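(* Over $\mathbb K=\mathbb C$, the monoidal category $\mathcal B_{\check\omega_3}(7)$ is isomorphic, as a monoidal category, to the diagram category $\mathscr T_\Gamma$ of Benkart and Elduque (the 3-tangle category of the cross product on $\mathbb C^7$), both being described by generators and relations in the context.
   Context: **Brauer category.** $\mathcal B(\delta)$ is the $\mathbb C$-linear strict monoidal category with objects $v^r$ (written $r$), $r\in\mathbb N$; $\mathrm{Hom}(r,s)$ has as basis the Brauer diagrams (perfect matchings of $r$ bottom and $s$ top points), $BA$ is obtained by stacking $B$ on top of $A$ and replacing each closed loop by $\delta$, and $\otimes$ is juxtaposition. $I$ is the identity of $1$, $X:2\to2$ the crossing, $\cap:2\to0$, $\cup:0\to2$, $E=\cup\cap$; $X(r,s):r+s\to s+r$ is the crossing of a block of $r$ parallel strands with a block of $s$ parallel strands. **$\mathcal B_{\check\omega_3}(7)$** is the $\mathbb C$-linear strict monoidal category obtained from $\mathcal B(7)$ by freely adjoining morphisms (coupons) $\check\omega_3:0\to3$ and $\mathbb H:2\to2$, subject to: (i) sliding: for each coupon $g:p\to q$ and $c\in\mathbb N$, $X(c,q)(I^{\otimes c}\otimes g)=(g\otimes I^{\otimes c})X(c,p)$ and $X(q,c)(g\otimes I^{\otimes c})=(I^{\otimes c}\otimes g)X(p,c)$; (ii) $\mathbb H$ equals its rotation by $180^\circ$ using nested cups and caps; (iii) $X\mathbb H=\mathbb HX$; (iv) $(I\otimes\cap\otimes I)(X\otimes\mathbb H)(I\otimes\cup\otimes I)=-\mathbb H=(I\otimes\cap\otimes I)(\mathbb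 H\otimes X)(I\otimes\cup\otimes I)$; (v) with $\mathbb H_{12}=\mathbb H\otimes I$, $\mathbb H_{23}=I\otimes\mathbb H$, $\mathbb H_{13}=(I\otimes X)(\mathbb H\otimes I)(I\otimes X)$: $[\mathbb H_{12},\mathbb H_{13}+\mathbb H_{23}]=0=[\mathbb H_{12}+\mathbb H_{13},\mathbb H_{23}]$; (vi) $(X\otimes I)\check\omega_3=(I\otimes X)\check\omega_3=-\check\omega_3$; (vii) with $\Upsilon=(I\otimes I\otimes\cap)(\check\omega_3\otimes I):1\to2$ and $\hat\Upsilon=(I\otimes\cap)(\Upsilon\otimes I):2\to1$: $\hat\Upsilon\Upsilon=6I$ and $\mathbb H=X-2E+I\otimes I-\Upsilon\hat\Upsilon$. **$\mathscr T_\Gamma$** has objects $r\in\mathbb N$ and is the $\mathbb C$-linear strict monoidal category generated by the Brauer generators $I,X,\cup,\cap$ with their usual relations (loop value $7$; relation $\gamma_0$) and one additional trivalent-vertex morphism $\Upsilon':1\to2$, compatible with isotopy: the two ways of bending it agree, $(\cap\otimes I)(I\otimes\Upsilon')=(I\otimes\cap)(\Upsilon'\otimes I)=:\hat\Upsilon'$, and strands can be slid over it, $X(1,2)(I\otimes\Upsilon')=(\Upsilon'\otimes I)X$ and $X(2,1)(\Upsilon'\otimes I)=(I\otimes\Upsilon')X$; subject further to $(\gamma_1)$ skew symmetry $X\Upsilon'=-\Upsilon'$, and $(\gamma_2)$ $\Upsilon'\hat\Upsilon'+(I\otimes\hat\Upsilon')(\Upsilon'\otimes I)=2X-E-I\otimes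 I$. *)

(* Defs.v *)
From HB Require Import structures.
From mathcomp Require Import all_boot all_order all_algebra.
From mathcomp Require Import generic_quotient.
From mathcomp Require Import boolp reals.
From mathcomp Require Import complex.

Set Implicit Arguments.
Unset Strict Implicit.
Unset Printing Implicit Defensive.

Import GRing.Theory.
Local Open Scope ring_scope.

(* Equality in [arrow hom] compares morphisms whose sources and targets are
   only propositionally equal, such as the two sides of strict associativity. *)
Inductive arrow (K : fieldType) (O : Type) (hom : O -> O -> lmodType K) :
    Type := Arrow a b of hom a b.
Arguments Arrow {K O} hom {a b} _.

Record linMonCat (K : fieldType) := LinMonCat {
  obj : Type;
  hom : obj -> obj -> lmodType K;
  unitO : obj;
  tensO : obj -> obj -> obj;
  idm : forall a, hom a a;
  comp : forall a b c, hom b c -> hom a b -> hom a c;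
  tensm : forall a b c d, hom a b -> hom c d -> hom (tensO a c) (tensO b d);
  comp_linl : forall a b c (f : hom a b), linear (fun g : hom b c => comp g f);
  comp_linr : forall a b c (g : hom b c), linear (fun f : hom a b => comp g f);
  tens_linl : forall a b c d (g : hom c d),
    linear (fun f : hom a b => tensm f g);
  tens_linr : forall a b c d (f : hom a b),
    linear (fun g : hom c d => tensm f g);
  compA : forall a b c d (h : hom c d) (g : hom b c) (f : hom a b),
    comp h (comp g f) = comp (comp h g) f;
  comp1m : forall a b (f : hom a b), comp (idm b) f = f;
  compm1 : forall a b (f : hom a b), comp f (idm a) = f;
  tens_idm : forall a b, tensm (idm a) (idm b) = idm (tensO a b);
  tens_comp : forall a b c a' b' c' (g : hom b c) (f : hom a b)
      (g' : hom b' c') (f' : hom a' b'),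
    tensm (comp g f) (comp g' f') = comp (tensm g g') (tensm f f');
  tensOA : forall a b c, tensO a (tensO b c) = tensO (tensO a b) c;
  tensO1o : forall a, tensO unitO a = a;
  tensOo1 : forall a, tensO a unitO = a;
  tensmA : forall a b c d a' b' (f : hom a b) (g : hom c d) (h : hom a' b'),
    Arrow hom (tensm f (tensm g h)) = Arrow hom (tensm (tensm f g) h);
  tens1m : forall a b (f : hom a b),
    Arrow hom (tensm (idm unitO) f) = Arrow hom f;
  tensm1 : forall a b (f : hom a b),
    Arrow hom (tensm f (idm unitO)) = Arrow hom f
}.

Record linMonFunctor (K : fieldType) (A B : linMonCat K) := LinMonFunctor {
  fobj : obj A -> obj B;
  fhom : forall a b, hom a b -> hom (fobj a) (fobj b);
  fhom_lin : forall a b, linear (@fhom a b);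
  fhom_idm : forall a, fhom (idm a) = idm (fobj a);
  fhom_comp : forall a b c (g : hom b c) (f : hom a b),
    fhom (comp g f) = comp (fhom g) (fhom f);
  fobj_unit : fobj (unitO A) = unitO B;
  fobj_tens : forall a b, fobj (tensO a b) = tensO (fobj a) (fobj b);
  fhom_tens : forall a b c d (f : hom a b) (g : hom c d),
    Arrow (@hom _ B) (fhom (tensm f g)) =
    Arrow (@hom _ B) (tensm (fhom f) (fhom g))
}.

Definition inverse_functors (K : fieldType) (A B : linMonCat K)
    (F : linMonFunctor A B) (G : linMonFunctor B A) : Prop :=
  (forall a, fobj G (fobj F a) = a) /\
  (forall a b (f : hom a b),
    Arrow (@hom _ A) (fhom G (fhom F f)) = Arrow (@hom _ A) f).

Definition linMonIso (K : fieldType) (A B : linMonCat K) : Prop :=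
  exists (F : linMonFunctor A B) (G : linMonFunctor B A),
    inverse_functors F G /\ inverse_functors G F.

Inductive term (K : fieldType) (gen : nat -> nat -> Type) :
    nat -> nat -> Type :=
| TGen m n of gen m n : term K gen m n
| TId n : term K gen n n
| TComp m n p of term K gen n p & term K gen m n : term K gen m p
| TTens m n p q of term K gen m n & term K gen p q :
    term K gen (m + p)%N (n + q)%N
| TZero m n : term K gen m n
| TAdd m n of term K gen m n & term K gen m n : term K gen m n
| TScale m n of K & term K gen m n : term K gen m n.
Arguments TGen {K gen m n} _.
Arguments TId {K gen} n.
Arguments TZero {K gen m n}.

Declare Scope term_scope.
Delimit Scope term_scope with T.
Bind Scope term_scope with term.
Notation "g ∘ f" := (TComp g f)
  (at level 38, left associativity) : term_scope.
Notation "f ⊗ g" := (TTens f g)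
  (at level 37, left associativity) : term_scope.
Notation "f + g" := (TAdd f g) : term_scope.
Notation "a *: f" := (TScale a f) : term_scope.
Notation "- f" := (TScale (-1) f) : term_scope.
Notation "f - g" := (TAdd f (TScale (-1) g)) : term_scope.
Notation "0" := TZero : term_scope.

(* The congruence generated by [rel] and the axioms of linear strict monoidal
   categories.  It relates terms of a priori different types because
   strictness does; related terms have equal types (lemma [eqt_type]). *)
Inductive eqt (K : fieldType) (gen : nat -> nat -> Type)
    (rel : forall m n, term K gen m n -> term K gen m n -> Prop) :
    forall m n, term K gen m n -> forall m' n', term K gen m' n' -> Prop :=
| eqt_rel m n (f g : term K gen m n) : rel m n f g -> eqt rel f g
| eqt_refl m n (f : term K gen m n) : eqt rel f f
| eqt_sym m n (f : term K gen m n) m' n' (g : term K gen m' n') :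
    eqt rel f g -> eqt rel g f
| eqt_trans m n (f : term K gen m n) m' n' (g : term K gen m' n')
    m'' n'' (h : term K gen m'' n'') :
    eqt rel f g -> eqt rel g h -> eqt rel f h
| eqt_comp m n p (g : term K gen n p) (f : term K gen m n)
    m' n' p' (g' : term K gen n' p') (f' : term K gen m' n') :
    eqt rel g g' -> eqt rel f f' -> eqt rel (g ∘ f) (g' ∘ f')
| eqt_tens m n p q (f : term K gen m n) (g : term K gen p q)
    m' n' p' q' (f' : term K gen m' n') (g' : term K gen p' q') :
    eqt rel f f' -> eqt rel g g' -> eqt rel (f ⊗ g) (f' ⊗ g')
| eqt_add m n (f g : term K gen m n) m' n' (f' g' : term K gen m' n') :
    eqt rel f f' -> eqt rel g g' -> eqt rel (f + g)%T (f' + g')%T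
| eqt_scale a m n (f : term K gen m n) m' n' (f' : term K gen m' n') :
    eqt rel f f' -> eqt rel (a *: f)%T (a *: f')%T
| eqt_addA m n (f g h : term K gen m n) :
    eqt rel (f + (g + h))%T (f + g + h)%T
| eqt_addC m n (f g : term K gen m n) : eqt rel (f + g)%T (g + f)%T
| eqt_add0 m n (f : term K gen m n) : eqt rel (0 + f)%T f
| eqt_addN m n (f : term K gen m n) : eqt rel (- f + f)%T (@TZero K gen m n)
| eqt_scaleA a b m n (f : term K gen m n) :
    eqt rel (a *: (b *: f))%T ((a * b)%R *: f)%T
| eqt_scale1 m n (f : term K gen m n) : eqt rel (1%R *: f)%T f
| eqt_scaleDr a m n (f g : term K gen m n) :
    eqt rel (a *: (f + g))%T (a *: f + a *: g)%T
| eqt_scaleDl a b m n (f : term K gen m n) :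
    eqt rel ((a + b)%R *: f)%T (a *: f + b *: f)%T
| eqt_compA m n p q (h : term K gen p q) (g : term K gen n p)
    (f : term K gen m n) : eqt rel (h ∘ (g ∘ f)) (h ∘ g ∘ f)
| eqt_comp1m m n (f : term K gen m n) : eqt rel (TId n ∘ f) f
| eqt_compm1 m n (f : term K gen m n) : eqt rel (f ∘ TId m) f
| eqt_comp_linl a m n p (g g' : term K gen n p) (f : term K gen m n) :
    eqt rel ((a *: g + g') ∘ f)%T (a *: (g ∘ f) + g' ∘ f)%T
| eqt_comp_linr a m n p (g : term K gen n p) (f f' : term K gen m n) :
    eqt rel (g ∘ (a *: f + f'))%T (a *: (g ∘ f) + g ∘ f')%T
| eqt_tens_linl a m n p q (f f' : term K gen m n) (g : term K gen p q) :
    eqt rel ((a *: f + f') ⊗ g)%T (a *: (f ⊗ g) + f' ⊗ g)%T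
| eqt_tens_linr a m n p q (f : term K gen m n) (g g' : term K gen p q) :
    eqt rel (f ⊗ (a *: g + g'))%T (a *: (f ⊗ g) + f ⊗ g')%T
| eqt_tens_id m n : eqt rel (TId m ⊗ TId n) (@TId K gen (m + n)%N)
| eqt_tens_comp m n p m' n' p' (g : term K gen n p) (f : term K gen m n)
    (g' : term K gen n' p') (f' : term K gen m' n') :
    eqt rel ((g ∘ f) ⊗ (g' ∘ f')) ((g ⊗ g') ∘ (f ⊗ f'))
| eqt_tensA m n p q m' n' (f : term K gen m n) (g : term K gen p q)
    (h : term K gen m' n') : eqt rel (f ⊗ (g ⊗ h)) (f ⊗ g ⊗ h)
| eqt_tens1m m n (f : term K gen m n) : eqt rel (TId 0 ⊗ f) f
| eqt_tensm1 m n (f : term K gen m n) : eqt rel (f ⊗ TId 0) f.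

Section Presented.
Context (K : fieldType) (gen : nat -> nat -> Type)
  (rel : forall m n, term K gen m n -> term K gen m n -> Prop).

Lemma eqt_type m n (f : term K gen m n) m' n' (g : term K gen m' n') :
  eqt rel f g -> m = m' /\ n = n'.
Proof.
elim=> //=.
- by move=> ? ? ? ? ? ? _ [-> ->].
- by move=> ? ? ? ? ? ? ? ? ? _ [-> ->] _ [-> ->].
- by move=> ? ? ? ? ? ? ? ? ? ? _ [_ ->] _ [-> _].
- by move=> ? ? ? ? ? ? ? ? ? ? ? ? _ [-> ->] _ [-> ->].
- by move=> *; rewrite !addnA.
- by move=> *; rewrite !addn0.
Qed.

Definition eqtb m n : {classic term K gen m n} ->
    {classic term K gen m n} -> bool := fun f g => `[< eqt rel f g >].

Lemma eqtb_refl m n : reflexive (@eqtb m n).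
Proof. by move=> f; apply/asboolP/eqt_refl. Qed.

Lemma eqtb_sym m n : symmetric (@eqtb m n).
Proof. by move=> f g; apply/asboolP/asboolP; apply: eqt_sym. Qed.

Lemma eqtb_trans m n : transitive (@eqtb m n).
Proof.
by move=> g f h /asboolP fg /asboolP gh; apply/asboolP; apply: eqt_trans fg gh.
Qed.

Canonical eqtb_equiv m n :=
  EquivRel (@eqtb m n) (@eqtb_refl m n) (@eqtb_sym m n) (@eqtb_trans m n).

Definition phom m n := {eq_quot (@eqtb_equiv m n)}%qT.
HB.instance Definition _ m n := Choice.on (phom m n).

Definition tcl m n (f : term K gen m n) : phom m n :=
  (\pi_(phom m n) (f : {classic term K gen m n}))%qT.
Definition trep m n (u : phom m n) : term K gen m n := repr u.

Lemma trepK m n (u : phom m n) : tcl (trep u) = u.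
Proof. exact: reprK. Qed.

Lemma tcl_eq m n (f g : term K gen m n) : tcl f = tcl g <-> eqt rel f g.
Proof.
split=> [|fg]; first by move/eqquotP/asboolP.
by apply/eqquotP/asboolP.
Qed.

Lemma trep_tcl m n (f : term K gen m n) : eqt rel (trep (tcl f)) f.
Proof. by apply/tcl_eq; rewrite trepK. Qed.

Definition padd m n (u v : phom m n) : phom m n := tcl (trep u + trep v)%T.
Definition popp m n (u : phom m n) : phom m n := tcl (- trep u)%T.
Definition pscale m n (a : K) (u : phom m n) : phom m n :=
  tcl (a *: trep u)%T.
Definition pcomp m n p (v : phom n p) (u : phom m n) : phom m p :=
  tcl (trep v ∘ trep u).
Definition ptens m n p q (u : phom m n) (v : phom p q) :
  phom (m + p)%N (n + q)%N := tcl (trep u ⊗ trep v).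

Lemma tclD m n (f g : term K gen m n) : padd (tcl f) (tcl g) = tcl (f + g)%T.
Proof. by apply/tcl_eq/eqt_add; apply: trep_tcl. Qed.

Lemma tclN m n (f : term K gen m n) : popp (tcl f) = tcl (- f)%T.
Proof. by apply/tcl_eq/eqt_scale; apply: trep_tcl. Qed.

Lemma tclZ m n a (f : term K gen m n) : pscale a (tcl f) = tcl (a *: f)%T.
Proof. by apply/tcl_eq/eqt_scale; apply: trep_tcl. Qed.

Lemma tcl_comp m n p (g : term K gen n p) (f : term K gen m n) :
  pcomp (tcl g) (tcl f) = tcl (g ∘ f).
Proof. by apply/tcl_eq/eqt_comp; apply: trep_tcl. Qed.

Lemma tcl_tens m n p q (f : term K gen m n) (g : term K gen p q) :
  ptens (tcl f) (tcl g) = tcl (f ⊗ g).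
Proof. by apply/tcl_eq/eqt_tens; apply: trep_tcl. Qed.

Lemma paddA m n : associative (@padd m n).
Proof.
move=> u v w; rewrite -(trepK u) -(trepK v) -(trepK w) !tclD.
exact/tcl_eq/eqt_addA.
Qed.

Lemma paddC m n : commutative (@padd m n).
Proof.
by move=> u v; rewrite -(trepK u) -(trepK v) !tclD; apply/tcl_eq/eqt_addC.
Qed.

Lemma padd0 m n : left_id (tcl (@TZero K gen m n)) (@padd m n).
Proof. by move=> u; rewrite -(trepK u) tclD; apply/tcl_eq/eqt_add0. Qed.

Lemma paddN m n :
  left_inverse (tcl (@TZero K gen m n)) (@popp m n) (@padd m n).
Proof. by move=> u; rewrite -(trepK u) tclN tclD; apply/tcl_eq/eqt_addN. Qed.

HB.instance Definition _ m n :=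
  GRing.isZmodule.Build (phom m n) (@paddA m n) (@paddC m n)
    (@padd0 m n) (@paddN m n).

Lemma pscaleA m n a b (u : phom m n) :
  pscale a (pscale b u) = pscale (a * b) u.
Proof. by rewrite -(trepK u) !tclZ; apply/tcl_eq/eqt_scaleA. Qed.

Lemma pscale1 m n : left_id 1 (@pscale m n).
Proof. by move=> u; rewrite -(trepK u) tclZ; apply/tcl_eq/eqt_scale1. Qed.

Lemma pscaleDr m n : right_distributive (@pscale m n) +%R.
Proof.
move=> a u v; rewrite -(trepK u) -(trepK v).
rewrite /GRing.add /= !(tclZ, tclD); exact/tcl_eq/eqt_scaleDr.
Qed.

Lemma pscaleDl m n (u : phom m n) : {morph (@pscale m n)^~ u : a b / a + b}.
Proof.
move=> a b; rewrite -(trepK u) /= !tclZ.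
by rewrite [RHS]tclD; apply/tcl_eq/eqt_scaleDl.
Qed.

HB.instance Definition _ m n :=
  GRing.Zmodule_isLmodule.Build K (phom m n) (@pscaleA m n) (@pscale1 m n)
    (@pscaleDr m n) (@pscaleDl m n).

Definition plmod m n : lmodType K := phom m n.

Lemma tcl_arrow m n (f : term K gen m n) m' n' (g : term K gen m' n') :
  eqt rel f g -> Arrow plmod (tcl f) = Arrow plmod (tcl g).
Proof.
move=> fg; have [em en] := eqt_type fg.
by subst m' n'; congr (Arrow plmod); apply/tcl_eq.
Qed.

Lemma tcl_lin a m n (f g : term K gen m n) :
  a *: tcl f + tcl g = tcl (a *: f + g)%T.
Proof.
have : padd (pscale a (tcl f)) (tcl g) = tcl (a *: f + g)%T.
  by rewrite tclZ tclD.
exact.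
Qed.

Lemma pcomp_linl m n p (u : phom m n) :
  linear (fun v : phom n p => pcomp v u).
Proof.
move=> a v v'; rewrite -(trepK u) -(trepK v) -(trepK v').
rewrite tcl_lin !tcl_comp tcl_lin.
exact/tcl_eq/eqt_comp_linl.
Qed.

Lemma pcomp_linr m n p (v : phom n p) :
  linear (fun u : phom m n => pcomp v u).
Proof.
move=> a u u'; rewrite -(trepK u) -(trepK v) -(trepK u').
rewrite tcl_lin !tcl_comp tcl_lin.
exact/tcl_eq/eqt_comp_linr.
Qed.

Lemma ptens_linl m n p q (v : phom p q) :
  linear (fun u : phom m n => ptens u v).
Proof.
move=> a u u'; rewrite -(trepK u) -(trepK v) -(trepK u').
rewrite tcl_lin !tcl_tens tcl_lin.
exact/tcl_eq/eqt_tens_linl.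
Qed.

Lemma ptens_linr m n p q (u : phom m n) :
  linear (fun v : phom p q => ptens u v).
Proof.
move=> a v v'; rewrite -(trepK u) -(trepK v) -(trepK v').
rewrite tcl_lin !tcl_tens tcl_lin.
exact/tcl_eq/eqt_tens_linr.
Qed.

Lemma pcompA m n p q (w : phom p q) (v : phom n p) (u : phom m n) :
  pcomp w (pcomp v u) = pcomp (pcomp w v) u.
Proof.
rewrite -(trepK u) -(trepK v) -(trepK w) !tcl_comp.
exact/tcl_eq/eqt_compA.
Qed.

Lemma pcomp1m m n (u : phom m n) : pcomp (tcl (TId n)) u = u.
Proof. by rewrite -(trepK u) tcl_comp; apply/tcl_eq/eqt_comp1m. Qed.

Lemma pcompm1 m n (u : phom m n) : pcomp u (tcl (TId m)) = u.
Proof. by rewrite -(trepK u) tcl_comp; apply/tcl_eq/eqt_compm1. Qed.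

Lemma ptens_id m n : ptens (tcl (TId m)) (tcl (TId n)) = tcl (TId (m + n)%N).
Proof. by rewrite tcl_tens; apply/tcl_eq/eqt_tens_id. Qed.

Lemma ptens_comp m n p m' n' p' (v : phom n p) (u : phom m n)
    (v' : phom n' p') (u' : phom m' n') :
  ptens (pcomp v u) (pcomp v' u') = pcomp (ptens v v') (ptens u u').
Proof.
rewrite -(trepK u) -(trepK v) -(trepK u') -(trepK v').
by rewrite !(tcl_comp, tcl_tens); apply/tcl_eq/eqt_tens_comp.
Qed.

Lemma ptensA m n p q m' n' (u : phom m n) (v : phom p q) (w : phom m' n') :
  Arrow plmod (ptens u (ptens v w)) =
  Arrow plmod (ptens (ptens u v) w).
Proof.
rewrite -(trepK u) -(trepK v) -(trepK w) !tcl_tens.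
exact/tcl_arrow/eqt_tensA.
Qed.

Lemma ptens1m m n (u : phom m n) :
  Arrow plmod (ptens (tcl (TId 0)) u) = Arrow plmod u.
Proof. by rewrite -(trepK u) tcl_tens; apply/tcl_arrow/eqt_tens1m. Qed.

Lemma ptensm1 m n (u : phom m n) :
  Arrow plmod (ptens u (tcl (TId 0))) = Arrow plmod u.
Proof. by rewrite -(trepK u) tcl_tens; apply/tcl_arrow/eqt_tensm1. Qed.

Definition presented : linMonCat K :=
  @LinMonCat K nat plmod 0%N addn (fun n => tcl (TId n)) pcomp ptens
    pcomp_linl pcomp_linr ptens_linl ptens_linr pcompA pcomp1m pcompm1
    ptens_id ptens_comp addnA add0n addn0 ptensA ptens1m ptensm1.

End Presented.

(* [inl i] is the [i]-th bottom point, [inr j] the [j]-th top point. *)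
Definition boundary (r s : nat) : finType := ('I_r + 'I_s)%type.

(* A perfect matching, as a fixed-point-free involution. *)
Definition is_matching (r s : nat)
    (f : {ffun boundary r s -> boundary r s}) : bool :=
  [forall x, (f (f x) == x) && (f x != x)].

Record brauer (r s : nat) := Brauer {
  partner :> {ffun boundary r s -> boundary r s};
  partnerP : is_matching partner
}.

HB.instance Definition _ r s := [isSub for @partner r s].
HB.instance Definition _ r s := [Finite of brauer r s by <:].

Definition id_fun (r : nat) (x : boundary r r) : boundary r r :=
  match x with inl i => inr i | inr i => inl i end.

Lemma id_matching r : is_matching [ffun x => @id_fun r x].
Proof. by apply/forallP => -[] i; rewrite !ffunE /= eqxx. Qed.

Definition br_id r : brauer r r := Brauer (id_matching r).

Definition cross_fun (r s : nat) (x : boundary (r + s) (s + r)) :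
    boundary (r + s) (s + r) :=
  match x with
  | inl i => inr (match split i with
                  | inl a => rshift s a
                  | inr b => lshift r b
                  end)
  | inr k => inl (match split k with
                  | inl b => rshift r b
                  | inr a => lshift s a
                  end)
  end.

Lemma cross_matching r s : is_matching [ffun x => @cross_fun r s x].
Proof.
apply/forallP => -[] i; rewrite !ffunE /= andbT;
  apply/eqP; congr (_ _); case: (split_ordP i) => j ->.
- by rewrite (unsplitK (inr j : 'I_s + 'I_r)).
- by rewrite (unsplitK (inl j : 'I_s + 'I_r)).
- by rewrite (unsplitK (inr j : 'I_r + 'I_s)).
- by rewrite (unsplitK (inl j : 'I_r + 'I_s)).
Qed.

Definition br_cross r s : brauer (r + s) (s + r) :=
  Brauer (cross_matching r s).

Definition cap_fun (x : boundary 2 0) : boundary 2 0 :=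
  match x with inl i => inl (rev_ord i) | inr k => inr k end.

Lemma cap_matching : is_matching [ffun x => cap_fun x].
Proof.
apply/forallP => -[i|[[]//]]; rewrite !ffunE; apply/andP; split.
  by rewrite /= rev_ordK.
by case: i => -[|[|//]].
Qed.

Definition br_cap : brauer 2 0 := Brauer cap_matching.

Definition cup_fun (x : boundary 0 2) : boundary 0 2 :=
  match x with inl k => inl k | inr i => inr (rev_ord i) end.

Lemma cup_matching : is_matching [ffun x => cup_fun x].
Proof.
apply/forallP => -[[[]//]|i]; rewrite !ffunE; apply/andP; split.
  by rewrite /= rev_ordK.
by case: i => -[|[|//]].
Qed.

Definition br_cup : brauer 0 2 := Brauer cup_matching.

Section Stacking.
Context (r s t : nat) (B : brauer s t) (A : brauer r s).

(* Points of the stack of [B] on top of [A]: the bottom points of [A], the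
   [s] identified middle points, and the top points of [B]. *)
Definition stack_point : finType := ('I_r + 'I_s + 'I_t)%type.

Definition lower_point (x : boundary r s) : stack_point := inl x.

Definition upper_point (x : boundary s t) : stack_point :=
  match x with inl j => inl (inr j) | inr k => inr k end.

Definition outer_point (x : boundary r t) : stack_point :=
  match x with inl i => inl (inl i) | inr k => inr k end.

Definition stack_edge : rel stack_point := fun x y =>
  [exists a, (x == lower_point a) && (y == lower_point (A a))] ||
  [exists b, (x == upper_point b) && (y == upper_point (B b))].

(* The components of the stack are loops through middle points and paths with
   two distinct outer ends, so exactly one [D] satisfies this. *)
Definition is_stack (D : brauer r t) : bool :=
  [forall x, forall y, (D x == y) ==
    (x != y) && connect stack_edge (outer_point x) (outer_point y)].

(* A closed loop is a component without outer point. *)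
Definition stack_loops : nat :=
  n_comp stack_edge
    [pred p | ~~ [exists x, connect stack_edge p (outer_point x)]].

End Stacking.

Section Juxtaposition.
Context (r s r' s' : nat).

Definition left_point (x : boundary r s) : boundary (r + r') (s + s') :=
  match x with inl i => inl (lshift r' i) | inr j => inr (lshift s' j) end.

Definition right_point (x : boundary r' s') : boundary (r + r') (s + s') :=
  match x with inl i => inl (rshift r i) | inr j => inr (rshift s j) end.

(* Every boundary point is a left or a right one, so this determines [D]. *)
Definition is_juxtaposition (A : brauer r s) (B : brauer r' s')
    (D : brauer (r + r') (s + s')) : bool :=
  [forall x, D (left_point x) == left_point (A x)] &&
  [forall y, D (right_point y) == right_point (B y)].

End Juxtaposition.

Definition bhom (K : fieldType) (r s : nat) : lmodType K :=
  {ffun brauer r s -> K^o}.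

Definition bdiag (K : fieldType) (r s : nat) (D : brauer r s) : bhom K r s :=
  [ffun D' => (D' == D)%:R].
Arguments bdiag K {r s} D.

Definition bcomp (K : fieldType) (delta : K) (r s t : nat)
    (g : bhom K s t) (f : bhom K r s) : bhom K r t :=
  \sum_(B : brauer s t) \sum_(A : brauer r s)
    (g B * f A * delta ^+ stack_loops B A) *:
      \sum_(D | is_stack B A D) bdiag K D.

Definition btens (K : fieldType) (r s r' s' : nat)
    (f : bhom K r s) (g : bhom K r' s') : bhom K (r + r') (s + s') :=
  \sum_(A : brauer r s) \sum_(B : brauer r' s')
    (f A * g B) *: \sum_(D | is_juxtaposition A B D) bdiag K D.

Inductive omega3_gen (K : fieldType) : nat -> nat -> Type :=
| BMor r s of bhom K r s : omega3_gen K r s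
| Omega3 : omega3_gen K 0 3
| HCoupon : omega3_gen K 2 2.
Arguments Omega3 {K}.
Arguments HCoupon {K}.

Section Omega3.
Context (K : fieldType).
Local Open Scope term_scope.

Definition oterm := term K (omega3_gen K).
Definition obr r s (f : bhom K r s) : oterm r s := TGen (BMor f).

Definition oI : oterm 1 1 := TId 1.
Definition oXX r s : oterm (r + s)%N (s + r)%N :=
  obr (bdiag K (br_cross r s)).
Definition oX : oterm 2 2 := oXX 1 1.
Definition ocap : oterm 2 0 := obr (bdiag K br_cap).
Definition ocup : oterm 0 2 := obr (bdiag K br_cup).
Definition oE : oterm 2 2 := ocup ∘ ocap.
Definition oH : oterm 2 2 := TGen HCoupon.
Definition oomega : oterm 0 3 := TGen Omega3.

Definition ocup2 : oterm 0 4 := (oI ⊗ ocup ⊗ oI) ∘ ocup.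
Definition ocap2 : oterm 4 0 := ocap ∘ (oI ⊗ ocap ⊗ oI).

Definition oH12 : oterm 3 3 := oH ⊗ oI.
Definition oH23 : oterm 3 3 := oI ⊗ oH.
Definition oH13 : oterm 3 3 := (oI ⊗ oX) ∘ (oH ⊗ oI) ∘ (oI ⊗ oX).

Definition oY : oterm 1 2 := (oI ⊗ oI ⊗ ocap) ∘ (oomega ⊗ oI).
Definition oYhat : oterm 2 1 := (oI ⊗ ocap) ∘ (oY ⊗ oI).

Definition ocommutator (f g : oterm 3 3) : oterm 3 3 := f ∘ g - g ∘ f.

Inductive omega3_coupon : forall p q, oterm p q -> Prop :=
| coupon_omega : omega3_coupon oomega
| coupon_H : omega3_coupon oH.

Inductive omega3_rel : forall m n, oterm m n -> oterm m n -> Prop :=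
(* The first four relations make [BMor] a linear strict monoidal functor, so
   that this is the Brauer category with morphisms freely adjoined to it. *)
| omega3_br_lin a r s (f g : bhom K r s) :
    omega3_rel (obr (a *: f + g)%R) (a *: obr f + obr g)
| omega3_br_id r : omega3_rel (obr (bdiag K (br_id r))) (TId r)
| omega3_br_comp r s t (g : bhom K s t) (f : bhom K r s) :
    omega3_rel (obr (bcomp 7 g f)) (obr g ∘ obr f)
| omega3_br_tens r s r' s' (f : bhom K r s) (g : bhom K r' s') :
    omega3_rel (obr (btens f g)) (obr f ⊗ obr g)
| omega3_slide_l c p q (g : oterm p q) : omega3_coupon g ->
    omega3_rel (oXX c q ∘ (TId c ⊗ g)) ((g ⊗ TId c) ∘ oXX c p)
| omega3_slide_r c p q (g : oterm p q) : omega3_coupon g ->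
    omega3_rel (oXX q c ∘ (g ⊗ TId c)) ((TId c ⊗ g) ∘ oXX p c)
| omega3_H_rotate :
    omega3_rel oH
      ((oI ⊗ oI ⊗ ocap2) ∘ (oI ⊗ oI ⊗ oH ⊗ oI ⊗ oI) ∘ (ocup2 ⊗ oI ⊗ oI))
| omega3_H_sym : omega3_rel (oX ∘ oH) (oH ∘ oX)
| omega3_H_skew_l :
    omega3_rel ((oI ⊗ ocap ⊗ oI) ∘ (oX ⊗ oH) ∘ (oI ⊗ ocup ⊗ oI)) (- oH)
| omega3_H_skew_r :
    omega3_rel ((oI ⊗ ocap ⊗ oI) ∘ (oH ⊗ oX) ∘ (oI ⊗ ocup ⊗ oI)) (- oH)
| omega3_four_term_l : omega3_rel (ocommutator oH12 (oH13 + oH23)) 0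
| omega3_four_term_r : omega3_rel (ocommutator (oH12 + oH13) oH23) 0
| omega3_skew_l : omega3_rel ((oX ⊗ oI) ∘ oomega) (- oomega)
| omega3_skew_r : omega3_rel ((oI ⊗ oX) ∘ oomega) (- oomega)
| omega3_bubble : omega3_rel (oYhat ∘ oY) (6%R *: oI)
| omega3_H_def :
    omega3_rel oH (oX - 2%R *: oE + oI ⊗ oI - oY ∘ oYhat).

End Omega3.

Definition Bomega3_7 (K : fieldType) : linMonCat K :=
  presented (@omega3_rel K).

Inductive tangle_gen : nat -> nat -> Type :=
| TX : tangle_gen 2 2
| TCup : tangle_gen 0 2
| TCap : tangle_gen 2 0
| TY : tangle_gen 1 2.

Section Tangle.
Context (K : fieldType).
Local Open Scope term_scope.

Definition tterm := term K tangle_gen.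

Definition tI : tterm 1 1 := TId 1.
Definition tX : tterm 2 2 := TGen TX.
Definition tcup : tterm 0 2 := TGen TCup.
Definition tcap : tterm 2 0 := TGen TCap.
Definition tE : tterm 2 2 := tcup ∘ tcap.
Definition tY : tterm 1 2 := TGen TY.
Definition tYhat : tterm 2 1 := (tI ⊗ tcap) ∘ (tY ⊗ tI).
Definition tX12 : tterm 3 3 := (tI ⊗ tX) ∘ (tX ⊗ tI).
Definition tX21 : tterm 3 3 := (tX ⊗ tI) ∘ (tI ⊗ tX).

Inductive tangle_rel : forall m n, tterm m n -> tterm m n -> Prop :=
(* Up to and including [tangle_loop]: the usual presentation of the Brauer
   category, with loop value 7. *)
| tangle_XX : tangle_rel (tX ∘ tX) (tI ⊗ tI)
| tangle_braid :
    tangle_rel ((tX ⊗ tI) ∘ (tI ⊗ tX) ∘ (tX ⊗ tI))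
      ((tI ⊗ tX) ∘ (tX ⊗ tI) ∘ (tI ⊗ tX))
| tangle_zigzag_l : tangle_rel ((tcap ⊗ tI) ∘ (tI ⊗ tcup)) tI
| tangle_zigzag_r : tangle_rel ((tI ⊗ tcap) ∘ (tcup ⊗ tI)) tI
| tangle_cap_X : tangle_rel (tcap ∘ tX) tcap
| tangle_X_cup : tangle_rel (tX ∘ tcup) tcup
| tangle_slide_cap :
    tangle_rel ((tcap ⊗ tI) ∘ (tI ⊗ tX)) ((tI ⊗ tcap) ∘ (tX ⊗ tI))
| tangle_slide_cup :
    tangle_rel ((tI ⊗ tX) ∘ (tcup ⊗ tI)) ((tX ⊗ tI) ∘ (tI ⊗ tcup))
| tangle_loop : tangle_rel (tcap ∘ tcup) (7%R *: TId 0)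
| tangle_Y_bend : tangle_rel ((tcap ⊗ tI) ∘ (tI ⊗ tY)) tYhat
| tangle_Y_slide_l : tangle_rel (tX12 ∘ (tI ⊗ tY)) ((tY ⊗ tI) ∘ tX)
| tangle_Y_slide_r : tangle_rel (tX21 ∘ (tY ⊗ tI)) ((tI ⊗ tY) ∘ tX)
| tangle_Y_skew : tangle_rel (tX ∘ tY) (- tY)
| tangle_Y_square :
    tangle_rel (tY ∘ tYhat + (tI ⊗ tYhat) ∘ (tY ⊗ tI))
      (2%R *: tX - tE - tI ⊗ tI).

End Tangle.

Definition TGamma (K : fieldType) : linMonCat K :=
  presented (@tangle_rel K).

(* Main.v *)
Require Import Defs.
From mathcomp Require Import all_boot all_order all_algebra.
From mathcomp Require Import reals complex.
From HB Require Import structures.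
From mathcomp Require Import generic_quotient boolp zify.
Import Defs.

(** The isomorphism is the identity on objects and rescales the trivalent
    vertex.  Let [c ^ 2 = -1].  One functor sends a Brauer diagram to the
    tangle that it draws, [oomega] to [-c] times the bent vertex
    [(tY ⊗ tI) ∘ tcup], and [oH] to [tX - 2 tE + tI ⊗ tI + tY ∘ tYhat]; the
    other sends [tX], [tcup], [tcap] to the corresponding Brauer diagrams and
    [tY] to [c *: oY].  The factor [c] is forced up to sign: [oYhat ∘ oY] is
    [6 oI], whereas relation gamma_2 makes [tYhat ∘ tY] equal to [-6 tI].  On
    generators the two assignments are mutually inverse because of the zigzag
    relations and of the relation that defines [oH], so the whole content is
    that each of them respects the relations of its source.

    Three tools do this.

    First, coherence for the Brauer category given by generators and relations
    ([brauer_coherence]).  Every composite of crossings, cups and caps reduces,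
    after bending, to a list of labels in which each label occurs twice, joined
    by arcs ([join]); the same reduction is followed by the state sum [sem],
    which counts the colourings of the strands by two colours.  The state sum
    recovers the matching and the number of loops, so composites with the same
    state sum are equal.  The combinatorial side, where Brauer diagrams are
    involutions and loops are components of a graph, has the same state sums
    ([stack_exists], [juxtaposition_exists]).

    Second, diagrams with vertices.  On both sides the vertex is a bent
    totally antisymmetric vector in [Hom(0, 3)], past which strands slide: for
    [oomega] these are relations, for the tangle vertex consequences of
    isotopy and of gamma_1 ([tvec_slide], [tvec_skew]).  All vectors can be
    pulled out to the right, which leaves a Brauer diagram.  Hence an equality
    of two diagrams up to loops and up to a signed permutation of the legs of
    the vectors is decided by computation ([similar_interp]), and so is an
    equality of linear combinations modulo given multiples of a given relation
    ([reducesP]).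

    Third, the consequences of gamma_2.  The rotation, symmetry, skew symmetry
    and bubble relations follow by such computations.  For the four-term
    relation put [D = H12 + H13].  It acts on the last two strands like a
    derivation: it commutes with [I ⊗ X], annihilates [I ⊗ cup] and [I ⊗ cap],
    and satisfies [D (I ⊗ Y) = (I ⊗ Y) H] and its mirror image.  Since [H23]
    is built from [X], [cup], [cap], [Y] and [Yhat], it commutes with [D]
    ([deriv_comm]); the other four-term relation is the conjugate of this one
    by a cyclic permutation of the strands.

    Conversely gamma_2 holds for [c *: oY]: substitute the definition of [oH]
    into its skew symmetry and compose with the crossing
    ([omega_square]). *)

Set Implicit Arguments.
Unset Strict Implicit.
Unset Printing Implicit Defensive.
Import GRing.Theory.
Local Open Scope ring_scope.

Notation term_rel K gen :=
  (forall m n, term K gen m n -> term K gen m n -> Prop).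

(** * Morphisms of a presented category, with source and target forgotten *)
Section Arrows.
Context (K : fieldType) (gen : nat -> nat -> Type) (rel : term_rel K gen).

(** Strict associativity and unit laws relate terms of different types.  On
    arrows that carry their source and target they become Leibniz equations,
    by which one can rewrite without casts. *)
Definition uarrow := arrow (@plmod K gen rel).
Definition cls m n (f : term K gen m n) : uarrow :=
  Arrow (@plmod K gen rel) (tcl rel f).

Lemma clsP m n (f : term K gen m n) m' n' (g : term K gen m' n') :
  cls f = cls g <-> eqt rel f g.
Proof.
split=> [fg|]; last exact: tcl_arrow.
pose P (u : uarrow) := match u with Arrow _ _ h => eqt rel f (trep h) end.
have : P (cls g) by rewrite -fg /P /=; apply/eqt_sym/trep_tcl.
by move=> /= h; apply: eqt_trans h _; apply: trep_tcl.
Qed.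

Lemma Arrow_inj m n (f g : plmod rel m n) :
  Arrow (plmod rel) f = Arrow (plmod rel) g -> f = g.
Proof.
rewrite -(trepK f) -(trepK g) => fg.
by apply/tcl_eq/clsP.
Qed.

Definition src (u : uarrow) := let: Arrow a _ _ := u in a.
Definition tgt (u : uarrow) := let: Arrow _ b _ := u in b.

(** A section of [Arrow], zero on arrows with other ends. *)
Definition hom_of m n (u : uarrow) : plmod rel m n :=
  match pselect (exists h : plmod rel m n, Arrow (plmod rel) h = u) with
  | left e => projT1 (cid e)
  | right _ => 0
  end.

Lemma hom_ofK m n (h : plmod rel m n) : hom_of m n (Arrow (plmod rel) h) = h.
Proof.
rewrite /hom_of; case: pselect => [e|[]]; last by exists h.
by case: cid => h' /= /Arrow_inj.
Qed.

Lemma hom_of_arrow u m n : src u = m -> tgt u = n ->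
  Arrow (plmod rel) (hom_of m n u) = u.
Proof. by case: u => a b h /= <- <-; rewrite hom_ofK. Qed.

Lemma hom_of_mismatch u m n : src u <> m \/ tgt u <> n -> hom_of m n u = 0.
Proof.
rewrite /hom_of; case: pselect => [e|//] ne; exfalso; case: e => h e.
by case: ne; rewrite -e.
Qed.

(** A composite of mismatched arrows is zero.  This convention makes
    composition associative without side conditions; only the unit and
    interchange laws need matching ends. *)
Definition ucomp (g f : uarrow) : uarrow :=
  match g, f with
  | Arrow _ c _, Arrow a b f' => 
    Arrow (plmod rel) (pcomp (hom_of b c g) f')
  end.
Definition utens (f g : uarrow) : uarrow :=
  match f, g with
  | Arrow _ _ f', Arrow _ _ g' => Arrow (plmod rel) (ptens f' g')
  end.
Definition uscale (a : K) (f : uarrow) : uarrow :=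
  match f with Arrow _ _ f' => Arrow (plmod rel) (a *: f') end.
Definition uid n : uarrow := cls (TId n).

Local Notation "g ⊙ f" := (ucomp g f) (at level 38, left associativity).
Local Notation "f ⊠ g" := (utens f g) (at level 37, left associativity).

Section LinearMaps.
Context (U V : lmodType K) (f : U -> V) (f_lin : linear f).
Lemma lin0 : f 0 = 0.
Proof. by have := f_lin (-1) 0 0; rewrite scaler0 addr0 scaleN1r addNr. Qed.
Lemma linZ a u : f (a *: u) = a *: f u.
Proof. by rewrite -[a *: u]addr0 f_lin lin0 addr0. Qed.
Lemma linD u v : f (u + v) = f u + f v.
Proof. by rewrite -{1}[u]scale1r f_lin scale1r. Qed.
End LinearMaps.

Section Bilinearity.
Context (a : K) (m n p q : nat).
Implicit Types (f : plmod rel m n) (g : plmod rel n p) (h : plmod rel p q).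
Lemma pcomp0l f : pcomp (0 : plmod rel n p) f = 0.
Proof. exact: lin0 (pcomp_linl f). Qed.
Lemma pcomp0r g : pcomp g (0 : plmod rel m n) = 0.
Proof. exact: lin0 (pcomp_linr g). Qed.
Lemma pcompZl g f : pcomp (a *: g) f = a *: pcomp g f.
Proof. exact: linZ (pcomp_linl f) a g. Qed.
Lemma pcompZr g f : pcomp g (a *: f) = a *: pcomp g f.
Proof. exact: linZ (pcomp_linr g) a f. Qed.
Lemma pcompDl g g' f : pcomp (g + g') f = pcomp g f + pcomp g' f.
Proof. exact: linD (pcomp_linl f) g g'. Qed.
Lemma pcompDr g f f' : pcomp g (f + f') = pcomp g f + pcomp g f'.
Proof. exact: linD (pcomp_linr g) f f'. Qed.
Lemma ptens0l h : ptens (0 : plmod rel m n) h = 0.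
Proof. exact: lin0 (ptens_linl h). Qed.
Lemma ptens0r f : ptens f (0 : plmod rel p q) = 0.
Proof. exact: lin0 (ptens_linr f). Qed.
Lemma ptensZl f h : ptens (a *: f) h = a *: ptens f h.
Proof. exact: linZ (ptens_linl h) a f. Qed.
Lemma ptensZr f h : ptens f (a *: h) = a *: ptens f h.
Proof. exact: linZ (ptens_linr f) a h. Qed.
Lemma ptensDl f f' h : ptens (f + f') h = ptens f h + ptens f' h.
Proof. exact: linD (ptens_linl h) f f'. Qed.
Lemma ptensDr f h h' : ptens f (h + h') = ptens f h + ptens f h'.
Proof. exact: linD (ptens_linr f) h h'. Qed.
End Bilinearity.

Lemma ucompE m n p (g : plmod rel n p) (f : plmod rel m n) :
  Arrow (plmod rel) g ⊙ Arrow (plmod rel) f = Arrow (plmod rel) (pcomp g f).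
Proof. by rewrite /= hom_ofK. Qed.

Lemma cls_comp m n p (g : term K gen n p) (f : term K gen m n) :
  cls (TComp g f) = cls g ⊙ cls f.
Proof. by rewrite ucompE /= tcl_comp. Qed.
Lemma cls_tens m n p q (g : term K gen n p) (f : term K gen m q) :
  cls (TTens g f) = cls g ⊠ cls f.
Proof. by rewrite /= tcl_tens. Qed.

Lemma tcl_scale a m n (f : term K gen m n) :
  tcl rel (TScale a f) = a *: (tcl rel f : plmod rel m n).
Proof. by rewrite -tclZ. Qed.
Lemma tcl_add m n (f g : term K gen m n) :
  tcl rel (TAdd f g) = (tcl rel f : plmod rel m n) + tcl rel g.
Proof. by rewrite -tclD. Qed.
Lemma cls_scale a m n (f : term K gen m n) :
  cls (TScale a f) = uscale a (cls f).
Proof. by rewrite /cls /= tcl_scale. Qed.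

Lemma src_comp g f : src (g ⊙ f) = src f.
Proof. by case: g f => ? ? ? [? ? ?]. Qed.
Lemma tgt_comp g f : tgt (g ⊙ f) = tgt g.
Proof. by case: g f => ? ? ? [? ? ?]. Qed.
Lemma src_tens g f : src (g ⊠ f) = (src g + src f)%N.
Proof. by case: g f => ? ? ? [? ? ?]. Qed.
Lemma tgt_tens g f : tgt (g ⊠ f) = (tgt g + tgt f)%N.
Proof. by case: g f => ? ? ? [? ? ?]. Qed.
Lemma src_scale a f : src (uscale a f) = src f. Proof. by case: f. Qed.
Lemma tgt_scale a f : tgt (uscale a f) = tgt f. Proof. by case: f. Qed.

Lemma ucompA h g f : h ⊙ (g ⊙ f) = (h ⊙ g) ⊙ f.
Proof.
case: h g f => [c' d h] [b' c g] [a b f].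
have [e|ne] := eqVneq b' b; last first.
  have /eqP ne' := ne.
  rewrite /= [hom_of b c _]hom_of_mismatch; last by left.
  rewrite [hom_of b d _]hom_of_mismatch; last by left.
  by rewrite pcomp0l pcomp0r pcomp0l.
subst b'; rewrite ucompE.
have [e|/eqP ne] := eqVneq c' c; first by subst c'; rewrite !ucompE pcompA.
rewrite /= [hom_of c d _]hom_of_mismatch; last by left.
by rewrite !pcomp0l hom_ofK pcomp0l.
Qed.

Lemma ucomp1m f n : tgt f = n -> uid n ⊙ f = f.
Proof. by case: f => a b f /= <-; rewrite hom_ofK pcomp1m. Qed.
Lemma ucompm1 f n : src f = n -> f ⊙ uid n = f.
Proof. by case: f => a b f /= <-; rewrite hom_ofK pcompm1. Qed.
Lemma utensA f g h : f ⊠ (g ⊠ h) = f ⊠ g ⊠ h.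
Proof. by case: f g h => ? ? ? [? ? ?] [? ? ?] /=; rewrite ptensA. Qed.
Lemma utens1m f : uid 0 ⊠ f = f.
Proof. by case: f => ? ? ?; exact: ptens1m. Qed.
Lemma utensm1 f : f ⊠ uid 0 = f.
Proof. by case: f => ? ? ?; exact: ptensm1. Qed.
Lemma utens_id m n : uid m ⊠ uid n = uid (m + n).
Proof. by rewrite /uid /= ptens_id. Qed.

Lemma uinter g f g' f' : src g = tgt f -> src g' = tgt f' ->
  (g ⊙ f) ⊠ (g' ⊙ f') = (g ⊠ g') ⊙ (f ⊠ f').
Proof.
case: g f g' f' => [b c g] [a b1 f] [b' c' g'] [a' b1' f'] /= e e'.
by subst b1 b1'; rewrite !hom_ofK ptens_comp.
Qed.

Lemma uscaleA a b f : uscale a (uscale b f) = uscale (a * b) f.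
Proof. by case: f => ? ? ? /=; rewrite scalerA. Qed.
Lemma uscale1 f : uscale 1 f = f.
Proof. by case: f => ? ? ? /=; rewrite scale1r. Qed.
Lemma hom_ofZ a m n f : hom_of m n (uscale a f) = a *: hom_of m n f.
Proof.
have [[<- <-]|h] := pselect (src f = m /\ tgt f = n).
  by case: f => ? ? ? /=; rewrite !hom_ofK.
have {}h : src f <> m \/ tgt f <> n.
  exact/not_andP.
by rewrite !hom_of_mismatch ?scaler0 // src_scale tgt_scale.
Qed.
Lemma ucompZl a g f : uscale a g ⊙ f = uscale a (g ⊙ f).
Proof.
case: g f => b' c g [a' b f].
by rewrite /= (hom_ofZ a b c (Arrow (plmod rel) g)) pcompZl.
Qed.
Lemma ucompZr a g f : g ⊙ uscale a f = uscale a (g ⊙ f).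
Proof. by case: g f => b' c g [a' b f]; rewrite /= pcompZr. Qed.
Lemma utensZl a g f : uscale a g ⊠ f = uscale a (g ⊠ f).
Proof. by case: g f => b' c g [a' b f]; rewrite /= ptensZl. Qed.
Lemma utensZr a g f : g ⊠ uscale a f = uscale a (g ⊠ f).
Proof. by case: g f => b' c g [a' b f]; rewrite /= ptensZr. Qed.

(** Whiskering: every morphism used below is a composite of generators placed
    between identity strands. *)
Definition wh a f b := uid a ⊠ f ⊠ uid b.

Lemma src_wh a f b : src (wh a f b) = (a + src f + b)%N.
Proof. by rewrite !src_tens. Qed.
Lemma tgt_wh a f b : tgt (wh a f b) = (a + tgt f + b)%N.
Proof. by rewrite !tgt_tens. Qed.
Lemma src_id n : src (uid n) = n. Proof. by []. Qed.
Lemma tgt_id n : tgt (uid n) = n. Proof. by []. Qed.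

Lemma wh_comp a b g f : src g = tgt f -> wh a (g ⊙ f) b = wh a g b ⊙ wh a f b.
Proof.
move=> e; rewrite /wh -uinter ?src_tens ?tgt_tens ?e // -uinter //.
by rewrite !ucomp1m.
Qed.

Lemma wh_wh a a' b b' f : wh a (wh a' f b') b = wh (a + a') f (b' + b).
Proof. by rewrite /wh !utensA utens_id -[LHS]utensA utens_id. Qed.

Lemma wh_id a n b : wh a (uid n) b = uid (a + n + b).
Proof. by rewrite /wh !utens_id. Qed.
Lemma wh00 f : wh 0 f 0 = f.
Proof. by rewrite /wh utens1m utensm1. Qed.
Lemma whZ a c f b : wh a (uscale c f) b = uscale c (wh a f b).
Proof. by rewrite /wh utensZr utensZl. Qed.

Lemma uinter_l f g : f ⊠ g = wh 0 f (tgt g) ⊙ wh (src f) g 0.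
Proof. by rewrite /wh utens1m utensm1 -uinter // ucompm1 // ucomp1m. Qed.
Lemma uinter_r f g : f ⊠ g = wh (tgt f) g 0 ⊙ wh 0 f (src g).
Proof. by rewrite /wh utens1m utensm1 -uinter // ucompm1 // ucomp1m. Qed.

(** Boxes on disjoint groups of strands can be moved past each other. *)
Lemma wh_xchg m a f b a' g b' a'' b'' :
  a' = (a + src f + m)%N -> a'' = (a + tgt f + m)%N ->
  b = (m + tgt g + b')%N -> b'' = (m + src g + b')%N ->
  wh a f b ⊙ wh a' g b' = wh a'' g b' ⊙ wh a f b''.
Proof.
move=> -> -> -> ->.
have -> : wh a f (m + tgt g + b') = wh a (wh 0 f (m + tgt g)) b'.
  by rewrite wh_wh addn0.
have -> : wh a f (m + src g + b') = wh a (wh 0 f (m + src g)) b'.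
  by rewrite wh_wh addn0.
have E x : wh (a + x + m) g b' = wh a (wh x (wh m g 0) 0) b'.
  by rewrite !wh_wh addnA.
rewrite !E -!wh_comp ?src_wh ?tgt_wh ?src_id ?tgt_id; try lia.
congr wh.
have -> : (m + tgt g)%N = tgt (wh m g 0) by rewrite tgt_wh addn0.
have -> : (m + src g)%N = src (wh m g 0) by rewrite src_wh addn0.
by rewrite -uinter_l -uinter_r.
Qed.

End Arrows.
Arguments cls : simpl never.
Arguments uid : simpl never.
Arguments ucomp : simpl never.
Arguments utens : simpl never.
Arguments uscale : simpl never.
Arguments wh : simpl never.
Arguments hom_of : simpl never.

(** * Joining paired points by arcs *)
Declare Scope arrow_scope.
Delimit Scope arrow_scope with A.
Notation "g ⊙ f" := (ucomp g%A f%A)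
  (at level 60, right associativity) : arrow_scope.
Notation "f ⊠ g" := (utens f%A g%A)
  (at level 37, left associativity) : arrow_scope.

(** Both categories contain crossings, cups and caps that satisfy the Brauer
    relations; the arguments below need nothing else, so they are stated for
    any such structure. *)
Record brauer_in (K : fieldType) (gen : nat -> nat -> Type) (rel : term_rel K gen)
    (delta : K) := BrauerIn {
  bX : uarrow rel;
  bcup : uarrow rel;
  bcap : uarrow rel;
  bX_src : src bX = 2%N;
  bX_tgt : tgt bX = 2%N;
  bcup_src : src bcup = 0%N;
  bcup_tgt : tgt bcup = 2%N;
  bcap_src : src bcap = 2%N;
  bcap_tgt : tgt bcap = 0%N;
  bXX : (bX ⊙ bX)%A = uid rel 2;
  bbraid : (wh 0 bX 1 ⊙ wh 1 bX 0 ⊙ wh 0 bX 1)%A =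
    (wh 1 bX 0 ⊙ wh 0 bX 1 ⊙ wh 1 bX 0)%A;
  bzigzag_l : (wh 0 bcap 1 ⊙ wh 1 bcup 0)%A = uid rel 1;
  bzigzag_r : (wh 1 bcap 0 ⊙ wh 0 bcup 1)%A = uid rel 1;
  bcapX : (bcap ⊙ bX)%A = bcap;
  bXcup : (bX ⊙ bcup)%A = bcup;
  bslide_cap : (wh 0 bcap 1 ⊙ wh 1 bX 0)%A = (wh 1 bcap 0 ⊙ wh 0 bX 1)%A;
  bslide_cup : (wh 1 bX 0 ⊙ wh 0 bcup 1)%A = (wh 0 bX 1 ⊙ wh 1 bcup 0)%A;
  bloop : (bcap ⊙ bcup)%A = uscale delta (uid rel 0)
}.

(** A matching of the points [0, .., n - 1] is encoded by giving each point
    a label: matched points have the same label.  Unlike an involution, a list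
    of labels is easily cut, permuted and extended. *)
Definition paired (l : seq nat) := all (fun x => count_mem x l == 2)%N l.

Lemma paired_cat_cons x A B : x \notin A -> x \notin B ->
  paired (x :: A ++ x :: B) = paired (A ++ B).
Proof.
move=> xA xB; rewrite /paired /= !eqxx /= !count_cat /= eqxx.
rewrite (count_memPn xA) (count_memPn xB) /= all_cat /= eqxx !count_cat /=.
rewrite eqxx (count_memPn xA) (count_memPn xB) /= all_cat.
have E s : x \notin s ->
  all (fun y => (x == y) + count_mem y (A ++ x :: B) == 2)%N s =
  all (fun y => count_mem y (A ++ B) == 2)%N s.
  move=> xs; apply: eq_in_all => y ys; rewrite !count_cat /=.
  by case: (eqVneq x y) => [e|_] //=; move: xs; rewrite e ys.
by rewrite !E.
Qed.

Lemma mem_split (x : nat) (l : seq nat) :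
  x \in l -> exists A B : seq nat, l = A ++ x :: B.
Proof. by move=> xl; case/splitPr: xl => A B; exists A, B. Qed.

Lemma pairedP x l : paired (x :: l) ->
  exists A B, [/\ l = A ++ x :: B, x \notin A, x \notin B & paired (A ++ B)].
Proof.
move=> pl; have := pl; rewrite /paired /= => /andP [+ _].
rewrite eqxx add1n eqSS => /eqP cx.
have xl : x \in l by rewrite -has_pred1 has_count cx.
have [A [B e]] := mem_split xl; rewrite {}e in pl cx *.
move: cx; rewrite count_cat /= eqxx addnCA add1n => -[] /eqP.
rewrite addn_eq0 => /andP [/eqP/count_memPn xA /eqP/count_memPn xB].
by exists A, B; split => //; move: pl; rewrite paired_cat_cons.
Qed.

Lemma paired_perm l l' : perm_eq l l' -> paired l = paired l'.
Proof.
move=> e; rewrite /paired (perm_all _ e); apply: eq_all => x.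
by rewrite (permP e).
Qed.

Ltac uclose := rewrite -?ucompA ?wh_wh ?wh00;
  repeat (first [reflexivity | lia | f_equal]).

Section Labels.
Context (K : fieldType) (gen : nat -> nat -> Type) (rel : term_rel K gen)
  (delta : K) (S : brauer_in rel delta).
Local Open Scope arrow_scope.
Local Notation X := (bX S).
Local Notation cup := (bcup S).
Local Notation cap := (bcap S).
Local Notation I n := (uid rel n).

Local Notation srctgt := (src_comp, tgt_comp, src_wh, tgt_wh, src_id, tgt_id,
  src_tens, tgt_tens, src_scale, tgt_scale,
  bX_src S, bX_tgt S, bcup_src S, bcup_tgt S, bcap_src S, bcap_tgt S).

Lemma asl (g f h : uarrow rel) : g ⊙ f = h -> forall k, g ⊙ f ⊙ k = h ⊙ k.
Proof. by move=> e k; rewrite ucompA e. Qed.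

Lemma wh_XX a b : wh a X b ⊙ wh a X b = I (a + 2 + b).
Proof. by rewrite -wh_comp ?srctgt // bXX wh_id. Qed.

Lemma wh_braid a b : wh a X b.+1 ⊙ wh a.+1 X b ⊙ wh a X b.+1 =
  wh a.+1 X b ⊙ wh a X b.+1 ⊙ wh a.+1 X b.
Proof.
have E : forall c, wh a (wh 1 X 0) c = wh a.+1 X c by move=> c; rewrite wh_wh addn1.
have E' : wh a (wh 0 X 1) b = wh a X b.+1 by rewrite wh_wh addn0.
by rewrite -!E -!E' -!wh_comp ?srctgt // bbraid.
Qed.

Lemma wh_slide_cap a b : wh a cap b.+1 ⊙ wh a.+1 X b = wh a.+1 cap b ⊙ wh a X b.+1.
Proof.
have E f : forall c, wh a (wh 1 f 0) c = wh a.+1 f c.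
  by move=> c; rewrite wh_wh addn1.
have E' f : wh a (wh 0 f 1) b = wh a f b.+1 by rewrite wh_wh addn0.
by rewrite -!E -!E' -!wh_comp ?srctgt // bslide_cap.
Qed.

Lemma wh_slide_cup a b : wh a.+1 X b ⊙ wh a cup b.+1 = wh a X b.+1 ⊙ wh a.+1 cup b.
Proof.
have E f : forall c, wh a (wh 1 f 0) c = wh a.+1 f c.
  by move=> c; rewrite wh_wh addn1.
have E' f : wh a (wh 0 f 1) b = wh a f b.+1 by rewrite wh_wh addn0.
by rewrite -!E -!E' -!wh_comp ?srctgt // bslide_cup.
Qed.

Lemma wh_zigzag_l a b : wh a cap b.+1 ⊙ wh a.+1 cup b = I (a + b).+1.
Proof.
have -> : wh a cap b.+1 = wh a (wh 0 cap 1) b by rewrite wh_wh addn0.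
have -> : wh a.+1 cup b = wh a (wh 1 cup 0) b by rewrite wh_wh addn1.
by rewrite -wh_comp ?srctgt // bzigzag_l wh_id addn1.
Qed.

Lemma wh_zigzag_r a b : wh a.+1 cap b ⊙ wh a cup b.+1 = I (a + b).+1.
Proof.
have -> : wh a.+1 cap b = wh a (wh 1 cap 0) b by rewrite wh_wh addn1.
have -> : wh a cup b.+1 = wh a (wh 0 cup 1) b by rewrite wh_wh addn0.
by rewrite -wh_comp ?srctgt // bzigzag_r wh_id addn1.
Qed.

(** The cap joining the first of [k + 2] points to the last, over the [k]
    points in between. *)
Fixpoint arc k : uarrow rel :=
  if k is k'.+1 then wh 1 (arc k') 0 ⊙ wh 0 X k else cap.

Lemma arc_src k : src (arc k) = k.+2.
Proof. by case: k => [|k] /=; rewrite !srctgt. Qed.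
Lemma arc_tgt k : tgt (arc k) = k.
Proof. by elim: k => [|k IH] /=; rewrite !srctgt // IH; lia. Qed.

Local Notation arcst := (arc_src, arc_tgt, srctgt).

Lemma arc0 : arc 0 = cap. Proof. by []. Qed.
Lemma arcS k : arc k.+1 = wh 1 (arc k) 0 ⊙ wh 0 X k.+1. Proof. by []. Qed.

#[local] Arguments arc : simpl never.

Lemma arcS2 k : arc k.+2 = wh 2 (arc k) 0 ⊙ wh 1 X k.+1 ⊙ wh 0 X k.+2.
Proof.
rewrite arcS arcS wh_comp ?arcst; try lia.
by rewrite !wh_wh -ucompA !addn0.
Qed.

(** A crossing of strands that pass the arc can be moved to its other side. *)
Lemma arc_X i b : arc (i + b).+2 ⊙ wh i.+1 X b.+1 = wh i X b ⊙ arc (i + b).+2.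
Proof.
elim: i => [|i IH].
  rewrite add0n arcS2 -!ucompA -wh_braid.
  rewrite (asl (@wh_xchg _ _ _ 0 0 X b 2 (arc b) 0 2 b.+2 _ _ _ _)) ?arcst //; try lia.
  by rewrite -ucompA.
rewrite addSn (arcS (i + b).+2) -ucompA.
rewrite (@wh_xchg _ _ _ i 0 X _ i.+2 X b.+1 i.+2 (i + b).+3) ?arcst //; try lia.
have E : wh i.+2 X b.+1 = wh 1 (wh i.+1 X b.+1) 0 by rewrite wh_wh addn0.
rewrite {}E ucompA -wh_comp ?arcst; try lia.
rewrite IH wh_comp ?arcst; try lia.
by rewrite wh_wh addn0 -ucompA.
Qed.

Lemma arc_X_end k : wh 0 (arc k) 1 ⊙ wh k.+1 X 0 = arc k.+1.
Proof.
elim: k => [|k IH]; first by rewrite /= wh_slide_cap.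
rewrite {1}arcS wh_comp ?arcst; try lia.
rewrite -ucompA !wh_wh !addn1 !add0n ?addn0.
rewrite (@wh_xchg _ _ _ k 0 X _ k.+2 X 0 k.+2 k.+2) ?arcst //; try lia.
rewrite [wh k.+2 _ _](_ : _ = wh 1 (wh k.+1 X 0) 0); last by rewrite wh_wh.
rewrite [wh 1 (arc k) _](_ : _ = wh 1 (wh 0 (arc k) 1) 0); last by rewrite wh_wh.
rewrite ucompA -wh_comp ?arcst; try lia.
by rewrite IH.
Qed.

Lemma wh_slide_cap3 a b : wh a cap b.+1 ⊙ wh a.+1 X b ⊙ wh a X b.+1 = wh a.+1 cap b.
Proof.
rewrite (asl (wh_slide_cap a b)) -ucompA wh_XX ucompm1 // !srctgt; lia.
Qed.

(** The two orders in which crossing arcs can be drawn agree.  This is what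
    makes [join] independent of the order of the labels. *)
Lemma arc_arc k b :
  arc (k + b) ⊙ wh 1 (arc k) b.+1 = wh 0 (arc k) b ⊙ arc (k + b).+2.
Proof.
elim: k => [|k IH].
  rewrite add0n (_ : arc 0 = cap) // -(wh_slide_cap3 0 b.+1) arcS2.
  rewrite (asl (@wh_xchg _ _ _ 0 0 cap b 2 (arc b) 0 0 b.+2 _ _ _ _)) ?arcst //; try lia.
  by rewrite wh00 -ucompA.
transitivity (wh 1 (arc k) b ⊙ wh 1 (arc (k + b).+2) 0 ⊙
              wh 0 X (k + b).+3 ⊙ wh 1 X (k + b).+2).
  rewrite addSn arcS (arcS k) wh_comp ?arcst; try lia.
rewrite -!ucompA !wh_wh.
  rewrite (asl (@wh_xchg _ _ _ 0 0 X _ 2 (arc k) b.+1 2 (k + b).+3 _ _ _ _));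
    rewrite ?arcst; try lia.
  rewrite -!ucompA [wh (1 + 1) _ _](_ : _ = wh 1 (wh 1 (arc k) b.+1) 0);
    last by rewrite wh_wh addn0.
  rewrite (asl (esym (wh_comp _ _ _))) ?arcst; try lia.
  rewrite IH wh_comp ?arcst; try lia.
  by uclose.
rewrite addSn (arcS2 (k + b).+1) (arcS k) wh_comp ?arcst; try lia.
rewrite -!ucompA !wh_wh addSn !add0n; try lia.
rewrite (asl (@wh_xchg _ _ _ 0 0 X _ 2 (arc (k + b).+1) 0 2 (k + b).+3 _ _ _ _));
  rewrite ?arcst; try lia.
rewrite -!ucompA wh_braid arcS wh_comp ?arcst; try lia.
by uclose.
Qed.

(** Moves the last of [k + 1] strands to the front: this is what an arc turns
    into when a cup straightens one of its ends. *)
Fixpoint pull k : uarrow rel :=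
  if k is k'.+1 then wh 0 X k' ⊙ wh 1 (pull k') 0 else I 1.

Lemma pull_tgt k : tgt (pull k) = k.+1.
Proof. by case: k => [|k] //=; rewrite !srctgt. Qed.

Lemma arc_cup k : wh 1 (arc k) 0 ⊙ wh 0 cup k.+1 = pull k.
Proof.
elim: k => [|k IH]; first by rewrite /= wh_zigzag_r.
rewrite arcS wh_comp ?arcst; try lia.
rewrite -!ucompA !wh_wh !addn0 wh_slide_cup.
rewrite (asl (esym (@wh_xchg _ _ _ 0 0 X k 2 (arc k) 0 2 k.+2 _ _ _ _)));
  rewrite ?arcst; try lia.
have -> : wh 2 (arc k) 0 = wh 1 (wh 1 (arc k) 0) 0 by uclose.
have -> : wh 1 cup k.+1 = wh 1 (wh 0 cup k.+1) 0 by uclose.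
rewrite -!ucompA -wh_comp ?arcst; try lia.
by rewrite IH.
Qed.

Lemma arcS_cup k : arc k.+1 ⊙ wh 0 cup k.+1 = pull k.
Proof. by rewrite arcS -ucompA -wh_comp ?srctgt // bXcup arc_cup. Qed.

Fixpoint join_upto n (l : seq nat) : uarrow rel :=
  match n, l with
  | n'.+1, x :: l' => join_upto n' (rem x l') ⊙
      wh 0 (arc (index x l')) (size l' - (index x l').+1)
  | _, _ => I 0
  end.
(** The morphism from [size l] to [0] that caps off equal labels, beginning
    with the arc of the first point.  Composing it with a crossing, cap or cup
    changes the list of labels in the evident way: [join_swap], [join_cap] and
    [join_cup_front] with [join_cup_loop] and [join_cup_merge]. *)
Definition join l := join_upto (size l) l.

Lemma join_upto_size n m l : (size l <= n)%N -> (size l <= m)%N ->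
  join_upto n l = join_upto m l.
Proof.
elim: n m l => [|n IH] [|m] [|x l] //=; rewrite !ltnS => ln lm.
have le : (size (rem x l) <= size l)%N by rewrite size_subseq ?rem_subseq.
by rewrite (IH m) //; apply: leq_trans le _.
Qed.

Lemma rem_cat_cons (x : nat) A B : x \notin A -> rem x (A ++ x :: B) = A ++ B.
Proof.
elim: A => [|a A IH] /=; first by rewrite eqxx.
by rewrite inE negb_or eq_sym => /andP [/negbTE -> /IH ->].
Qed.

Lemma index_cat_cons (x : nat) A B : x \notin A -> index x (A ++ x :: B) = size A.
Proof. by move=> xA; rewrite index_cat (negbTE xA) /= eqxx addn0. Qed.

Lemma join_cons x A B : x \notin A ->
  join (x :: A ++ x :: B) = join (A ++ B) ⊙ wh 0 (arc (size A)) (size B).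
Proof.
move=> xA; rewrite /join /= rem_cat_cons // index_cat_cons //.
rewrite (@join_upto_size _ (size (A ++ B))) // !size_cat /=; last lia.
by uclose.
Qed.


Lemma join_src l : paired l -> src (join l) = size l.
Proof.
case: l => [|x l] // /pairedP [A [B [-> xA _ _]]].
by rewrite join_cons // !arcst /= !size_cat /=; lia.
Qed.

Lemma join_XX l a b : paired l -> size l = (a + 2 + b)%N ->
  join l ⊙ wh a X b ⊙ wh a X b = join l.
Proof. by move=> pl e; rewrite wh_XX ucompm1 // join_src. Qed.

Lemma paired2 x A B : paired (x :: A ++ x :: B) -> x \notin A /\ x \notin B.
Proof.
rewrite /paired /= => /andP [+ _].
rewrite eqxx count_cat /= eqxx add1n addnCA add1n !eqSS addn_eq0.
by case/andP => /eqP/count_memPn ? /eqP/count_memPn.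
Qed.

(** The case in which the arcs of the first two points cross. *)
Lemma join_swap_front x y A B D : paired (x :: y :: A ++ x :: B ++ y :: D) ->
  join (x :: y :: A ++ x :: B ++ y :: D) ⊙
    wh 0 X (size (A ++ x :: B ++ y :: D)) =
  join (y :: x :: A ++ x :: B ++ y :: D).
Proof.
move=> p; have [] := @paired2 x (y :: A) (B ++ y :: D) p.
rewrite inE negb_or => /andP [xy xA].
rewrite mem_cat inE !negb_or => /and3P [xB _ xD].
have p' : paired (y :: (A ++ B) ++ y :: D).
  by move: p; rewrite -[y :: A ++ _]cat_cons paired_cat_cons ?catA //;
    rewrite ?mem_cat ?inE !negb_or ?xy ?xA ?xB ?xD.
have [] := paired2 p'; rewrite mem_cat negb_or => /andP [yA yB] yD.
rewrite -[y :: A ++ _]cat_cons join_cons; last by rewrite inE negb_or xy.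
rewrite /= -ucompA {1}arcS.
rewrite wh_comp ?arcst; try lia.
rewrite !wh_wh -ucompA.
have -> : wh 0 X (size (A ++ x :: B ++ y :: D)) =
          wh (0 + 0) X ((size A).+1 + size (B ++ y :: D)).
  by rewrite !size_cat /= !size_cat /=; uclose.
rewrite wh_XX ucompm1 ?arcst; last by rewrite !size_cat /=; lia.
rewrite [in LHS]catA join_cons; last by rewrite mem_cat negb_or yA.
have -> : x :: A ++ x :: B ++ y :: D = (x :: A ++ x :: B) ++ y :: D.
  by rewrite /= -catA.
rewrite join_cons; last first.
  by rewrite inE mem_cat inE !negb_or yA yB eq_sym xy.
rewrite [in RHS]cat_cons -[in RHS]catA cat_cons join_cons // catA -!ucompA.
congr (_ ⊙ _).
have -> : wh (0 + 1) (arc (size A)) (0 + size (B ++ y :: D)) =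
   wh 0 (wh 1 (arc (size A)) (size B).+1) (size D).
  by rewrite size_cat /=; uclose.
have -> : wh 0 (arc (size A)) (size (B ++ D)) =
   wh 0 (wh 0 (arc (size A)) (size B)) (size D).
  by rewrite size_cat /=; uclose.
rewrite /= !size_cat /= -!wh_comp ?arcst; try lia.
by rewrite arc_arc !addnS.
Qed.

Lemma paired_mem x y l : paired (x :: y :: l) -> x != y -> x \in l.
Proof.
move=> p xy; have [A [B [e _ _ _]]] := pairedP p.
have : x \in y :: l by rewrite e mem_cat mem_head orbT.
by rewrite inE (negbTE xy).
Qed.

Lemma paired_swap l1 x y l2 :
  paired (l1 ++ x :: y :: l2) = paired (l1 ++ y :: x :: l2).
Proof.
apply: paired_perm; rewrite perm_cat2l.
exact: (permEl (perm_catCA [:: x] [:: y] l2)).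
Qed.

Lemma join_swap0 x y l : paired (x :: y :: l) ->
  join (x :: y :: l) ⊙ wh 0 X (size l) = join (y :: x :: l).
Proof.
have [<-|xy] := eqVneq x y => p.
  by rewrite (@join_cons x [::] l) // -ucompA -wh_comp ?srctgt // bcapX.
have p2 : paired (y :: x :: l) by rewrite -(@paired_swap [::]).
have xl := paired_mem p xy.
have yl : y \in l by apply: paired_mem p2 _; rewrite eq_sym.
have [A [B e]] := mem_split xl; rewrite {}e in yl p p2 *; move: yl.
rewrite mem_cat inE eq_sym (negbTE xy) /= => /orP [] yl.
  have [A1 [A2 e]] := mem_split yl.
  move: p p2; rewrite {}e -catA cat_cons => p p2.
  by rewrite -(join_swap_front p2) -ucompA join_XX.
have [B1 [B2 e]] := mem_split yl.
by move: p; rewrite e => p; rewrite join_swap_front.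
Qed.

(** Here the swapped strands include the far end of the first arc, which gets
    longer by one. *)
Lemma join_swap_end z l1 y l2 : paired (z :: l1 ++ z :: y :: l2) ->
  join (z :: l1 ++ z :: y :: l2) ⊙ wh (size l1).+1 X (size l2) =
  join (z :: l1 ++ y :: z :: l2).
Proof.
move=> p; have [zl1 +] := paired2 p; rewrite inE negb_or => /andP [zy zl2].
rewrite join_cons // -[l1 ++ y :: z :: l2](cat_rcons y) join_cons; last first.
  by rewrite mem_rcons inE negb_or zy.
rewrite cat_rcons -ucompA size_rcons -arc_X_end; congr (_ ⊙ _).
rewrite wh_comp ?arcst; try lia.
by uclose.
Qed.

(** By induction on the number of points to the left of the crossing: the
    arc of the first point either encloses the crossing, or ends in it, or lies
    entirely to its left. *)
Lemma join_swap l1 x y l2 : paired (l1 ++ x :: y :: l2) ->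
  join (l1 ++ x :: y :: l2) ⊙ wh (size l1) X (size l2) =
  join (l1 ++ y :: x :: l2).
Proof.
move: {2}(size l1) (leqnn (size l1)) => n.
elim: n l1 x y l2 => [|n IH] [|z l1] x y l2 //=; try by move=> _; exact: join_swap0.
rewrite ltnS => le_n p.
have : z \in l1 ++ x :: y :: l2.
  by have [A [B [-> _ _ _]]] := pairedP p; rewrite mem_cat mem_head orbT.
rewrite mem_cat !inE => /or4P [|/eqP zx|/eqP zy|].
- move=> zl1; have [P [Q e]] := mem_split zl1; move: le_n p.
  rewrite {}e => le_n; rewrite -!catA !cat_cons => p.
  have [zP zQ] := paired2 p.
  rewrite !join_cons // !size_cat /= -ucompA.
  rewrite (@wh_xchg _ _ _ (size Q) 0 (arc (size P)) _ _ X _ (size P + size Q)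
    (size Q + 2 + size l2)); rewrite ?arcst; try lia.
  rewrite ucompA; congr (_ ⊙ _); last by rewrite /=; uclose.
  rewrite catA -size_cat IH; first by rewrite -catA.
    by move: le_n; rewrite !size_cat /=; lia.
  by rewrite -catA -(paired_cat_cons zP zQ).
- move: p; rewrite -zx => p; exact: join_swap_end.
- move: p; rewrite -zy => p; rewrite -join_swap_end; last first.
    by rewrite -cat_cons -paired_swap.
  rewrite -ucompA join_XX //; first by rewrite -cat_cons -paired_swap.
  by rewrite /= size_cat /=; lia.
- move=> zl2; have [P [Q e]] := mem_split zl2; rewrite {}e in p *.
  have E u v : z :: l1 ++ u :: v :: P ++ z :: Q = z :: (l1 ++ u :: v :: P) ++ z :: Q.
    by rewrite -catA.
  rewrite !E in p *; have [zA zQ] := paired2 p.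
  rewrite !join_cons //; last first.
    by move: zA; rewrite !mem_cat !inE !negb_or => /and4P [-> -> -> ->].
  rewrite -!catA !cat_cons -(IH l1 x y) //; last first.
    by move: p; rewrite paired_cat_cons // -catA.
  rewrite -!ucompA; congr (_ ⊙ _).
  have -> : size (l1 ++ x :: y :: P) = (size l1 + size P).+2.
    by rewrite size_cat /=; lia.
  have -> : size (l1 ++ y :: x :: P) = (size l1 + size P).+2.
    by rewrite size_cat /=; lia.
  have -> : wh (size l1).+1 X (size (P ++ z :: Q)) =
    wh 0 (wh (size l1).+1 X (size P).+1) (size Q).
    by rewrite size_cat /=; uclose.
  have -> : wh (size l1) X (size (P ++ Q)) =
    wh 0 (wh (size l1) X (size P)) (size Q).
    by rewrite size_cat /=; uclose.
  by rewrite -!wh_comp ?arcst ?arc_X //; lia.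
Qed.

Lemma paired_front z l1 l2 :
  paired (l1 ++ z :: z :: l2) = paired (z :: z :: l1 ++ l2).
Proof.
apply: paired_perm; exact: (permEl (perm_catCA l1 [:: z; z] l2)).
Qed.

Lemma join_cap z l1 l2 : z \notin l1 ++ l2 -> paired (l1 ++ l2) ->
  join (l1 ++ l2) ⊙ wh (size l1) cap (size l2) = join (l1 ++ z :: z :: l2).
Proof.
elim/last_ind: l1 l2 => [|l1 w IH] l2 zl p; first by rewrite (@join_cons z [::] l2).
have p1 : paired (l1 ++ z :: z :: w :: l2).
  by rewrite paired_front (@paired_cat_cons z [::]) // -cat_rcons.
have p2 : paired (l1 ++ z :: w :: z :: l2).
  by rewrite -(cat_rcons z) -paired_swap cat_rcons.
rewrite !cat_rcons -(join_swap p2) -(cat_rcons z) -join_swap; last by rewrite cat_rcons.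
rewrite cat_rcons -IH -?cat_rcons // !size_rcons -!ucompA; congr (_ ⊙ _).
by rewrite /= wh_slide_cap3.
Qed.

Lemma wh_slide_cup3 a b : wh a X b.+1 ⊙ wh a.+1 X b ⊙ wh a cup b.+1 = wh a.+1 cup b.
Proof.
rewrite wh_slide_cup ucompA wh_XX ucomp1m // !srctgt; lia.
Qed.

(** Since crossings only permute the labels, a cup may be assumed to be
    leftmost. *)
Lemma join_cup_front x y l1 l2 : paired (l1 ++ x :: y :: l2) ->
  join (l1 ++ x :: y :: l2) ⊙ wh (size l1) cup (size l2) =
  join (x :: y :: l1 ++ l2) ⊙ wh 0 cup (size (l1 ++ l2)).
Proof.
elim/last_ind: l1 l2 => [|l1 w IH] l2 //; rewrite !cat_rcons => p.
have p1 : paired (l1 ++ x :: w :: y :: l2) by rewrite paired_swap.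
have p2 : paired (l1 ++ x :: y :: w :: l2).
  by rewrite -(cat_rcons x) paired_swap cat_rcons.
rewrite -IH // size_rcons -wh_slide_cup3 -(cat_rcons x) -[in RHS]join_swap;
  last by rewrite cat_rcons.
rewrite cat_rcons size_rcons -[in RHS](join_swap p) -!ucompA; congr (_ ⊙ _).
Qed.

Lemma join_cup_loop x l : paired (x :: x :: l) ->
  join (x :: x :: l) ⊙ wh 0 cup (size l) = uscale delta (join l).
Proof.
move=> p; have [_ xl] := @paired2 x [::] l p.
have pl : paired l by rewrite -(@paired_cat_cons x [::] l).
rewrite (@join_cons x [::] l) // arc0 -ucompA -wh_comp ?srctgt // bloop.
by rewrite whZ wh_id ucompZr ucompm1 // join_src.
Qed.

Lemma join_pull P x A B : paired (P ++ x :: A ++ B) ->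
  join (P ++ x :: A ++ B) ⊙ wh (size P) (pull (size A)) (size B) =
  join (P ++ A ++ x :: B).
Proof.
elim: A P => [|a A IH] P p.
  by rewrite wh_id ucompm1 // join_src // size_cat /=; lia.
rewrite /= wh_comp ?srctgt ?pull_tgt; try lia.
rewrite !wh_wh.
have p2 : paired (P ++ a :: x :: A ++ B) by rewrite -paired_swap.
rewrite -[in RHS](cat_rcons a) -IH cat_rcons // -[in RHS]join_swap //.
by rewrite !size_rcons -!ucompA; congr (_ ⊙ _); rewrite !size_cat; uclose.
Qed.

Lemma join_cup_merge x y A B : x != y -> paired (x :: y :: A ++ y :: B) ->
  join (x :: y :: A ++ y :: B) ⊙ wh 0 cup (size (A ++ y :: B)) =
  join (A ++ x :: B).
Proof.
move=> xy p; have p' : paired (y :: (x :: A) ++ y :: B) by rewrite -(@paired_swap [::]).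
have [yA yB] := paired2 p'.
have p2 : paired (x :: A ++ B) by move: p'; rewrite paired_cat_cons.
rewrite -bXcup wh_comp ?srctgt // ucompA join_swap0 //.
rewrite (@join_cons y (x :: A)) // -(@join_pull [::] x A B p2) -ucompA.
congr (_ ⊙ _).
have -> : wh 0 cup (size (A ++ y :: B)) = wh 0 (wh 0 cup (size A).+1) (size B).
  by rewrite size_cat /=; uclose.
by rewrite -wh_comp ?arcst ?arcS_cup //; lia.
Qed.

Lemma join_map (f : nat -> nat) l : {in l &, injective f} -> join (map f l) = join l.
Proof.
rewrite /join size_map; move: (size l) => n.
elim: n l => [|n IH] [|x l] //= fi.
have fl : {in x :: l, forall y, (f y == f x) = (y == x)}.
  by move=> y yl; apply: (inj_in_eq fi) => //; rewrite mem_head.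
have fl' : {in l, forall y, (f y == f x) = (y == x)}.
  by move=> y yl; apply: fl; rewrite inE yl orbT.
have -> : index (f x) (map f l) = index x l.
  elim: l fl' {fi fl} => //= a l IHl fl'; rewrite fl' ?mem_head //.
  by case: eqP => // _; rewrite IHl // => y yl; apply: fl'; rewrite inE yl orbT.
have -> : rem (f x) (map f l) = map f (rem x l).
  elim: l fl' {fi fl} => //= a l IHl fl'; rewrite fl' ?mem_head //.
  by case: eqP => // _; rewrite IHl // => y yl; apply: fl'; rewrite inE yl orbT.
rewrite size_map IH // => y z yl zl; apply: fi; rewrite inE.
  by rewrite (mem_rem yl) orbT.
by rewrite (mem_rem zl) orbT.
Qed.

End Labels.

(** * Diagrams, state sums and coherence *)
(** Expressions for composites of crossings, cups, caps and a vector [DVec] in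
    [Hom(0, 3)], without types so that they can be computed with. *)
Inductive diag :=
| DX | DCup | DCap | DVec
| DId of nat
| DComp of diag & diag
| DTens of diag & diag.

Fixpoint dsrc d : nat :=
  match d with
  | DX => 2 | DCup => 0 | DCap => 2 | DVec => 0 | DId n => n
  | DComp _ f => dsrc f
  | DTens f g => dsrc f + dsrc g
  end.

Fixpoint dtgt d : nat :=
  match d with
  | DX => 2 | DCup => 2 | DCap => 0 | DVec => 3 | DId n => n
  | DComp g _ => dtgt g
  | DTens f g => dtgt f + dtgt g
  end.

Fixpoint dwf d : bool :=
  match d with
  | DComp g f => [&& dwf g, dwf f & dsrc g == dtgt f]
  | DTens f g => dwf f && dwf g
  | _ => true
  end.

Fixpoint dvecs d : nat :=
  match d with
  | DVec => 1
  | DComp f g | DTens f g => dvecs g + dvecs f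
  | _ => 0
  end.

Definition dbrauer d := dwf d && (dvecs d == 0)%N.

Lemma dbrauer_compP g f :
  reflect [/\ dbrauer g, dbrauer f & dsrc g = dtgt f] (dbrauer (DComp g f)).
Proof.
rewrite /dbrauer /= addn_eq0; apply: (iffP idP).
  by case/andP => /and3P [-> -> /eqP ->] /andP [-> ->].
by case=> /andP [-> ->] /andP [-> ->] ->; rewrite eqxx.
Qed.

Lemma dbrauer_tensE f g : dbrauer (DTens f g) = dbrauer f && dbrauer g.
Proof. by rewrite /dbrauer /= addn_eq0 [(_ == 0)%N && _]andbC andbACA. Qed.

(** The state sum: the colours, with multiplicity, that strands leave with
    when they enter with colours [c] and the legs of the vectors carry the
    colours [v].  Strands keep their colour, so this is the functor to matrices
    that sends a strand to a two-dimensional space with cap and cup given by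
    the standard bilinear form; a loop contributes the factor 2. *)
Fixpoint sem d (v c : seq bool) : seq (seq bool) :=
  match d with
  | DX => [:: rev c]
  | DCup => [:: [:: true; true]; [:: false; false]]
  | DCap => if nth false c 0 == nth false c 1 then [:: [::]] else [::]
  | DVec => [:: v]
  | DId _ => [:: c]
  | DComp g f =>
    let k := (3 * dvecs f)%N in
    flatten [seq sem g (drop k v) e | e <- sem f (take k v) c]
  | DTens f g =>
    let k := (3 * dvecs f)%N in
    [seq e ++ e' | e <- sem f (take k v) (take (dsrc f) c),
                   e' <- sem g (drop k v) (drop (dsrc f) c)]
  end.

Lemma sem_size d v c e : dwf d -> size v = (3 * dvecs d)%N ->
  size c = dsrc d -> e \in sem d v c -> size e = dtgt d.
Proof.
elim: d v c e => [||||n|g IHg f IHf|f IHf g IHg] v c e /=.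
- by move=> _ _ sc; rewrite inE => /eqP ->; rewrite size_rev.
- by move=> _ _ _; rewrite !inE => /orP [] /eqP ->.
- by move=> _ _ _; case: ifP => // _; rewrite inE => /eqP ->.
- by move=> _ sv _; rewrite inE => /eqP ->.
- by move=> _ _ sc; rewrite inE => /eqP ->.
- case/and3P => wg wf /eqP gf sv sc /flattenP [s /mapP [e' he ->]].
  apply: IHg => //; first by rewrite size_drop sv; lia.
  by rewrite gf; apply: IHf he => //; rewrite size_takel // sv; lia.
- case/andP => wf wg sv sc /allpairsP [[e1 e2] /= [h1 h2 ->]]; rewrite size_cat.
  rewrite (IHf _ _ _ wf _ _ h1) ?(IHg _ _ _ wg _ _ h2) //.
  + by rewrite size_drop sv; lia.
  + by rewrite size_drop sc; lia.
  + by rewrite size_takel // sv; lia.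
  + by rewrite size_takel // sc; lia.
Qed.

Lemma sem_size0 d c e : dbrauer d -> size c = dsrc d -> e \in sem d [::] c ->
  size e = dtgt d.
Proof. by case/andP => wd /eqP vd; apply: sem_size; rewrite // vd. Qed.

(** The state sum of [join l]: an arc contributes 1 when its ends agree. *)
Definition coloured (l : seq nat) (c : seq bool) :=
  c == [seq nth false c (index x l) | x <- l].

Lemma colouredP l c : size c = size l ->
  reflect (exists f, c = map f l) (coloured l c).
Proof.
move=> sz; apply: (iffP eqP) => [e|[f e]].
  by exists (fun x => nth false c (index x l)).
rewrite {1}e; apply/eq_in_map => x xl.
by rewrite e (nth_map x) ?index_mem // nth_index.
Qed.

Lemma cat_map_eq (f : nat -> bool) l1 l2 c1 c2 : size c1 = size l1 ->
  (c1 ++ c2 == map f (l1 ++ l2)) = (c1 == map f l1) && (c2 == map f l2).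
Proof. by move=> sz; rewrite map_cat eqseq_cat // size_map. Qed.

Lemma cat_map_eqP (f : nat -> bool) l1 l2 c1 c2 : size c1 = size l1 ->
  c1 ++ c2 = map f (l1 ++ l2) <-> (c1 = map f l1 /\ c2 = map f l2).
Proof.
move=> sz; split=> [/eqP|[-> ->]]; last by rewrite map_cat.
by rewrite cat_map_eq // => /andP [/eqP ? /eqP].
Qed.

Lemma split_at (T : Type) a b (l : seq T) : size l = (a + b)%N ->
  exists l1 l2, [/\ l = l1 ++ l2, size l1 = a & size l2 = b].
Proof.
move=> sz; exists (take a l), (drop a l); rewrite cat_take_drop.
by rewrite size_drop size_take sz; split => //; [case: ltnP; lia | lia].
Qed.

Lemma split_at2 (T : Type) a b (l : seq T) : size l = (a + 2 + b)%N ->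
  exists l1 x y l2, [/\ l = l1 ++ x :: y :: l2, size l1 = a & size l2 = b].
Proof.
rewrite -addnA => /split_at [l1 [[|x [|y l2]] [-> sz]]] //= [] sz2.
by exists l1, x, y, l2.
Qed.

Lemma coloured_swap l1 x y l2 c1 a b c2 :
  size c1 = size l1 -> size c2 = size l2 ->
  coloured (l1 ++ x :: y :: l2) (c1 ++ b :: a :: c2) =
  coloured (l1 ++ y :: x :: l2) (c1 ++ a :: b :: c2).
Proof.
move=> s1 s2; apply/colouredP/colouredP; rewrite ?size_cat /= ?s1 ?s2 //.
  by move=> [f /cat_map_eqP[]// -> [-> -> ->]]; exists f; rewrite map_cat.
by move=> [f /cat_map_eqP[]// -> [-> -> ->]]; exists f; rewrite map_cat.
Qed.

Lemma coloured_cap z l1 l2 c1 a b c2 : z \notin l1 ++ l2 ->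
  size c1 = size l1 -> size c2 = size l2 ->
  coloured (l1 ++ z :: z :: l2) (c1 ++ a :: b :: c2) =
  (a == b) && coloured (l1 ++ l2) (c1 ++ c2).
Proof.
move=> zl s1 s2; apply/colouredP/andP; rewrite ?size_cat /= ?s1 ?s2 //.
  move=> [f /cat_map_eqP[]// -> [-> -> ->]]; split => //.
  by apply/colouredP; [rewrite ?size_cat ?size_map | exists f; rewrite map_cat].
move=> [/eqP -> /colouredP [|f /cat_map_eqP[]// -> ->]].
  by rewrite !size_cat s1 s2.
exists (fun x => if x == z then b else f x); rewrite map_cat /= eqxx.
move: zl; rewrite mem_cat negb_or => /andP [z1 z2].
congr (_ ++ _ :: _ :: _); apply/eq_in_map => x xl; case: eqP => // e;
  by rewrite e in xl; rewrite xl in z1 z2.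
Qed.

Lemma coloured_cup_loop x l1 l2 c1 a c2 : x \notin l1 ++ l2 ->
  size c1 = size l1 -> size c2 = size l2 ->
  coloured (l1 ++ x :: x :: l2) (c1 ++ a :: a :: c2) =
  coloured (l1 ++ l2) (c1 ++ c2).
Proof. by move=> xl s1 s2; rewrite coloured_cap // eqxx. Qed.

(** Summing over the colour of a cup that connects the arcs labelled [x] and
    [y] identifies the two labels. *)
Lemma coloured_cup_merge x y l1 l2 c1 c2 : x != y ->
  x \in l1 ++ l2 -> 
  size c1 = size l1 -> size c2 = size l2 ->
  (coloured (l1 ++ x :: y :: l2) (c1 ++ true :: true :: c2) +
  coloured (l1 ++ x :: y :: l2) (c1 ++ false :: false :: c2) =
  coloured (map (fun z => if z == y then x else z) (l1 ++ l2)) (c1 ++ c2))%N.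
Proof.
move=> xy xl s1 s2.
have sz : size (c1 ++ c2) = size (l1 ++ l2) by rewrite !size_cat s1 s2.
have H v : coloured (l1 ++ x :: y :: l2) (c1 ++ v :: v :: c2) =
  coloured (map (fun z => if z == y then x else z) (l1 ++ l2)) (c1 ++ c2) &&
  (nth false (c1 ++ c2) (index x (l1 ++ l2)) == v).
  apply/colouredP/andP; rewrite ?size_cat /= ?s1 ?s2 //.
    move=> [f /cat_map_eqP[]// e1 [fx fy e2]]; split.
      apply/colouredP; first by rewrite size_map.
      exists f; rewrite -map_comp e1 e2 -map_cat; apply: eq_map => z /=.
      by case: eqP => // ->; rewrite -fx -fy.
    by rewrite e1 e2 -map_cat (nth_map x) ?index_mem // nth_index // fx.
  move=> [/colouredP []]; first by rewrite size_map.
  move=> f; rewrite -map_comp => e /eqP ev.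
  have fx : f x = v.
    rewrite -ev e (nth_map x) ?index_mem // nth_index //=.
    by rewrite (negbTE xy).
  exists (fun z => f (if z == y then x else z)).
  move/cat_map_eqP: e => [//|-> ->].
  by rewrite map_cat /= eqxx (negbTE xy) fx.
rewrite !H; case: coloured => //=.
by case: (nth _ _ _).
Qed.

Lemma fresh (l : seq nat) : exists z, z \notin l.
Proof.
exists (sumn l).+1; apply/negP => h.
suff : forall x, x \in l -> (x <= sumn l)%N by move/(_ _ h); rewrite ltnn.
elim: l {h} => //= y l IH x; rewrite inE => /orP [/eqP ->|/IH]; lia.
Qed.

Lemma paired_merge x y A B : x != y -> paired (x :: y :: A ++ y :: B) ->
  [/\ y \notin A, y \notin B & paired (A ++ x :: B)].
Proof.
move=> xy p; have p' : paired (y :: (x :: A) ++ y :: B).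
  by rewrite -(@paired_swap [::]).
have [] := paired2 p'; rewrite inE negb_or => /andP [_ yA] yB; split => //.
move: p'; rewrite paired_cat_cons // ?inE ?negb_or 1?eq_sym ?xy //.
by move=> p'; rewrite (paired_perm (permEl (perm_catCA A [:: x] B))).
Qed.

Lemma sem_comp0 g f c :
  sem (DComp g f) [::] c = flatten [seq sem g [::] e | e <- sem f [::] c].
Proof. by []. Qed.

Lemma sem_tens0 f g c : sem (DTens f g) [::] c =
  [seq e ++ e' | e <- sem f [::] (take (dsrc f) c), e' <- sem g [::] (drop (dsrc f) c)].
Proof. by []. Qed.

(** Nested cups and caps, used to bend top points down. *)
Fixpoint ncup n : diag :=
  if n is n'.+1 then DComp (DTens (DId 1) (DTens (ncup n') (DId 1))) DCup
  else DId 0.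

Fixpoint ncap n : diag :=
  if n is n'.+1 then DComp (ncap n') (DTens (DId n') (DTens DCap (DId n')))
  else DId 0.

Lemma ncup_src n : dsrc (ncup n) = 0%N. Proof. by case: n. Qed.
Lemma ncup_tgt n : dtgt (ncup n) = (n + n)%N.
Proof. by elim: n => //= n ->; lia. Qed.
Lemma ncup_brauer n : dbrauer (ncup n).
Proof.
rewrite /dbrauer; elim: n => //= n /andP [-> /eqP ->].
by rewrite ncup_src.
Qed.
Lemma ncap_src n : dsrc (ncap n) = (n + n)%N.
Proof. by case: n => //= n; lia. Qed.
Lemma ncap_tgt n : dtgt (ncap n) = 0%N.
Proof. by elim: n => //=. Qed.
Lemma ncap_brauer n : dbrauer (ncap n).
Proof.
rewrite /dbrauer; elim: n => //= n /andP [-> /eqP ->].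
by rewrite ncap_src add0n eqxx.
Qed.

Fixpoint colours n : seq (seq bool) :=
  if n is n'.+1 then
    [seq true :: e | e <- colours n'] ++ [seq false :: e | e <- colours n']
  else [:: [::]].

Lemma mem_colours n c : (c \in colours n) = (size c == n).
Proof.
elim: n c => [|n IH] [|b c] //=.
  by rewrite mem_cat; apply/negbTE/norP; split; apply/mapP => -[].
rewrite mem_cat eqSS -IH; case: b; first rewrite orbC.
  rewrite mem_map; last by move=> ? ? [].
  by rewrite (negbTE (_ : _ \notin _)) //; apply/mapP => -[].
rewrite mem_map; last by move=> ? ? [].
by rewrite (negbTE (_ : _ \notin _)) //; apply/mapP => -[].
Qed.

Lemma colours_uniq n : uniq (colours n).
Proof.
elim: n => //= n IH; rewrite cat_uniq !map_inj_uniq //; try by move=> ? ? [].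
by rewrite IH andbT /=; apply/hasPn => c /mapP [e _ ->]; apply/mapP => -[].
Qed.

Lemma sem_ncup n : sem (ncup n) [::] [::] = [seq e ++ rev e | e <- colours n].
Proof.
elim: n => // n IH; rewrite [ncup _.+1]/= sem_comp0 !map_cons !sem_tens0 /=.
rewrite ncup_src drop0 IH !cats0 !allpairs1r -!map_comp map_cat -!map_comp.
by congr (_ ++ _); apply: eq_map => e /=; rewrite rev_cons -cats1 catA.
Qed.

Lemma sem_ncap n e f : size e = n -> size f = n ->
  sem (ncap n) [::] (e ++ f) = if f == rev e then [:: [::]] else [::].
Proof.
elim: n e f => [[|//] [|//]//|n IH]; elim/last_ind => // e a _ [//|b f].
rewrite size_rcons => -[se] [sf]; rewrite sem_comp0 sem_tens0 sem_tens0 cat_rcons.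
rewrite /= take_size_cat // drop_size_cat //= rev_rcons eqseq_cons eq_sym.
case: eqP => _ //=.
by rewrite drop0 !cats0 IH.
Qed.

Section Interpretation.
Context (K : fieldType) (gen : nat -> nat -> Type) (rel : term_rel K gen)
  (X cup cap vec : uarrow rel).

Fixpoint interp d : uarrow rel :=
  match d with
  | DX => X | DCup => cup | DCap => cap | DVec => vec
  | DId n => uid rel n
  | DComp g f => ucomp (interp g) (interp f)
  | DTens f g => utens (interp f) (interp g)
  end.

End Interpretation.
Notation ev S vec := (interp (bX S) (bcup S) (bcap S) vec).

Section Evaluation.
Context (K : fieldType) (gen : nat -> nat -> Type) (rel : term_rel K gen)
  (delta : K) (S : brauer_in rel delta) (vec : uarrow rel).
Hypothesis (vec_src : src vec = 0%N) (vec_tgt : tgt vec = 3%N).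
Local Open Scope arrow_scope.
Local Notation X := (bX S).
Local Notation cup := (bcup S).
Local Notation cap := (bcap S).
Local Notation I n := (uid rel n).

Local Notation ev := (interp X cup cap vec).

Local Notation srctgt := (src_comp, tgt_comp, src_wh, tgt_wh, src_id, tgt_id,
  src_tens, tgt_tens, src_scale, tgt_scale, vec_src, vec_tgt,
  bX_src S, bX_tgt S, bcup_src S, bcup_tgt S, bcap_src S, bcap_tgt S).

Lemma ev_src d : src (ev d) = dsrc d.
Proof. by elim: d => //= [|||g _ f <-|f <- g <-]; rewrite !srctgt. Qed.
Lemma ev_tgt d : tgt (ev d) = dtgt d.
Proof. by elim: d => //= [|||g <- f _|f <- g <-]; rewrite !srctgt. Qed.

(** A Brauer diagram composed with arcs reduces to arcs and loops, and the
    state sum follows this reduction. *)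
Lemma join_diag d a b l : dbrauer d -> paired l ->
  size l = (a + dtgt d + b)%N ->
  exists k l', [/\ paired l', size l' = (a + dsrc d + b)%N,
    join S l ⊙ wh a (ev d) b = uscale (delta ^+ k) (join S l') &
    forall c1 c c2, size c1 = a -> size c = dsrc d -> size c2 = b ->
      (\sum_(e <- sem d [::] c) coloured l (c1 ++ e ++ c2) =
       2 ^ k * coloured l' (c1 ++ c ++ c2))%N].
Proof.
elim: d a b l => [||||n|g IHg f IHf|f IHf g IHg] a b l //=.
- move=> _ p /split_at2 [l1 [x [y [l2 [e <- <-]]]]]; subst l.
  exists 0%N, (l1 ++ y :: x :: l2); split.
  + by rewrite -paired_swap.
  + by rewrite size_cat /=; lia.
  + by rewrite join_swap // expr0 uscale1.
  + move=> c1 [|u [|v []]] // c2 s1 _ s2.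
    by rewrite big_seq1 mul1n /= (coloured_swap _ _ u v).
- move=> _ p /split_at2 [l1 [x [y [l2 [e <- <-]]]]]; subst l.
  have p' : paired (x :: y :: l1 ++ l2).
    by rewrite -(paired_perm (permEl (perm_catCA l1 [:: x; y] l2))).
  have [xy|xy] := eqVneq x y.
    subst y; have [_ xl] := @paired2 x [::] _ p'.
    exists 1%N, (l1 ++ l2); split.
    + by move: p'; rewrite (@paired_cat_cons x [::]).
    + by rewrite size_cat addn0.
    + by rewrite join_cup_front // join_cup_loop.
    + move=> c1 c c2 s1 /size0nil -> s2; rewrite big_cons big_seq1 /=.
      by rewrite !coloured_cup_loop // expn1 mul2n -addnn.
  have xl := paired_mem p' xy.
  have yl : y \in l1 ++ l2.
    by apply: (@paired_mem y x); rewrite 1?eq_sym // -(@paired_swap [::]).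
  have [A [B e]] := mem_split yl; rewrite e in p' *.
  have [yA yB p2] := paired_merge xy p'.
  exists 0%N, (A ++ x :: B); split => //.
  + have /(congr1 size) : l1 ++ l2 = A ++ y :: B by [].
    by rewrite !size_cat /=; lia.
  + by rewrite join_cup_front // e join_cup_merge // expr0 uscale1.
  + move=> c1 c c2 s1 /size0nil -> s2; rewrite big_cons big_seq1 expn0 mul1n.
    rewrite coloured_cup_merge // e map_cat /= eqxx; congr (nat_of_bool (coloured _ _)).
    congr (_ ++ _ :: _); rewrite -[RHS]map_id; apply/eq_in_map => z zl;
     case: eqP => // ez; by rewrite -ez zl in yA yB.
- move=> _ p; rewrite addn0 => /split_at [l1 [l2 [e <- <-]]]; subst l.
  have [z zl] := fresh (l1 ++ l2).
  exists 0%N, (l1 ++ z :: z :: l2); split.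
  + by rewrite paired_front (@paired_cat_cons z [::]).
  + by rewrite size_cat /=; lia.
  + by rewrite (join_cap S zl) // expr0 uscale1.
  + move=> c1 [|u [|v []]] // c2 s1 _ s2; rewrite mul1n /= coloured_cap //.
    by case: eqP => _; rewrite ?big_seq1 ?big_nil.
- move=> _ p sz; exists 0%N, l; split => //.
  + by rewrite wh_id ucompm1 ?expr0 ?uscale1 // join_src.
  + by move=> *; rewrite big_seq1 mul1n.
- move=> /dbrauer_compP [bg bf gf] p sz.
  have [k1 [l1 [p1 s1 e1 c1]]] := IHg a b l bg p sz.
  have [|k2 [l2 [p2 s2 e2 c2]]] := IHf a b l1 bf p1; first by rewrite s1 gf.
  exists (k1 + k2)%N, l2; split => //.
  + rewrite wh_comp ?ev_src ?ev_tgt // ucompA e1 ucompZl e2 uscaleA.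
    by rewrite exprD.
  + move=> u1 u u2 su1 su su2; rewrite big_flatten /= big_map.
    rewrite expnD -mulnA -c2 // big_distrr /= !big_seq.
    by apply: eq_bigr => e /(sem_size0 bf su) es; rewrite c1 // es.
- rewrite dbrauer_tensE => /andP [bf bg] p sz.
  have [|k1 [l1 [p1 s1 e1 c1]]] := IHf a (dtgt g + b)%N l bf p.
    by rewrite sz; lia.
  have [|k2 [l2 [p2 s2 e2 c2]]] := IHg (a + dsrc f)%N b l1 bg p1.
    by rewrite s1; lia.
  exists (k1 + k2)%N, l2; split => //; first by rewrite s2; lia.
  + rewrite uinter_l ev_src ev_tgt wh_comp ?srctgt ?ev_src ?ev_tgt; try lia.
    rewrite !wh_wh addn0 add0n ucompA e1 ucompZl e2 uscaleA.
    by rewrite exprD.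
  + move=> u1 u u2 su1 su su2; rewrite big_allpairs_dep /=.
    rewrite exchange_big /=.
    have -> : u1 ++ u ++ u2 = (u1 ++ take (dsrc f) u) ++ drop (dsrc f) u ++ u2.
      by rewrite -catA (catA (take _ _)) cat_take_drop.
    have st : size (take (dsrc f) u) = dsrc f by rewrite size_take su; case: ltnP; lia.
    have sd : size (drop (dsrc f) u) = dsrc g by rewrite size_drop su; lia.
    rewrite expnD -mulnA -c2 ?size_cat ?su1 ?st ?sd // big_distrr /= !big_seq.
    apply: eq_bigr => e /(sem_size0 bg sd) es.
    rewrite -catA -c1 ?st // ?size_cat ?es ?su2 //.
    by apply: eq_bigr => e' _; rewrite -!catA.
Qed.


(** The inverse of bending all top points down to the right, as done by
    [dbend]. *)
Definition unbend m n (u : uarrow rel) := wh 0 u n ⊙ wh m (ev (ncup n)) 0.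

Definition dbend d := DComp (ncap (dtgt d)) (DTens d (DId (dtgt d))).

Lemma nested_zigzag n : wh 0 (ev (ncap n)) n ⊙ wh n (ev (ncup n)) 0 = I n.
Proof.
elim: n => [|n IH]; first by rewrite (wh_id _ 0 0 0) ucomp1m.
have -> : ev (ncap n.+1) = ev (ncap n) ⊙ wh n cap n.
  by rewrite /wh -utensA.
have -> : ev (ncup n.+1) = wh 1 (ev (ncup n)) 1 ⊙ cup.
  by rewrite /wh -utensA.
rewrite wh_comp ?srctgt ?ev_src ?ncap_src; last lia.
rewrite wh_comp ?srctgt ?ev_src ?ncup_src //.
rewrite !wh_wh add0n addn1 -!ucompA.
rewrite (asl (@wh_xchg _ _ _ 0 n cap (n + n.+1)%N n.+2 (ev (ncup n)) 1 n 1 _ _ _ _));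
  rewrite ?srctgt ?ev_src ?ev_tgt ?ncup_tgt ?ncup_src; try lia.
rewrite -!ucompA (wh_zigzag_l S n 0) addn0 ucompm1; last first.
  by rewrite srctgt ev_src ncup_src; lia.
have -> : wh 0 (ev (ncap n)) n.+1 = wh 0 (wh 0 (ev (ncap n)) n) 1 by uclose.
have -> : wh n (ev (ncup n)) 1 = wh 0 (wh n (ev (ncup n)) 0) 1 by uclose.
rewrite -wh_comp ?srctgt ?ev_src ?ev_tgt ?ncup_tgt ?ncap_src; last lia.
by rewrite IH wh_id addn1.
Qed.

Lemma unbend_bend d : unbend (dsrc d) (dtgt d) (ev (dbend d)) = ev d.
Proof.
rewrite /unbend /dbend /= wh_comp ?srctgt ?ev_src ?ev_tgt ?ncap_src //.
set n := dtgt d; set m := dsrc d.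
have -> : wh 0 (ev d ⊠ I n) n = wh 0 (ev d) (n + n).
  by rewrite -[_ ⊠ I n]utens1m utensA -/(wh 0 _ n) wh_wh.
rewrite -ucompA (@wh_xchg _ _ _ 0 0 (ev d) _ m (ev (ncup n)) 0 n 0);
  rewrite ?ev_src ?ev_tgt ?ncup_src ?ncup_tgt; try lia.
by rewrite ucompA nested_zigzag wh00 ucomp1m // ev_tgt.
Qed.

(** The normal form of a Brauer diagram: arcs joining its boundary points read
    counterclockwise, times a power of [delta]. *)
Lemma diag_normal d : dbrauer d -> exists k l,
  [/\ paired l, size l = (dsrc d + dtgt d)%N,
   ev d = uscale (delta ^+ k) (unbend (dsrc d) (dtgt d) (join S l)) &
   forall c e, size c = dsrc d -> size e = dtgt d ->
     count_mem e (sem d [::] c) = (2 ^ k * coloured l (c ++ rev e))%N].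
Proof.
move=> bd; have [wd /eqP vd] := andP bd.
have bb : dbrauer (dbend d).
  rewrite /dbrauer /= wd vd !addn0 ncap_src eqxx /= andbT.
  by have /andP [-> ->] := ncap_brauer (dtgt d).
have [||k [l [pl sl el cl]]] := @join_diag (dbend d) 0 0 [::] bb => //.
  by rewrite /= ncap_tgt.
exists k, l; split => //; first by rewrite sl /=; lia.
  rewrite -{1}unbend_bend -[X in unbend _ _ X](@ucomp1m _ _ _ _ 0); last first.
    by rewrite ev_tgt /= ncap_tgt.
  rewrite -[ev (dbend d)]wh00 -[I 0]/(join S [::]) el.
  by rewrite /unbend whZ ucompZl.
move=> c e sc se; have := cl [::] (c ++ rev e) [::] erefl _ erefl.
rewrite cats0 => <-; last by rewrite size_cat size_rev sc se.
rewrite /dbend sem_comp0 sem_tens0 -sc take_size_cat // drop_size_cat //.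
rewrite big_flatten /= big_map allpairs1r big_map -sum1_count [RHS]big_seq [LHS]big_mkcond.
rewrite [LHS]big_seq; apply: eq_bigr => e' /sem_size; rewrite vd => /(_ wd erefl sc) se'.
rewrite sem_ncap ?size_rev ?se //.
rewrite (inj_eq (can_inj (@revK bool))) eq_sym /=.
by case: ifP => _; rewrite ?big_seq1 ?big_nil.
Qed.

Lemma coloured_const l v : coloured l (nseq (size l) v).
Proof.
apply/colouredP; first by rewrite size_nseq.
by exists (fun=> v); elim: l => //= x l <-.
Qed.

(** Colourings determine which labels are equal: give one colour to the two
    points of a single label.  This uses at most two points of that colour,
    which keeps the computations below short. *)
Lemma paired_unique k k' l l' : paired l -> paired l' -> size l = size l' ->
  (forall c, size c = size l -> (count id c <= 2)%N ->
     2 ^ k * coloured l c = 2 ^ k' * coloured l' c)%N ->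
  k = k' /\ join S l = join S l'.
Proof.
move=> pl pl' sz H.
have kk : k = k'.
  have := H _ (size_nseq (size l) false).
  rewrite count_nseq mul0n => /(_ isT).
  by rewrite coloured_const sz coloured_const !muln1 => /expnI ->.
split=> //; subst k'.
have {}H c : size c = size l -> (count id c <= 2)%N ->
    coloured l c = coloured l' c.
  move=> /H h /h /eqP; rewrite eqn_pmul2l ?expn_gt0 //.
  by case: coloured; case: coloured.
have E i j : (i < size l)%N -> (j < size l)%N ->
    (nth 0%N l i == nth 0%N l j) = (nth 0%N l' i == nth 0%N l' j).
  have aux m m' : paired m -> size m = size m' ->
      (forall c, size c = size m -> (count id c <= 2)%N ->
         coloured m c -> coloured m' c) ->
      (i < size m)%N -> (j < size m)%N -> nth 0%N m' i = nth 0%N m' j ->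
      nth 0%N m i = nth 0%N m j.
    move=> pm s h im jm e.
    pose c := [seq x == nth 0%N m j | x <- m].
    have c2 : (count id c <= 2)%N.
      rewrite count_map (eq_count (a2 := pred1 (nth 0%N m j))) //.
      by have /eqP -> := allP pm _ (mem_nth 0%N jm).
    have /h : coloured m c.
      by apply/colouredP; [rewrite size_map | exists (pred1 (nth 0%N m j))].
    rewrite size_map => /(_ erefl c2)/colouredP [|f ef]; first by rewrite size_map.
    have ci : nth false c i = (nth 0%N m i == nth 0%N m j).
      by rewrite (nth_map 0%N).
    have cj : nth false c j by rewrite (nth_map 0%N) // eqxx.
    have cij : nth false c i = nth false c j.
      by rewrite ef !(nth_map 0%N) -?s // e.
    by apply/eqP; rewrite -ci cij.
  move=> il jl; apply/eqP/eqP => e; [apply: (aux l' l) | apply: (aux l l')];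
    rewrite ?sz // -?sz // => c sc c2; rewrite H //.
pose f x := nth 0%N l' (index x l).
have -> : l' = map f l.
  apply: (@eq_from_nth _ 0%N); rewrite ?size_map // => i il'.
  rewrite -sz in il'; rewrite (nth_map 0%N) // /f; apply/eqP.
  have il : (index (nth 0%N l i) l < size l)%N by rewrite index_mem mem_nth.
  by rewrite -E // nth_index // mem_nth.
rewrite join_map // => x y xl yl; rewrite /f => /eqP.
by rewrite -E ?index_mem // !nth_index // => /eqP.
Qed.

(** A Brauer diagram is determined, up to the loops that it contains, by its
    state sum: both sides have the same normal form. *)
Theorem brauer_coherence j d d' : dbrauer d -> dbrauer d' ->
  dsrc d = dsrc d' -> dtgt d = dtgt d' ->
  (forall c e, size c = dsrc d -> size e = dtgt d -> (count id c <= 2)%N ->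
     count_mem e (sem d [::] c) = (2 ^ j * count_mem e (sem d' [::] c))%N) ->
  ev d = uscale (delta ^+ j) (ev d').
Proof.
move=> bd bd' es et H.
have [k [l [pl sl -> cl]]] := diag_normal bd.
have [k' [l' [pl' sl' -> cl']]] := diag_normal bd'.
have [|c sc c2|-> ->] := @paired_unique k (j + k') l l' pl pl'.
- by rewrite sl sl' es et.
- have /split_at [c1 [c3 [ec s1 s2]]] : size c = (dsrc d + dtgt d)%N by rewrite sc.
  move: c2; rewrite ec count_cat => c2.
  have := H c1 (rev c3) s1; rewrite size_rev => /(_ s2 (leq_trans (leq_addr _ _) c2)).
  by rewrite cl ?cl' ?size_rev -?es -?et // revK expnD -mulnA.
by rewrite uscaleA -exprD es et.
Qed.

End Evaluation.

(** * State sums of perfect matchings, stacks and juxtapositions *)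
Section Matchings.
Context (r s : nat).
Implicit Types (D : brauer r s) (c e : seq bool) (x y : boundary r s).

Definition colour_at c e x : bool :=
  match x with inl i => nth false c i | inr j => nth false e j end.

Definition fits D c e := [forall x, colour_at c e (D x) == colour_at c e x].

Lemma brauerK D x : D (D x) = x.
Proof. by have /forallP /(_ x) /andP [/eqP] := partnerP D. Qed.
Lemma brauer_neq D x : D x != x.
Proof. by have /forallP /(_ x) /andP [] := partnerP D. Qed.

Lemma colour_at_surj (f : boundary r s -> bool) :
  exists c e, [/\ size c = r, size e = s & colour_at c e =1 f].
Proof.
exists [seq f (inl i) | i <- enum 'I_r], [seq f (inr i) | i <- enum 'I_s].
do 2! rewrite size_map size_enum_ord; split => // -[i|i] /=.
  by rewrite (nth_map i) ?size_enum_ord // nth_ord_enum.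
by rewrite (nth_map i) ?size_enum_ord // nth_ord_enum.
Qed.

(** A matching is recovered from its colourings: colour exactly [x] and
    [D x]. *)
Lemma fits_separates D x y :
  (forall c e, size c = r -> size e = s -> fits D c e ->
     colour_at c e x = colour_at c e y) -> y = x \/ y = D x.
Proof.
move=> H; have [c [e [sc se E]]] := colour_at_surj (fun z => z \in [:: x; D x]).
have /(H _ _ sc se) : fits D c e.
  apply/forallP => z; rewrite !E !inE (can2_eq (brauerK D) (brauerK D)).
  by rewrite (can_eq (brauerK D)) orbC.
rewrite !E mem_head => /esym; rewrite !inE => /orP [] /eqP ->; by [left|right].
Qed.

(** The top points are listed backwards, as they occur after bending. *)
Definition points : seq (boundary r s) :=
  map inl (enum 'I_r) ++ rev (map inr (enum 'I_s)).

Lemma mem_points x : x \in points.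
Proof.
rewrite mem_cat mem_rev; case: x => i.
  by rewrite (map_f inl (mem_enum _ i)).
by rewrite (map_f inr (mem_enum _ i)) orbT.
Qed.

Lemma points_uniq : uniq points.
Proof.
have inl_inj : injective (inl : 'I_r -> boundary r s) by move=> ? ? [].
have inr_inj : injective (inr : 'I_s -> boundary r s) by move=> ? ? [].
rewrite cat_uniq rev_uniq (map_inj_uniq inl_inj) (map_inj_uniq inr_inj).
rewrite !enum_uniq andbT /=; apply/hasPn => x; rewrite mem_rev => /mapP [i _ ->].
by apply/mapP => -[].
Qed.

Lemma size_points : size points = (r + s)%N.
Proof. by rewrite size_cat size_rev (size_map inl) (size_map inr) !size_enum_ord. Qed.

Lemma colour_points c e : size c = r -> size e = s ->
  [seq colour_at c e x | x <- points] = c ++ rev e.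
Proof.
move=> sc se; rewrite map_cat map_rev; congr (_ ++ rev _); rewrite -map_comp.
  apply: (@eq_from_nth _ false); rewrite size_map size_enum_ord // => i ir.
  by rewrite (nth_map (Ordinal ir)) ?size_enum_ord //= nth_enum_ord.
apply: (@eq_from_nth _ false); rewrite size_map size_enum_ord // => i ir.
by rewrite (nth_map (Ordinal ir)) ?size_enum_ord //= nth_enum_ord.
Qed.

Definition label D x := minn (index x points) (index (D x) points).
Definition labels D := map (label D) points.

Lemma label_eq D x y : (label D y == label D x) = (y \in [:: x; D x]).
Proof.
rewrite !inE; apply/eqP/orP => [|[/eqP ->|/eqP ->]] //; last first.
  by rewrite /label brauerK minnC.
have I u v : index u points = index v points -> u = v.
  by move=> e; rewrite -(nth_index x (mem_points u)) e nth_index ?mem_points.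
rewrite /label /minn; do 2 case: ltnP => _; move/I.
- by move=> ->; left.
- by move=> ->; right.
- by move=> <-; right; rewrite brauerK.
- by move/(can_inj (brauerK D)) => ->; left.
Qed.

Lemma count_pair D x : count (fun y => y \in [:: x; D x]) points = 2%N.
Proof.
have E : (fun y => y \in [:: x; D x]) =1 predU (pred1 x) (pred1 (D x)).
  by move=> y; rewrite !inE.
have := count_predUI (pred1 x) (pred1 (D x)) points.
rewrite !count_uniq_mem ?points_uniq // !mem_points (eq_count E).
rewrite (@eq_count _ (predI _ _) pred0) ?count_pred0 ?addn0 // => y /=.
by case: eqP => //= ->; rewrite eq_sym (negbTE (brauer_neq D x)).
Qed.

Lemma labels_paired D : paired (labels D).
Proof.
rewrite /paired /labels all_map; apply/allP => x _ /=.
rewrite count_map; apply/eqP; rewrite -[RHS](count_pair D x).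
by apply: eq_count => y /=; rewrite label_eq.
Qed.

Lemma size_labels D : size (labels D) = (r + s)%N.
Proof. by rewrite size_map size_points. Qed.

Lemma coloured_labels D c e : size c = r -> size e = s ->
  coloured (labels D) (c ++ rev e) = fits D c e.
Proof.
move=> sc se; apply/colouredP/forallP.
- by rewrite size_labels size_cat size_rev sc se.
- move=> [f]; rewrite -colour_points // -map_comp => /eq_in_map E x.
  rewrite !E ?mem_points //=; apply/eqP; congr f; apply/eqP.
  by rewrite label_eq !inE eqxx orbT.
move=> H; exists (nth false (c ++ rev e)); rewrite -colour_points // -map_comp.
apply: eq_map => x /=; rewrite /label /minn; case: ltnP => _.
  by rewrite (nth_map x) ?index_mem ?mem_points // nth_index ?mem_points.
rewrite (nth_map x) ?index_mem ?mem_points // nth_index ?mem_points //.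
by rewrite (eqP (H x)).
Qed.

(** Every list of paired labels comes from a matching: the partner of a point
    is the other point with the same label. *)
Lemma paired_matching l : paired l -> size l = (r + s)%N ->
  exists D, forall c e, size c = r -> size e = s ->
    coloured l (c ++ rev e) = fits D c e.
Proof.
move=> pl sl; pose lab x := nth 0%N l (index x points).
have lE : l = map lab points.
  apply: (@eq_from_nth _ 0%N); rewrite ?size_map ?size_points // => i il.
  have [x0 _] : exists x0 : boundary r s, true.
    have: (0 < size points)%N by rewrite size_points -sl; lia.
    by case: points => // x0 p _; exists x0.
  rewrite (nth_map x0) ?size_points -?sl // /lab index_uniq ?points_uniq //.
  by rewrite size_points -sl.
have cnt x : count (fun y => lab y == lab x) points = 2%N.
  have /(allP pl) : lab x \in l by rewrite lE map_f ?mem_points.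
  by rewrite [X in count_mem _ X]lE count_map => /eqP.
have mateP x : exists m, m != x /\ forall y, (lab y == lab x) = (y \in [:: x; m]).
  pose p := [seq y <- points | lab y == lab x].
  have mp y : (lab y == lab x) = (y \in p) by rewrite mem_filter mem_points andbT.
  have sp : size p = 2%N by rewrite size_filter cnt.
  have up : uniq p by rewrite filter_uniq ?points_uniq.
  have xp : x \in p by rewrite -mp.
  clearbody p; case: p sp up xp mp => [|a [|b []]] //= _ /andP [+ _].
  rewrite !inE => ab /orP [] /eqP -> mp.
    by exists b; split => [|y]; [rewrite eq_sym | rewrite mp !inE].
  by exists a; split => [|y] //; rewrite mp !inE orbC.
have [f fP] := choice mateP.
have fne x : f x != x by case: (fP x).
have fE x y : (lab y == lab x) = (y \in [:: x; f x]) by case: (fP x).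
have ff x : f (f x) = x.
  have : x \in [:: f x; f (f x)] by rewrite -fE eq_sym fE !inE eqxx orbT.
  by rewrite !inE eq_sym (negbTE (fne x)) => /eqP.
have mf : is_matching [ffun x => f x].
  by apply/forallP => x; rewrite !ffunE ff eqxx fne.
exists (Brauer mf) => c e sc se; apply/colouredP/forallP.
- by rewrite sl size_cat size_rev sc se.
- move=> [g]; rewrite -colour_points // lE -map_comp => /eq_in_map E x.
  rewrite !E ?mem_points //= ffunE; apply/eqP; congr g; apply/eqP.
  by rewrite fE !inE eqxx orbT.
move=> H; exists (fun n => nth false (c ++ rev e) (index n l)).
rewrite -colour_points // {2}lE -map_comp; apply: eq_map => x /=.
have xl : lab x \in l by rewrite lE map_f ?mem_points.
have il : (index (lab x) l < size points)%N.
  by rewrite size_points -sl index_mem.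
rewrite (nth_map x) //.
have : lab (nth x points (index (lab x) l)) == lab x.
  by rewrite -(nth_map x 0%N) // -lE nth_index.
rewrite fE !inE => /orP [] /eqP -> //.
by have := H x; rewrite /= ffunE => /eqP.
Qed.

End Matchings.

(** Some Brauer diagram connects the points with equal labels. *)
Definition realised l := exists d,
  [/\ dbrauer d, dsrc d = size l, dtgt d = 0%N &
    forall c, size c = size l -> sem d [::] c = nseq (coloured l c) [::]].

Lemma realised_swap P u v Q : realised (P ++ u :: v :: Q) -> realised (P ++ v :: u :: Q).
Proof.
case=> d [bd sd td H]; have [wd vd] := andP bd.
exists (DComp d (DTens (DId (size P)) (DTens DX (DId (size Q))))).
rewrite size_cat /= in sd; split => //.
- by rewrite /dbrauer /= wd vd sd eqxx.
- by rewrite size_cat /=; lia.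
- move=> c; rewrite size_cat [size (_ :: _)]/= => sc.
  have /split_at2 [c1 [a [b [c2 [-> s1 s2]]]]] : size c = (size P + 2 + size Q)%N.
    by rewrite sc; lia.
  rewrite sem_comp0 sem_tens0 /= take_size_cat // drop_size_cat //= take0 drop0.
  rewrite cats0 H; last by rewrite !size_cat /= s1 s2.
  by rewrite (coloured_swap _ _ a b).
Qed.

Lemma realised_move P x A Q : realised (P ++ x :: A ++ Q) -> realised (P ++ A ++ x :: Q).
Proof.
elim: A P => // a A IH P /realised_swap; rewrite -cat_rcons => /IH.
by rewrite cat_rcons.
Qed.

Lemma paired_realised l : paired l -> realised l.
Proof.
move: {2}(size l) (leqnn (size l)) => n; elim: n l => [|n IH] [|x l] //=.
- by move=> _ _; exists (DId 0); split => // -[].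
- by move=> _ _; exists (DId 0); split => // -[].
rewrite ltnS => ln p; have [A [B [e xA xB pAB]]] := pairedP p.
rewrite {}e in ln p *; apply: (@realised_move [:: x]).
have [|d [bd sd td H]] := IH (A ++ B) _ pAB.
  by move: ln; rewrite !size_cat /=; lia.
have [wd vd] := andP bd.
exists (DTens DCap d); split => //=; first by rewrite /dbrauer /= wd addn0 vd.
  by rewrite sd.
move=> [|a [|b c]] //= [sc]; rewrite (@coloured_cap x [::] (A ++ B) [::]) //; last first.
  by rewrite /= mem_cat negb_or xA.
by case: eqP => _; rewrite //= ?take0 ?drop0 H // cats0 map_id.
Qed.

(** The diagram [d] connects the boundary points that [D] matches, without
    loops. *)
Definition draws r s (D : brauer r s) d :=
  [/\ dbrauer d, dsrc d = r, dtgt d = s &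
    forall c e, size c = r -> size e = s ->
      count_mem e (sem d [::] c) = fits D c e].

(** Draw the arcs between the labels, then bend the top points up again. *)
Lemma drawing_exists r s (D : brauer r s) : exists d, draws D d.
Proof.
have [d [bd sd td H]] := paired_realised (labels_paired D).
rewrite size_labels in sd H; have [wd /eqP vd] := andP bd.
have /andP [wu /eqP vu] := ncup_brauer s.
exists (DComp (DTens d (DId s)) (DTens (DId r) (ncup s))); split.
- by rewrite /dbrauer /= wd wu vd vu sd ncup_tgt addnA eqxx.
- by rewrite /= ncup_src addn0.
- by rewrite /= td.
move=> c e sc se; rewrite -coloured_labels //.
rewrite sem_comp0 sem_tens0 -[dsrc (DId r)]sc take_size drop_size sem_ncup.
rewrite allpairs1l -map_comp count_flatten sumnE -map_comp big_map big_map.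
have E f : size f = s ->
    count_mem e (sem (DTens d (DId s)) [::] (c ++ f ++ rev f)) =
    (coloured (labels D) (c ++ f) * (rev f == e))%N.
  move=> sf; rewrite sem_tens0 sd catA.
  have sz : size (c ++ f) = (r + s)%N by rewrite size_cat sc sf.
  rewrite -sz take_size_cat // drop_size_cat // H //.
  by case: coloured; rewrite //= mul1n addn0.
rewrite (bigD1_seq (rev e)) ?colours_uniq ?mem_colours ?size_rev ?se //=.
rewrite E ?size_rev // revK eqxx muln1 big_seq_cond big1 ?addn0 // => f.
rewrite mem_colours => /andP [/eqP sf fe]; rewrite E //.
by rewrite -(inj_eq (can_inj (@revK bool))) revK in fe; rewrite (negbTE fe) muln0.
Qed.

Section DiagramMatching.
Context (K : fieldType) (gen : nat -> nat -> Type) (rel : term_rel K gen)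
  (delta : K) (S : brauer_in rel delta).

Lemma diag_matching d : dbrauer d ->
  exists k (D : brauer (dsrc d) (dtgt d)), forall c e,
    size c = dsrc d -> size e = dtgt d ->
    count_mem e (sem d [::] c) = (2 ^ k * fits D c e)%N.
Proof.
move=> bd.
have [k [l [pl sl _ H]]] := @diag_normal _ _ _ _ S
  (cls rel (@TZero K gen 0 3)) erefl erefl d bd.
have [D HD] := paired_matching pl sl.
by exists k, D => c e sc se; rewrite H // HD.
Qed.
End DiagramMatching.

Lemma count_mem_sum (T : eqType) (ss us : seq T) (F : T -> nat) :
  uniq us -> {subset ss <= us} ->
  (\sum_(e <- ss) F e = \sum_(e <- us) count_mem e ss * F e)%N.
Proof.
move=> uu; elim: ss => [|e ss IH] sub.
  by rewrite big_nil big1 // => e _; rewrite mul0n.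
rewrite big_cons IH; last by move=> x xs; apply: sub; rewrite inE xs orbT.
rewrite [RHS](eq_bigr (fun x => (e == x) * F x + count_mem x ss * F x)%N); last first.
  by move=> x _; rewrite -mulnDl.
rewrite big_split /= [X in _ = (X + _)%N](bigD1_seq e) ?sub ?mem_head //=.
rewrite eqxx mul1n; congr (_ + _)%N.
rewrite big1 ?addn0 // => x xe; by rewrite eq_sym (negbTE xe).
Qed.

Lemma count_sem_comp g f c d : dbrauer f -> size c = dsrc f ->
  count_mem d (sem (DComp g f) [::] c) =
  (\sum_(e <- colours (dtgt f))
     count_mem e (sem f [::] c) * count_mem d (sem g [::] e))%N.
Proof.
move=> /andP [wf /eqP vf] sc.
rewrite sem_comp0 count_flatten sumnE -map_comp big_map /=.
apply: count_mem_sum (colours_uniq _) _ => e /sem_size se.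
by rewrite mem_colours se // vf.
Qed.

Section Stacks.
Context (r s t : nat) (B : brauer s t) (A : brauer r s).
Local Notation E := (stack_edge B A).

(** The number of colourings of the middle points that extend a colouring of
    the outer ones: the state sum of the stack. *)
Definition stack_count c d :=
  count (fun e => fits A c e && fits B e d) (colours s).

Definition stack_colour c e d (p : stack_point r s t) : bool :=
  match p with
  | inl (inl i) => nth false c i
  | inl (inr j) => nth false e j
  | inr k => nth false d k
  end.

Definition consistent (g : stack_point r s t -> bool) := forall p q, E p q -> g p = g q.

Lemma stack_edgeP p q : reflect
  ((exists a, p = lower_point t a /\ q = lower_point t (A a)) \/
   (exists b, p = upper_point r b /\ q = upper_point r (B b))) (E p q).
Proof.
apply: (iffP orP) => -[].
- by move=> /existsP [a /andP [/eqP -> /eqP ->]]; left; exists a.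
- by move=> /existsP [b /andP [/eqP -> /eqP ->]]; right; exists b.
- by move=> [a [-> ->]]; left; apply/existsP; exists a; rewrite !eqxx.
- by move=> [b [-> ->]]; right; apply/existsP; exists b; rewrite !eqxx.
Qed.

Lemma stack_edge_sym : symmetric E.
Proof.
suff H p q : E p q -> E q p by move=> p q; apply/idP/idP; exact: H.
move=> /stack_edgeP [[a [-> ->]]|[b [-> ->]]]; apply/stack_edgeP.
  by left; exists (A a); rewrite brauerK.
by right; exists (B b); rewrite brauerK.
Qed.

Lemma stack_connect_sym : connect_sym E.
Proof. exact/sym_connect_sym/stack_edge_sym. Qed.

Lemma stack_colour_lower c e d a : stack_colour c e d (lower_point t a) = colour_at c e a.
Proof. by case: a. Qed.
Lemma stack_colour_upper c e d b : stack_colour c e d (upper_point r b) = colour_at e d b.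
Proof. by case: b. Qed.
Lemma stack_colour_outer c e d x :
  stack_colour c e d (outer_point s x) = colour_at c d x.
Proof. by case: x. Qed.

Lemma fits_consistent c e d :
  fits A c e && fits B e d <-> consistent (stack_colour c e d).
Proof.
split=> [/andP [/forallP fA /forallP fB] p q|H].
  move=> /stack_edgeP [[a [-> ->]]|[b [-> ->]]].
    by rewrite !stack_colour_lower (eqP (fA a)).
  by rewrite !stack_colour_upper (eqP (fB b)).
apply/andP; split; apply/forallP => x; apply/eqP.
  rewrite -!(stack_colour_lower c e d); apply: H; rewrite stack_edge_sym.
  by apply/stack_edgeP; left; exists x.
rewrite -!(stack_colour_upper c e d); apply: H; rewrite stack_edge_sym.
by apply/stack_edgeP; right; exists x.
Qed.

Lemma consistent_connect g p q : consistent g -> connect E p q -> g p = g q.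
Proof.
move=> H /connectP [l pl ->]; elim: l p pl => //= a l IH p /andP [/H -> ].
exact: IH.
Qed.

Lemma connect_consistent p : consistent (connect E p).
Proof.
move=> q q' h; apply/idP/idP => c; apply: connect_trans c _; apply: connect1 => //.
by rewrite stack_edge_sym.
Qed.

Lemma stack_colour_surj g : exists c e d,
  [/\ size c = r, size e = s, size d = t & stack_colour c e d =1 g].
Proof.
have [c [e [sc se H]]] := @colour_at_surj r s (fun x => g (lower_point t x)).
have [e' [d [se' sd H']]] := @colour_at_surj s t (fun x => g (upper_point r x)).
exists c, e, d; split => // -[[i|j]|k] /=.
- exact: (H (inl i)).
- exact: (H (inr j)).
- exact: (H' (inr k)).
Qed.

(** Colourings of the stack are functions that are constant on the components
    of the graph [stack_edge].  They extend a colouring of the outer points in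
    as many ways as there are colourings of the components without outer
    points, that is, of the loops. *)
Lemma stack_determined D k :
  (forall c d, size c = r -> size d = t ->
    stack_count c d = (2 ^ k * fits D c d)%N) ->
  is_stack B A D /\ stack_loops B A = k.
Proof.
move=> H; split.
  apply/forallP => x; apply/forallP => y; apply/eqP; apply/eqP/andP.
    move=> <-; split; first by rewrite eq_sym brauer_neq.
    have [c [e [d [sc se sd cE]]]] := stack_colour_surj (connect E (outer_point s x)).
    have ok : fits A c e && fits B e d.
      apply/fits_consistent => p q; rewrite !cE; exact: connect_consistent.
    have : fits D c d.
      have : (0 < stack_count c d)%N.
        rewrite -has_count; apply/hasP; exists e => //.
        by rewrite mem_colours se.
      by rewrite H //; case: fits => //; rewrite muln0.
    move=> /forallP /(_ x); rewrite -!(stack_colour_outer c e d) !cE.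
    by rewrite connect0 => /eqP.
  move=> [xy cxy]; have [] // : y = x \/ y = D x; last first.
    by move=> e; rewrite e eqxx in xy.
  apply: fits_separates => c d sc sd fD.
  have : (0 < stack_count c d)%N by rewrite H // fD muln1 expn_gt0.
  rewrite -has_count => /hasP [e _ /fits_consistent /consistent_connect].
  by move=> /(_ _ _ cxy); rewrite !stack_colour_outer.
(* With all outer points of colour [false], the colourings correspond to the
   sets of loops of colour [true]. *)
set c := nseq r false; set d := nseq t false.
have fD : fits D c d.
  by apply/forallP => x; case: x (D x) => i [] j; rewrite /= !nth_nseq !if_same.
have := H c d (size_nseq _ _) (size_nseq _ _); rewrite fD muln1 /stack_loops.
pose a p := ~~ [exists x, connect E p (outer_point s x)].
move=> ck; apply: (@expnI 2) => //; rewrite -ck.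
pose R := [set p | fingraph.roots E p && a p].
have -> : n_comp E [pred p | a p] = #|R|.
  by rewrite /n_comp_mem cardsE; apply: eq_card => p; rewrite !inE.
rewrite -card_powerset /stack_count -size_filter.
pose col (P : {set stack_point r s t}) :=
  [seq fingraph.root E (inl (inr j)) \in P | j <- enum 'I_s].
have size_col P : size (col P) = s by rewrite size_map size_enum_ord.
have nth_col P j : nth false (col P) (nat_of_ord j) = (fingraph.root E (inl (inr j)) \in P).
  by rewrite (nth_map j) ?size_enum_ord // nth_ord_enum.
have outer0 e x : stack_colour c e d (outer_point s x) = false.
  by rewrite stack_colour_outer; case: x => i; rewrite /= nth_nseq if_same.
have col_root (P : {set stack_point r s t}) : P \subset R -> stack_colour c (col P) d =1 (fun p => fingraph.root E p \in P).
  move=> /subsetP PR p; case: p => [[i|j]|k'] //=.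
  - rewrite nth_nseq if_same; apply/esym/negbTE/negP => /PR.
    rewrite inE => /andP [_ /existsP]; apply; exists (inl i).
    by rewrite stack_connect_sym connect_root.
  - rewrite nth_nseq if_same; apply/esym/negbTE/negP => /PR.
    rewrite inE => /andP [_ /existsP]; apply; exists (inr k').
    by rewrite stack_connect_sym connect_root.
have col_ok (P : {set stack_point r s t}) : P \subset R -> fits A c (col P) && fits B (col P) d.
  move=> PR; apply/fits_consistent => p q pq; rewrite !col_root //.
  by have /connect1/(fingraph.rootP stack_connect_sym) -> := pq.
have col_inj : {in powerset R &, injective col}.
  move=> P Q; rewrite !powersetE => PR QR ePQ.
  apply/setP => p; case pR : (p \in R); last first.
    by rewrite !(contraFF (subsetP _ p) pR).
  move: pR; rewrite inE => /andP [/eqP rp _].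
  by rewrite -rp -!col_root // ePQ.
rewrite cardE -(size_map col); apply: perm_size; apply: uniq_perm.
- by rewrite map_inj_in_uniq ?enum_uniq // => P Q; rewrite !mem_enum; exact: col_inj.
- by rewrite filter_uniq ?colours_uniq.
move=> e; rewrite mem_filter mem_colours; apply/mapP/andP.
  by move=> [P]; rewrite mem_enum powersetE => PR ->; rewrite size_col col_ok.
move=> [/fits_consistent ok /eqP se].
exists [set p in R | stack_colour c e d p].
  by rewrite mem_enum powersetE; apply/subsetP => p; rewrite inE => /andP [].
apply: (@eq_from_nth _ false); rewrite ?size_col // se => i si.
rewrite (nth_col _ (Ordinal si)) !inE roots_root; last exact: stack_connect_sym.
have cr := connect_root E (inl (inr (Ordinal si))).
rewrite -(consistent_connect ok cr) /=.
case: (boolP (nth _ _ _)) => [h|_]; last by rewrite andbF.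
rewrite andbT /=; apply/esym/existsP => -[x cx].
have := consistent_connect ok (connect_trans cr cx).
by rewrite outer0 /= h.
Qed.

Lemma count_sem_stack k k' g f : dbrauer f -> dsrc f = r -> dtgt f = s ->
  (forall c e, size c = r -> size e = s ->
    count_mem e (sem f [::] c) = (2 ^ k * fits A c e)%N) ->
  (forall e d, size e = s -> size d = t ->
    count_mem d (sem g [::] e) = (2 ^ k' * fits B e d)%N) ->
  forall c d, size c = r -> size d = t ->
  count_mem d (sem (DComp g f) [::] c) = (2 ^ (k' + k) * stack_count c d)%N.
Proof.
move=> bf sf tf Hf Hg c d sc sd; rewrite count_sem_comp ?sf // tf expnD.
rewrite /stack_count -sum1_count big_distrr /=.
rewrite [RHS]big_mkcond [LHS]big_seq [RHS]big_seq; apply: eq_bigr => e.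
rewrite mem_colours => /eqP se; rewrite Hf // Hg //.
by do 2 case: fits; rewrite /= ?muln0 ?mul0n ?muln1 // mulnC.
Qed.

Lemma draws_comp g f : draws A f -> draws B g ->
  dbrauer (DComp g f) /\ forall c d, size c = r -> size d = t ->
  count_mem d (sem (DComp g f) [::] c) = stack_count c d.
Proof.
move=> [bf sf tf Hf] [bg sg tg Hg]; split=> [|c d sc sd].
  by apply/dbrauer_compP; rewrite sg.
rewrite (@count_sem_stack 0 0) ?mul1n // => [c' e s1 s2|e d' s1 s2].
  by rewrite mul1n Hf.
by rewrite mul1n Hg.
Qed.
End Stacks.

Lemma is_stack_unique r s t (B : brauer s t) (A : brauer r s) D D' :
  is_stack B A D -> is_stack B A D' -> D = D'.
Proof.
move=> h h'; apply: val_inj; apply/ffunP => x; apply/esym/eqP.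
have /forallP /(_ x) /forallP /(_ (D x)) /eqP := h; rewrite eqxx => e.
by have /forallP /(_ x) /forallP /(_ (D x)) /eqP := h'; rewrite -e.
Qed.

Section DiagramProducts.
Context (K : fieldType) (gen : nat -> nat -> Type) (rel : term_rel K gen)
  (delta : K) (S : brauer_in rel delta).

(** The stack is the matching drawn by the composite of drawings of [A] and
    [B]. *)
Lemma stack_exists r s t (B : brauer s t) (A : brauer r s) :
  exists D, [/\ is_stack B A D, (forall D', is_stack B A D' = (D' == D)) &
    forall c d, size c = r -> size d = t ->
      stack_count B A c d = (2 ^ stack_loops B A * fits D c d)%N].
Proof.
have [f df] := drawing_exists A; have [g dg] := drawing_exists B.
have [bgf H] := draws_comp df dg; case: df dg H => [_ sf tf _] [_ sg tg _] H.
have [k [D HD]] := diag_matching S bgf; rewrite /= in D HD.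
subst r t.
have [st lo] : is_stack B A D /\ stack_loops B A = k.
  by apply: stack_determined => c d sc sd; rewrite -H // HD.
exists D; split => //.
  move=> D'; apply/idP/eqP => [st'|-> //]; exact: is_stack_unique st' st.
by move=> c d sc sd; rewrite lo -HD // H.
Qed.

Lemma count_cat_pairs (e e' : seq bool) ss ss' :
  (forall u, u \in ss -> size u = size e) ->
  count_mem (e ++ e') [seq u ++ u' | u <- ss, u' <- ss'] =
  (count_mem e ss * count_mem e' ss')%N.
Proof.
elim: ss => //= u ss IH H; rewrite count_cat mulnDl IH; last first.
  by move=> v vs; apply: H; rewrite inE vs orbT.
congr addn; rewrite count_map; case: (eqVneq u e) => [->|ue] /=.
  by rewrite mul1n; apply: eq_count => u' /=; rewrite eqseq_cat // eqxx.
rewrite mul0n (@eq_count _ _ pred0) ?count_pred0 // => u' /=.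
by rewrite (eqseq_cat _ _ (H _ (mem_head _ _))) (negbTE ue).
Qed.

Lemma count_sem_tens f g c c' e e' : dbrauer f -> size c = dsrc f ->
  size e = dtgt f ->
  count_mem (e ++ e') (sem (DTens f g) [::] (c ++ c')) =
  (count_mem e (sem f [::] c) * count_mem e' (sem g [::] c'))%N.
Proof.
move=> bf sc se; rewrite sem_tens0 -sc take_size_cat // drop_size_cat //.
by rewrite count_cat_pairs // => u /(sem_size0 bf sc); rewrite se.
Qed.

Lemma colour_at_left r s r' s' c e c' e' (x : boundary r s) :
  size c = r -> size e = s ->
  colour_at (c ++ c') (e ++ e') (left_point r' s' x) = colour_at c e x.
Proof. by move=> sc se; case: x => i /=; rewrite nth_cat ?sc ?se ltn_ord. Qed.

Lemma colour_at_right r s r' s' c e c' e' (x : boundary r' s') :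
  size c = r -> size e = s ->
  colour_at (c ++ c') (e ++ e') (right_point r s x) = colour_at c' e' x.
Proof.
by move=> sc se; case: x => i /=; rewrite nth_cat ?sc ?se ltnNge leq_addr /= addKn.
Qed.

Lemma left_point_inj r s r' s' : injective (@left_point r s r' s').
Proof. by move=> [i|i] [j|j] //= [] /val_inj ->. Qed.
Lemma right_point_inj r s r' s' : injective (@right_point r s r' s').
Proof. by move=> [i|i] [j|j] //= [] /addnI /val_inj ->. Qed.

Lemma point_cases r s r' s' (z : boundary (r + r') (s + s')) :
  (exists x, z = left_point r' s' x) \/ (exists y, z = right_point r s y).
Proof.
case: z => i; case: (split_ordP i) => j ->.
- by left; exists (inl j).
- by right; exists (inl j).
- by left; exists (inr j).
- by right; exists (inr j).
Qed.

Lemma fits_const r s (D : brauer r s) v : fits D (nseq r v) (nseq s v).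
Proof.
apply/forallP => x; have E (y : boundary r s) : colour_at (nseq r v) (nseq s v) y = v.
  by case: y => i; rewrite /= nth_nseq ltn_ord.
by rewrite !E.
Qed.

Lemma juxtaposition_exists r s r' s' (A : brauer r s) (B : brauer r' s') :
  exists D, [/\ (forall D', is_juxtaposition A B D' = (D' == D)) &
    forall c e c' e', size c = r -> size e = s -> size c' = r' -> size e' = s' ->
      fits D (c ++ c') (e ++ e') = fits A c e && fits B c' e'].
Proof.
have [f [bf sf tf Hf]] := drawing_exists A.
have [g [bg sg tg Hg]] := drawing_exists B.
have bfg : dbrauer (DTens f g) by rewrite dbrauer_tensE bf bg.
have [k [D HD]] := diag_matching S bfg; rewrite /= in D HD.
move: sf tf sg tg => sf tf sg tg; subst r s r' s'.
have {}HD c e c' e' : size c = dsrc f -> size e = dtgt f -> size c' = dsrc g ->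
    size e' = dtgt g ->
    (fits A c e * fits B c' e' = 2 ^ k * fits D (c ++ c') (e ++ e'))%N.
  move=> sc se sc' se'; rewrite -HD ?size_cat ?sc ?se ?sc' ?se' //.
  rewrite -[RHS]/(count_mem (e ++ e') (sem (DTens f g) [::] (c ++ c'))).
  by rewrite count_sem_tens // Hf ?Hg.
have k0 : k = 0%N.
  have := HD _ _ _ _ (size_nseq _ true) (size_nseq _ true)
                     (size_nseq _ true) (size_nseq _ true).
  rewrite !fits_const -!nseqD fits_const !muln1.
  by move=> e; apply: (@expnI 2).
have {}HD c e c' e' : size c = dsrc f -> size e = dtgt f -> size c' = dsrc g ->
    size e' = dtgt g ->
    fits D (c ++ c') (e ++ e') = fits A c e && fits B c' e'.
  move=> sc se sc' se'; have := HD _ _ _ _ sc se sc' se'; rewrite k0 mul1n.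
  by do 3 case: fits.
have DA x : D (left_point _ _ x) = left_point _ _ (A x).
  have [|/left_point_inj e|] // := @fits_separates _ _ D (left_point _ _ x) (left_point _ _ (A x)).
    move=> c e /split_at [c1 [c2 [-> s1 s2]]] /split_at [e1 [e2 [-> t1 t2]]].
    rewrite HD // => /andP [/forallP fA _].
    by rewrite !colour_at_left // (eqP (fA x)).
  by have := brauer_neq A x; rewrite e eqxx.
have DB x : D (right_point _ _ x) = right_point _ _ (B x).
  have [|/right_point_inj e|] // := @fits_separates _ _ D (right_point _ _ x) (right_point _ _ (B x)).
    move=> c e /split_at [c1 [c2 [-> s1 s2]]] /split_at [e1 [e2 [-> t1 t2]]].
    rewrite HD // => /andP [_ /forallP fB].
    by rewrite !colour_at_right // (eqP (fB x)).
  by have := brauer_neq B x; rewrite e eqxx.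
exists D; split => // D'; apply/andP/eqP => [[/forallP hA /forallP hB]|->].
  apply: val_inj; apply/ffunP => z.
  have [[x ->]|[y ->]] := point_cases z.
    by rewrite /= (eqP (hA x)) -DA.
  by rewrite /= (eqP (hB y)) -DB.
by split; apply/forallP => x; rewrite ?DA ?DB.
Qed.

End DiagramProducts.

(** * Crossings of blocks, and the Brauer category in both categories *)
(** One strand crossing [n] strands from left to right. *)
Fixpoint dpush n : diag :=
  if n is n'.+1 then DComp (DTens (DId 1) (dpush n')) (DTens DX (DId n'))
  else DId 1.

Fixpoint dcross c n : diag :=
  if c is c'.+1 then DComp (DTens (dcross c' n) (DId 1)) (DTens (DId c') (dpush n))
  else DId n.

Lemma dpush_src n : dsrc (dpush n) = n.+1.
Proof. by case: n. Qed.
Lemma dpush_tgt n : dtgt (dpush n) = n.+1.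
Proof. by elim: n => //= n ->. Qed.
Lemma dpush_brauer n : dbrauer (dpush n).
Proof.
rewrite /dbrauer; elim: n => //= n /andP [-> /eqP ->].
by rewrite dpush_src eqxx.
Qed.
Lemma dcross_src c n : dsrc (dcross c n) = (c + n)%N.
Proof. by case: c => //= c; rewrite dpush_src; lia. Qed.
Lemma dcross_tgt c n : dtgt (dcross c n) = (n + c)%N.
Proof. by elim: c => [|c IH] /=; rewrite ?IH; lia. Qed.
Lemma dcross_brauer c n : dbrauer (dcross c n).
Proof.
rewrite /dbrauer; elim: c => //= c /andP [-> /eqP ->].
have /andP [-> /eqP ->] := dpush_brauer n.
by rewrite dcross_src dpush_tgt addn1 addnS eqxx.
Qed.

Lemma sem_dpush n a l : size l = n -> sem (dpush n) [::] (a :: l) = [:: rcons l a].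
Proof.
elim: n l => [[]//|n IH] [|b l] // [sl]; rewrite [dpush _]/= sem_comp0 sem_tens0.
rewrite /= !take0 !drop0 -[rev [:: a; b]]/[:: b; a] /= ?take0 ?drop0 IH // ?cats0.
Qed.

Lemma sem_dcross c n u v : size u = c -> size v = n ->
  sem (dcross c n) [::] (u ++ v) = [:: v ++ u].
Proof.
elim: c u v => [|c IH] u v; first by move=> /size0nil -> _; rewrite /= cats0.
case/lastP: u => // u a; rewrite size_rcons => -[su] sv.
rewrite [dcross _ _]/= sem_comp0 sem_tens0 [dsrc (DId c)]/= cat_rcons.
rewrite take_size_cat // drop_size_cat // sem_dpush //= !cats0 dcross_src.
rewrite -cats1 catA take_size_cat ?size_cat ?su ?sv // drop_size_cat ?size_cat ?su ?sv //.
by rewrite IH //= -catA -cats1 catA.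
Qed.

Lemma fits_cross r s c e : size c = (r + s)%N -> size e = (s + r)%N ->
  fits (br_cross r s) c e = (e == drop r c ++ take r c).
Proof.
move=> sc se; have st : size (drop r c) = s by rewrite size_drop sc; lia.
have E e' (k : 'I_(s + r)) : colour_at c e' (br_cross r s (inr k)) =
    nth false (drop r c ++ take r c) k.
  rewrite /= ffunE /= nth_cat st; case: splitP => j -> /=.
    by rewrite nth_drop.
  by rewrite addKn nth_take.
apply/forallP/eqP => [H|-> x].
  apply: (@eq_from_nth _ false) => [|k ke].
    by rewrite size_cat st size_take sc se; case: ltnP; lia.
  by rewrite se in ke; have := H (inr (Ordinal ke)); rewrite E /= => /eqP <-.
case: x => [i|k]; last by rewrite E.
have [k ek] : exists k, br_cross r s (inl i) = inr k by rewrite /= ffunE; eexists.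
by rewrite ek -(brauerK (br_cross r s) (inl i)) ek E.
Qed.

Lemma fits_id r c e : size c = r -> size e = r -> fits (br_id r) c e = (e == c).
Proof.
move=> sc se; apply/forallP/eqP => [H|-> [i|i]]; rewrite /= ?ffunE //.
apply: (@eq_from_nth _ false) => [|k ke]; first by rewrite sc.
by rewrite se in ke; have := H (inl (Ordinal ke)); rewrite /= ffunE => /eqP.
Qed.

Lemma fits_cap a b : fits br_cap [:: a; b] [::] = (a == b).
Proof.
apply/forallP/eqP => [H|->].
  by have := H (inl ord0); rewrite /= ffunE => /eqP.
by move=> [[[|[|//]] ?]|[]//]; rewrite /= ffunE.
Qed.

Lemma fits_cup a b : fits br_cup [::] [:: a; b] = (a == b).
Proof.
apply/forallP/eqP => [H|->].
  by have := H (inr ord0); rewrite /= ffunE => /eqP.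
by move=> [[]//|[[|[|//]] ?]]; rewrite /= ffunE.
Qed.

Lemma draws_cross r s : draws (br_cross r s) (dcross r s).
Proof.
split; rewrite ?dcross_brauer ?dcross_src ?dcross_tgt // => c e sc se.
rewrite fits_cross //; have /split_at [u [v [-> su sv]]] := sc.
by rewrite sem_dcross // -su take_size_cat // drop_size_cat //= addn0 eq_sym.
Qed.

Lemma draws_X : draws (br_cross 1 1) DX.
Proof.
split=> // -[|a [|b []]] // [|x [|y []]] // _ _.
by rewrite fits_cross //= addn0 eq_sym.
Qed.

Lemma draws_id r : draws (br_id r) (DId r).
Proof. by split=> // c e sc se; rewrite fits_id //= addn0 eq_sym. Qed.

Lemma draws_cap : draws br_cap DCap.
Proof.
split=> // -[|a [|b []]] // [|//] _ _; rewrite fits_cap /=.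
by case: (a == b).
Qed.

Lemma draws_cup : draws br_cup DCup.
Proof.
by split=> // -[|//] [|[] [|[] []]] // _ _; rewrite fits_cup.
Qed.

Definition same_sem d d' := [&& dbrauer d, dbrauer d', dsrc d == dsrc d',
  dtgt d == dtgt d' &
  all (fun c => perm_eq (sem d [::] c) (sem d' [::] c)) (colours (dsrc d))].

Section Whiskers.
Context (K : fieldType) (gen : nat -> nat -> Type) (rel : term_rel K gen).
Lemma wh_l (f : uarrow rel) b : wh 0 f b = utens f (uid rel b).
Proof. by rewrite /wh utens1m. Qed.
Lemma wh_r (f : uarrow rel) a : wh a f 0 = utens (uid rel a) f.
Proof. by rewrite /wh utensm1. Qed.
Lemma uid_cls n : uid rel n = cls rel (TId n). Proof. by []. Qed.
Lemma cls_of (u : uarrow rel) m n : src u = m -> tgt u = n ->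
  exists f : term K gen m n, cls rel f = u.
Proof.
by case: u => a b h /= <- <-; exists (trep h); rewrite /cls trepK.
Qed.
End Whiskers.

Section TangleBrauer.
Context (K : fieldType).
Local Notation rel := (@tangle_rel K).

Lemma tangle_cls m n (f g : tterm K m n) : tangle_rel f g -> cls rel f = cls rel g.
Proof. by move=> h; apply/clsP/eqt_rel. Qed.

(** These are the first nine relations of the tangle category. *)
Definition tangle_brauer : brauer_in rel (7%:R : K).
Proof.
apply: (@BrauerIn _ _ rel 7%:R (cls rel (tX K)) (cls rel (tcup K)) (cls rel (tcap K)))
  => //; rewrite ?wh_l ?wh_r ?uid_cls -?cls_tens.
- rewrite -cls_comp; transitivity (cls rel (TTens (tI K) (tI K))).
    exact: tangle_cls (tangle_XX K).
  by rewrite cls_tens -!uid_cls utens_id.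
- rewrite !ucompA; have := tangle_cls (tangle_braid K); by rewrite !cls_comp.
- rewrite -cls_comp; exact: tangle_cls (tangle_zigzag_l K).
- rewrite -cls_comp; exact: tangle_cls (tangle_zigzag_r K).
- rewrite -cls_comp; exact: tangle_cls (tangle_cap_X K).
- rewrite -cls_comp; exact: tangle_cls (tangle_X_cup K).
- rewrite -!cls_comp; exact: tangle_cls (tangle_slide_cap K).
- rewrite -!cls_comp; exact: tangle_cls (tangle_slide_cup K).
- by rewrite -cls_comp (tangle_cls (tangle_loop K)) cls_scale.
Defined.
End TangleBrauer.

Section Drawings.
Context (K : fieldType).
Local Notation T := (@tangle_rel K).
Local Notation ST := (tangle_brauer K).

(** A placeholder for the value of [DVec] in diagrams without vectors. *)
Definition no_vec gen (rel : term_rel K gen) :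
  uarrow rel := cls rel (@TZero K gen 0 3).

Lemma draws_interp (gen : nat -> nat -> Type) (rel : term_rel K gen) delta
    (S : brauer_in rel delta) vec (vs : src vec = 0%N) (vt : tgt vec = 3%N) r s (D : brauer r s) d d' :
  draws D d -> draws D d' -> ev S vec d = ev S vec d'.
Proof.
move=> [bd sd td H] [bd' sd' td' H'].
rewrite (@brauer_coherence _ _ _ _ S vec vs vt 0 d d') ?expr0 ?uscale1 //; try congruence.
by move=> c e; rewrite sd td mul1n => sc se _; rewrite H ?H'.
Qed.

Lemma interp_no_vec (gen : nat -> nat -> Type) (rel : term_rel K gen)
    (X cup cap vec vec' : uarrow rel) d : dvecs d = 0%N ->
  interp X cup cap vec d = interp X cup cap vec' d.
Proof.
elim: d => //= [g IHg f IHf|f IHf g IHg] /eqP; rewrite addn_eq0 => /andP [/eqP vf /eqP vg];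
  by rewrite IHg // IHf.
Qed.

Lemma drawing_term_exists r s (D : brauer r s) :
  exists f : tterm K r s, exists d, draws D d /\ cls T f = ev ST (no_vec T) d.
Proof.
have [d Hd] := drawing_exists D; have [_ sd td _] := Hd.
have [||f ef] := @cls_of _ _ T (ev ST (no_vec T) d) r s.
- by rewrite ev_src.
- by rewrite ev_tgt.
by exists f, d.
Qed.

(** The tangle drawn by [D]; by coherence the choice of the drawing does not
    matter. *)
Definition drawing_term r s (D : brauer r s) : tterm K r s := projT1 (cid (drawing_term_exists D)).

Lemma drawing_term_interp r s (D : brauer r s) vec d : draws D d ->
  cls T (drawing_term D) = ev ST vec d.
Proof.
move=> Dd; rewrite /drawing_term; case: cid => f /= [d' [Dd' ->]].
rewrite (@draws_interp _ _ _ ST (no_vec T) erefl erefl _ _ _ _ _ Dd' Dd).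
by apply: interp_no_vec; have [/andP [_ /eqP]] := Dd.
Qed.

(** The all-[true] colouring detects the power of two, and the others the
    matching. *)
Lemma fits_determines r s (D D' : brauer r s) k k' :
  (forall c e, size c = r -> size e = s -> (2 ^ k * fits D c e = 2 ^ k' * fits D' c e)%N) ->
  k = k' /\ D = D'.
Proof.
move=> H; have kk : k = k'.
  have := H _ _ (size_nseq r true) (size_nseq s true).
  by rewrite !fits_const !muln1 => /expnI ->.
split=> //; subst k'; apply: val_inj; apply/ffunP => x /=.
have [|e|e] // := @fits_separates _ _ D' x (D x).
  move=> c e sc se fD'; have := H c e sc se; rewrite fD' => /eqP.
  rewrite eqn_pmul2l ?expn_gt0 //; case: (boolP (fits D c e)) => // /forallP /(_ x) /eqP -> //.
by have := brauer_neq D x; rewrite e eqxx.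
Qed.

End Drawings.

Section OmegaBrauer.
Context (K : fieldType).
Local Notation rel := (@omega3_rel K).
Local Notation E := (interp (cls rel (oX K)) (cls rel (ocup K)) (cls rel (ocap K))
  (cls rel (oomega K))).

Lemma omega_cls m n (f g : oterm K m n) : omega3_rel f g -> cls rel f = cls rel g.
Proof. by move=> h; apply/clsP/eqt_rel. Qed.

Definition brauer_class r s (f : bhom K r s) : plmod rel r s := tcl rel (obr f).

Lemma brauer_class_lin r s : linear (@brauer_class r s).
Proof.
move=> a f g; rewrite /brauer_class tcl_lin.
by apply/tcl_eq/eqt_rel; exact: omega3_br_lin.
Qed.

HB.instance Definition _ r s :=
  GRing.isLinear.Build K (bhom K r s) (plmod rel r s) *:%R (@brauer_class r s) (@brauer_class_lin r s).

Definition brauer_arrow r s (D : brauer r s) : uarrow rel := Arrow (plmod rel) (brauer_class (bdiag K D)).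

Lemma bcomp_bdiag (delta : K) r s t (B : brauer s t) (A : brauer r s) D :
  (forall D', is_stack B A D' = (D' == D)) ->
  bcomp delta (bdiag K B) (bdiag K A) = delta ^+ stack_loops B A *: bdiag K D.
Proof.
move=> H; rewrite /bcomp (bigD1 B) //= (bigD1 A) //= !ffunE !eqxx !mul1r.
rewrite (eq_bigl _ _ H) big_pred1_eq.
rewrite big1 ?addr0; last first.
  by move=> A' /negbTE nA; rewrite !ffunE nA mulr0 mul0r scale0r.
rewrite big1 ?addr0 // => B' /negbTE nB; rewrite big1 // => A' _.
by rewrite !ffunE nB !mul0r scale0r.
Qed.

Lemma btens_bdiag r s r' s' (A : brauer r s) (B : brauer r' s') D :
  (forall D', is_juxtaposition A B D' = (D' == D)) ->
  btens (bdiag K A) (bdiag K B) = bdiag K D.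
Proof.
move=> H; rewrite /btens (bigD1 A) //= (bigD1 B) //= !ffunE !eqxx !mul1r.
rewrite (eq_bigl _ _ H) big_pred1_eq scale1r.
rewrite big1 ?addr0; last first.
  by move=> B' /negbTE nB; rewrite !ffunE nB mulr0 scale0r.
rewrite big1 ?addr0 // => A' /negbTE nA; rewrite big1 // => B' _.
by rewrite !ffunE nA !mul0r scale0r.
Qed.

Lemma brauer_arrow_comp r s t (B : brauer s t) (A : brauer r s) D :
  (forall D', is_stack B A D' = (D' == D)) ->
  ucomp (brauer_arrow B) (brauer_arrow A) = uscale (7%:R ^+ stack_loops B A) (brauer_arrow D).
Proof.
move=> H; rewrite -(@cls_comp _ _ rel _ _ _ (obr (bdiag K B)) (obr (bdiag K A))).
rewrite -(omega_cls (omega3_br_comp _ _)) (bcomp_bdiag _ H).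
by rewrite /uscale /brauer_arrow /= -linearZ.
Qed.

Lemma brauer_arrow_tens r s r' s' (A : brauer r s) (B : brauer r' s') D :
  (forall D', is_juxtaposition A B D' = (D' == D)) ->
  utens (brauer_arrow A) (brauer_arrow B) = brauer_arrow D.
Proof.
move=> H; rewrite -(@cls_tens _ _ rel _ _ _ _ (obr (bdiag K A)) (obr (bdiag K B))).
rewrite -(omega_cls (omega3_br_tens _ _)).
by rewrite (btens_bdiag H).
Qed.

Lemma brauer_arrow_id r : brauer_arrow (br_id r) = uid rel r.
Proof. exact: omega_cls (omega3_br_id _ _). Qed.


(** Every composite of the basic Brauer diagrams is again a multiple of a
    Brauer diagram, which its state sum determines.  On this side coherence holds
    because Brauer diagrams with equal matchings are equal by definition. *)
Lemma omega_normal d : dbrauer d -> exists r s k (D : brauer r s),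
  [/\ dsrc d = r, dtgt d = s, E d = uscale (7%:R ^+ k) (brauer_arrow D) &
    forall c e, size c = r -> size e = s ->
     count_mem e (sem d [::] c) = (2 ^ k * fits D c e)%N].
Proof.
have base r s (D : brauer r s) d' : draws D d' -> E d' = brauer_arrow D ->
   exists r s k (D : brauer r s),
  [/\ dsrc d' = r, dtgt d' = s, E d' = uscale (7%:R ^+ k) (brauer_arrow D) &
    forall c e, size c = r -> size e = s ->
     count_mem e (sem d' [::] c) = (2 ^ k * fits D c e)%N].
  move=> [_ sd td H] ->; exists r, s, 0%N, D; rewrite expr0 uscale1.
  by split=> // c e sc se; rewrite mul1n H.
elim: d => [||||n|g IHg f IHf|f IHf g IHg].
- by move=> _; exact: base draws_X _.
- by move=> _; exact: base draws_cup _.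
- by move=> _; exact: base draws_cap _.
- by [].
- by move=> _; apply: base (draws_id n) _; rewrite brauer_arrow_id.
- move=> /dbrauer_compP [bg bf gf].
  have [r [s [k [A [sf tf eA Hf]]]]] := IHf bf.
  have [s' [t [k' [B [sg tg eB Hg]]]]] := IHg bg.
  have es : s' = s by rewrite -sg gf tf.
  move: B eB Hg sg; rewrite {}es => B eB Hg sg.
  have [D [_ uD HD]] := stack_exists (tangle_brauer K) B A.
  exists r, t, (k' + k + stack_loops B A)%N, D; split=> //.
    by rewrite /= eA eB ucompZl ucompZr (brauer_arrow_comp uD) !uscaleA !exprD.
  move=> c d sc sd; rewrite (count_sem_stack bf sf tf Hf Hg) //.
  by rewrite HD // mulnA -expnD.
- rewrite dbrauer_tensE => /andP [bf bg].
  have [r [s [k [A [sf tf eA Hf]]]]] := IHf bf.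
  have [r' [s' [k' [B [sg tg eB Hg]]]]] := IHg bg.
  have [D [uD HD]] := juxtaposition_exists (tangle_brauer K) A B.
  exists (r + r')%N, (s + s')%N, (k + k')%N, D; split.
  + by rewrite /= sf sg.
  + by rewrite /= tf tg.
  + by rewrite /= eA eB utensZl utensZr (brauer_arrow_tens uD) !uscaleA !exprD.
  move=> c e /split_at [c1 [c2 [-> s1 s2]]] /split_at [e1 [e2 [-> t1 t2]]].
  rewrite count_sem_tens ?sf ?tf // Hf ?Hg // HD //.
  by rewrite expnD mulnACA mulnb.
Qed.

Lemma omega_coherence j d d' : dbrauer d -> dbrauer d' ->
  dsrc d = dsrc d' -> dtgt d = dtgt d' ->
  (forall c e, size c = dsrc d -> size e = dtgt d ->
     count_mem e (sem d [::] c) = (2 ^ j * count_mem e (sem d' [::] c))%N) ->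
  E d = uscale (7%:R ^+ j) (E d').
Proof.
move=> bd bd' es et H.
have [r [s [k [D [sd td -> Hd]]]]] := omega_normal bd.
have [r' [s' [k' [D' [sd' td' -> Hd']]]]] := omega_normal bd'.
have er : r' = r by congruence.
have es' : s' = s by congruence.
move: D' Hd'; rewrite {}er {}es' => D' Hd'; have [-> ->] : k = (j + k')%N /\ D = D'.
  apply: fits_determines => c e sc se.
  by rewrite -Hd // H ?sd ?td // Hd' ?expnD ?mulnA.
by rewrite uscaleA exprD.
Qed.

Lemma omega_same_sem d d' : same_sem d d' -> E d = E d'.
Proof.
case/and5P => bd bd' /eqP es /eqP et /allP H.
rewrite (@omega_coherence 0 d d') ?expr0 ?uscale1 // => c e sc se.
by rewrite mul1n; apply/permP/H; rewrite mem_colours sc.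
Qed.

(** The Brauer relations hold between Brauer diagrams, since the two sides of
    each have the same state sum. *)
Definition omega_brauer : brauer_in rel (7%:R : K).
Proof.
apply: (@BrauerIn _ _ rel 7%:R (cls rel (oX K)) (cls rel (ocup K)) (cls rel (ocap K)))
  => //.
- exact: (@omega_same_sem (DComp DX DX) (DId 2)).
- rewrite !wh_l !wh_r.
  pose X1 := DTens DX (DId 1); pose X2 := DTens (DId 1) DX.
  exact: (@omega_same_sem (DComp X1 (DComp X2 X1)) (DComp X2 (DComp X1 X2))).
- rewrite wh_l wh_r.
  exact: (@omega_same_sem (DComp (DTens DCap (DId 1)) (DTens (DId 1) DCup)) (DId 1)).
- rewrite wh_l wh_r.
  exact: (@omega_same_sem (DComp (DTens (DId 1) DCap) (DTens DCup (DId 1))) (DId 1)).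
- exact: (@omega_same_sem (DComp DCap DX) DCap).
- exact: (@omega_same_sem (DComp DX DCup) DCup).
- rewrite !wh_l !wh_r.
  exact: (@omega_same_sem (DComp (DTens DCap (DId 1)) (DTens (DId 1) DX))
                          (DComp (DTens (DId 1) DCap) (DTens DX (DId 1)))).
- rewrite !wh_l !wh_r.
  exact: (@omega_same_sem (DComp (DTens (DId 1) DX) (DTens DCup (DId 1)))
                          (DComp (DTens DX (DId 1)) (DTens (DId 1) DCup))).
- rewrite -[7%:R]expr1; apply: (@omega_coherence 1 (DComp DCap DCup) (DId 0)) => //.
  by move=> [|//] [|//].
Defined.

End OmegaBrauer.

(** * Diagrams with antisymmetric vectors *)
(** The Brauer diagram left after the vectors of [d] have been pulled out to
    the right: their legs become additional inputs. *)
Fixpoint ext d : diag :=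
  match d with
  | DVec => DId 3
  | DComp g f => DComp (ext g) (DTens (ext f) (DId (3 * dvecs g)))
  | DTens f g => DComp (DTens (ext f) (ext g))
      (DTens (DTens (DId (dsrc f)) (dcross (dsrc g) (3 * dvecs f)))
             (DId (3 * dvecs g)))
  | _ => d
  end.

Lemma ext_tgt d : dtgt (ext d) = dtgt d.
Proof. by elim: d => //= [f -> g ->]. Qed.

Lemma ext_src d : dsrc (ext d) = (dsrc d + 3 * dvecs d)%N.
Proof.
elim: d => //= [n|g _ f ->|f _ g _]; rewrite ?dcross_src; lia.
Qed.

Lemma ext_brauer d : dwf d -> dbrauer (ext d).
Proof.
rewrite /dbrauer; elim: d => //= [g IHg f IHf|f IHf g IHg].
  move=> /and3P [/IHg /andP [-> /eqP ->] /IHf /andP [-> /eqP ->] /eqP gf].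
  by rewrite ext_src ext_tgt gf eqxx.
move=> /andP [/IHf /andP [-> /eqP ->] /IHg /andP [-> /eqP ->]].
have /andP [-> /eqP ->] := dcross_brauer (dsrc g) (3 * dvecs f).
rewrite !ext_src dcross_tgt /= andbT; apply/eqP; lia.
Qed.

Lemma ext_sem d v c : dwf d -> size v = (3 * dvecs d)%N -> size c = dsrc d ->
  sem (ext d) [::] (c ++ v) = sem d v c.
Proof.
elim: d v c => [||||n|g IHg f IHf|f IHf g IHg] v c /=.
- by move=> _ /size0nil ->; rewrite cats0.
- by [].
- by move=> _ /size0nil ->; rewrite cats0.
- by move=> _ _ /size0nil ->.
- by move=> _ /size0nil ->; rewrite cats0.
- move=> /and3P [wg wf /eqP gf] sv sc; rewrite ext_src.
  have -> : c ++ v = (c ++ take (3 * dvecs f) v) ++ drop (3 * dvecs f) v.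
    by rewrite -catA cat_take_drop.
  have st : size (take (3 * dvecs f) v) = (3 * dvecs f)%N.
    by rewrite size_take sv; case: ltnP; lia.
  have sz : size (c ++ take (3 * dvecs f) v) = (dsrc f + 3 * dvecs f)%N.
    by rewrite size_cat sc st.
  rewrite -sz take_size_cat // drop_size_cat // IHf // allpairs1r -map_comp.
  congr flatten; apply/eq_in_map => e /sem_size es /=.
  by rewrite IHg ?size_drop ?sv ?es ?gf //; lia.
- move=> /andP [wf wg] sv sc; rewrite dcross_src.
  have /split_at [c1 [c2 [-> s1 s2]]] := sc.
  have /split_at [v1 [v2 [-> t1 t2]]] : size v = (3 * dvecs f + 3 * dvecs g)%N.
    by rewrite sv; lia.
  have -> : (c1 ++ c2) ++ v1 ++ v2 = (c1 ++ c2 ++ v1) ++ v2 by rewrite -!catA.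
  have sz : size (c1 ++ c2 ++ v1) = (dsrc f + (dsrc g + 3 * dvecs f))%N.
    by rewrite !size_cat s1 s2 t1.
  rewrite -sz take_size_cat // drop_size_cat // -s1 take_size_cat // drop_size_cat //.
  rewrite sem_dcross //= cats0.
  have -> : (c1 ++ v1 ++ c2) ++ v2 = (c1 ++ v1) ++ c2 ++ v2 by rewrite -!catA.
  have sz' : size (c1 ++ v1) = dsrc (ext f) by rewrite size_cat s1 t1 ext_src.
  rewrite -t1 -sz' [take (size (_ ++ _)) _]take_size_cat //.
  rewrite [drop (size (_ ++ _)) _]drop_size_cat //.
  rewrite [take (size v1) _]take_size_cat // [drop (size v1) _]drop_size_cat //.
  rewrite [take (size c1) _]take_size_cat // [drop (size c1) _]drop_size_cat //.
  by rewrite IHf // IHg.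
Qed.

Section PullingVectors.
Context (K : fieldType) (gen : nat -> nat -> Type) (rel : term_rel K gen)
  (delta : K) (S : brauer_in rel delta) (vec : uarrow rel).
Hypothesis (vec_src : src vec = 0%N) (vec_tgt : tgt vec = 3%N).
Local Open Scope arrow_scope.
Local Notation I n := (uid rel n).
Local Notation E := (ev S vec).

Lemma same_sem_interp d d' : same_sem d d' -> E d = E d'.
Proof.
case/and5P => bd bd' /eqP es /eqP et /allP H.
rewrite (@brauer_coherence _ _ _ _ S vec vec_src vec_tgt 0 d d') ?expr0 ?uscale1 // => c e sc se _.
by rewrite mul1n; apply/permP/H; rewrite mem_colours sc.
Qed.

Lemma sem_eq_interp d d' : dbrauer d -> dbrauer d' -> dsrc d = dsrc d' ->
  dtgt d = dtgt d' ->
  (forall c, size c = dsrc d -> sem d [::] c = sem d' [::] c) -> E d = E d'.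
Proof.
move=> bd bd' es et H; apply: same_sem_interp; apply/and5P; split=> //; try exact/eqP.
by apply/allP => c; rewrite mem_colours => /eqP sc; rewrite H.
Qed.

Hypothesis vec_slide : E (dpush 3) ⊙ (I 1 ⊠ vec) = vec ⊠ I 1.

Fixpoint vecs k : uarrow rel := if k is k'.+1 then vec ⊠ vecs k' else I 0.

Lemma vecs_src k : src (vecs k) = 0%N.
Proof. by elim: k => //= k IH; rewrite src_tens vec_src. Qed.
Lemma vecs_tgt k : tgt (vecs k) = (3 * k)%N.
Proof. by elim: k => //= k IH; rewrite tgt_tens vec_tgt IH; lia. Qed.
Lemma vecs_add j k : vecs (j + k) = vecs j ⊠ vecs k.
Proof. by elim: j => [|j IH]; rewrite ?utens1m //= IH utensA. Qed.

Local Notation st := (src_comp, tgt_comp, src_wh, tgt_wh, src_id, tgt_id,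
  src_tens, tgt_tens, src_scale, tgt_scale, vec_src, vec_tgt, vecs_src, vecs_tgt,
  ev_src S vec_src, ev_tgt S vec_tgt).

(** A strand passes [m + n] strands by passing [m] of them and then [n]. *)
Lemma dpush_add m n : E (dpush (m + n)) = (I m ⊠ E (dpush n)) ⊙ (E (dpush m) ⊠ I n).
Proof.
have /andP [wm /eqP vm] := dpush_brauer m; have /andP [wn /eqP vn] := dpush_brauer n.
apply: (@sem_eq_interp (dpush (m + n)) (DComp (DTens (DId m) (dpush n)) (DTens (dpush m) (DId n)))).
- exact: dpush_brauer.
- rewrite /dbrauer /= wm wn vm vn dpush_src dpush_tgt /= andbT; apply/eqP; lia.
- by rewrite /= !dpush_src.
- by rewrite /= !dpush_tgt; lia.
move=> [|a l]; rewrite dpush_src // => -[sl].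
rewrite sem_dpush // sem_comp0 sem_tens0 dpush_src.
have /split_at [u [v [-> su sv]]] := sl.
rewrite -cat_cons -su -[(size u).+1]/(size (a :: u)) take_size_cat // drop_size_cat //.
rewrite sem_dpush //= !cats0 cat_rcons take_size_cat // drop_size_cat //.
by rewrite sem_dpush //= rcons_cat.
Qed.

Lemma vecs_slide1 k : E (dpush (3 * k)) ⊙ (I 1 ⊠ vecs k) = vecs k ⊠ I 1.
Proof.
elim: k => [|k IH]; first by rewrite muln0 -[vecs 0]/(I 0) utensm1 utens1m; exact: ucomp1m.
rewrite mulnS dpush_add -ucompA [vecs k.+1]/= (utensA (I 1)).
rewrite -uinter ?st ?dpush_src ?vecs_tgt // vec_slide ucomp1m ?st //.
rewrite -[(vec ⊠ I 1) ⊠ _]utensA -uinter ?st ?dpush_src ?vecs_tgt //.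
by rewrite IH ucomp1m ?st // utensA.
Qed.

Lemma vecs_slide m k : E (dcross m (3 * k)) ⊙ (I m ⊠ vecs k) = vecs k ⊠ I m.
Proof.
elim: m => [|m IH]; first by rewrite /= utens1m utensm1 ucomp1m ?st.
rewrite /= -ucompA -(addn1 m) -(utens_id rel m 1) -(utensA (I m) (I 1)).
rewrite -uinter ?st ?dpush_src // vecs_slide1 ucomp1m //.
rewrite (utensA (I m)) -uinter ?st ?dcross_src // IH ucomp1m //.
by rewrite -utensA.
Qed.

(** The vectors slide through the crossings created by [ext]. *)
Lemma interp_ext d : dwf d ->
  E d = E (ext d) ⊙ (I (dsrc d) ⊠ vecs (dvecs d)).
Proof.
elim: d => [||||n|g IHg f IHf|f IHf g IHg] /=.
- by move=> _; rewrite utensm1 ucompm1 // bX_src.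
- by move=> _; rewrite utensm1 ucompm1 // bcup_src.
- by move=> _; rewrite utensm1 ucompm1 // bcap_src.
- by move=> _; rewrite utens1m utensm1 ucomp1m.
- by move=> _; rewrite utensm1 ucomp1m.
- move=> /and3P [wg wf /eqP gf]; rewrite [in LHS]IHg // vecs_add -!ucompA.
  congr (_ ⊙ _); rewrite (utensA (I (dsrc f))).
  rewrite -uinter ?st ?ext_src // -IHf // ucomp1m ?st // gf.
  rewrite -{2}(@ucomp1m _ _ _ (E f) (dtgt f)) ?st //.
  rewrite -{2}(@ucompm1 _ _ _ (vecs (dvecs g)) 0) ?st //.
  by rewrite uinter ?st // utensm1.
move=> /andP [wf wg]; rewrite (addnC (dvecs g)) vecs_add -!ucompA.
rewrite -(utens_id rel (dsrc f)) (utensA (I _ ⊠ I _)) -(utensA (I (dsrc f)) (I _)).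
rewrite -[((I _ ⊠ _) ⊠ I _) ⊙ _]uinter ?st ?dcross_src //.
rewrite -[(I _ ⊠ _) ⊙ (I _ ⊠ _)]uinter ?st ?dcross_src // vecs_slide.
rewrite !ucomp1m ?st // (utensA (I (dsrc f))) -utensA.
by rewrite -uinter ?st ?ext_src // -IHf // -IHg.
Qed.

(** Once the vectors have been pulled out, coherence applies to what is left.
    The diagram [p] permutes the legs of the vectors, which costs the scalar
    [sgn]. *)
Theorem vec_coherence j d d' p : dwf d -> dwf d' -> dbrauer p ->
  dsrc d = dsrc d' -> dtgt d = dtgt d' -> dvecs d = dvecs d' ->
  dsrc p = (3 * dvecs d)%N -> dtgt p = (3 * dvecs d)%N ->
  (forall v c, size v = (3 * dvecs d)%N -> size c = dsrc d ->
    (count id (c ++ v) <= 2)%N ->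
    perm_eq (sem d v c)
      (flatten (nseq (2 ^ j) (flatten [seq sem d' v' c | v' <- sem p [::] v])))) ->
  forall sgn, E p ⊙ vecs (dvecs d) = uscale sgn (vecs (dvecs d)) ->
  E d = uscale (delta ^+ j * sgn) (E d').
Proof.
move=> wd wd' bp es et ev sp tp H sgn Hsgn.
have [wp vp] := andP bp.
rewrite (interp_ext wd).
pose b := DComp (ext d') (DTens (DId (dsrc d)) p).
have /andP [we' ve'] := ext_brauer wd'.
have bb : dbrauer b.
  by rewrite /dbrauer /b /= we' wp (eqP vp) (eqP ve') ext_src tp es ev eqxx.
rewrite (@brauer_coherence _ _ _ _ S vec vec_src vec_tgt j (ext d) b) //.
- rewrite ucompZl /b /= -ucompA -uinter ?st ?sp // Hsgn ucomp1m ?st //.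
  by rewrite utensZr ucompZr -uscaleA (interp_ext wd') es ev.
- exact: ext_brauer.
- by rewrite /b /= ext_src sp.
- by rewrite /b /= !ext_tgt.
move=> c e; rewrite ext_src ext_tgt => /split_at [c1 [v [-> s1 sv]]] se c2.
rewrite ext_sem //; have /permP -> := H v c1 sv s1 c2.
rewrite /b sem_comp0 sem_tens0 -[dsrc (DId _)]s1 take_size_cat // drop_size_cat //.
rewrite allpairs1l -map_comp.
have -> : map (sem (ext d') [::] \o cat c1) (sem p [::] v) =
          [seq sem d' v' c1 | v' <- sem p [::] v].
  apply/eq_in_map => v' hv'; rewrite /= ext_sem //; last by rewrite s1.
  by rewrite (sem_size wp _ _ hv') ?tp ?ev // ?(eqP vp) // sp.
by elim: (2 ^ j)%N => //= n IH; rewrite count_cat IH mulSn.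
Qed.


Definition vec_skew := wh 0 (bX S) 1 ⊙ vec = uscale (-1) vec /\
  wh 1 (bX S) 0 ⊙ vec = uscale (-1) vec.

End PullingVectors.

(** Symmetries of a tensor power of a totally antisymmetric vector: [Flip i b]
    exchanges legs [b] and [b + 1] of the [i]-th factor, [Swap i] the factors
    [i] and [i + 1]. *)
Inductive move := Flip of nat & bool | Swap of nat.

Definition move_diag k m : diag :=
  match m with
  | Flip i b => DTens (DTens (DId (3 * i + b)) DX) (DId (3 * (k - i).-1 + ~~ b))
  | Swap i => DTens (DTens (DId (3 * i)) (dcross 3 3)) (DId (3 * (k - i).-2))
  end.

Definition move_ok k m := match m with Flip i _ => i < k | Swap i => i.+1 < k end%N.
Definition move_odd m := if m is Flip _ _ then 1%N else 0%N.
Definition moves_diag k ms := foldr (fun m d => DComp (move_diag k m) d) (DId (3 * k)) ms.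
Definition moves_sign (R : pzRingType) ms : R := (-1) ^+ (\sum_(m <- ms) move_odd m)%N.

(** Colourings with at most [t] points of colour [true]: by [paired_unique]
    two such points suffice, so that quadratically many colourings are checked
    instead of exponentially many. *)
Fixpoint sparse t n : seq (seq bool) :=
  match n, t with
  | 0, _ => [:: [::]]
  | n'.+1, t'.+1 => [seq false :: c | c <- sparse t n'] ++ [seq true :: c | c <- sparse t' n']
  | n'.+1, 0 => [seq false :: c | c <- sparse 0 n']
  end.

Lemma mem_sparse t n c : size c = n -> (count id c <= t)%N -> c \in sparse t n.
Proof.
elim: n t c => [t [|//]|n IH [|t] [|[] c]] //= [sc] h.
- by apply: map_f; apply: IH.
- by rewrite mem_cat [X in _ || X]map_f ?orbT //; apply: IH.
- by rewrite mem_cat map_f //; apply: IH.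
Qed.

(** The hypotheses of [vec_coherence], for a leg permutation given by moves. *)
Definition similar j ms d d' :=
  let k := dvecs d in
  [&& dwf d, dwf d', dsrc d == dsrc d', dtgt d == dtgt d', k == dvecs d',
   all (move_ok k) ms &
   all (fun u => let v := drop (dsrc d) u in let c := take (dsrc d) u in
     perm_eq (sem d v c)
     (flatten (nseq (2 ^ j) (flatten [seq sem d' v' c | v' <- sem (moves_diag k ms) [::] v]))))
     (sparse 2 (dsrc d + 3 * k))].

Lemma move_diag_brauer k m : move_ok k m ->
  [/\ dbrauer (move_diag k m), dsrc (move_diag k m) = (3 * k)%N &
      dtgt (move_diag k m) = (3 * k)%N].
Proof. by case: m => [i []|i] /= h; split => //; lia. Qed.

Lemma moves_diag_brauer k ms : all (move_ok k) ms ->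
  [/\ dbrauer (moves_diag k ms), dsrc (moves_diag k ms) = (3 * k)%N &
      dtgt (moves_diag k ms) = (3 * k)%N].
Proof.
elim: ms => //= m ms IH /andP [/move_diag_brauer [bm sm tm] /IH [bs ss ts]].
split => //; move: bm bs => /andP [wm /eqP vm] /andP [ws /eqP vs].
by rewrite /dbrauer /= wm ws vm vs sm ts eqxx.
Qed.

Section Antisymmetry.
Context (K : fieldType) (gen : nat -> nat -> Type) (rel : term_rel K gen)
  (delta : K) (S : brauer_in rel delta) (vec : uarrow rel).
Hypothesis (vec_src : src vec = 0%N) (vec_tgt : tgt vec = 3%N).
Local Open Scope arrow_scope.
Local Notation I n := (uid rel n).
Local Notation E := (ev S vec).
Local Notation vecs := (vecs vec).
Hypothesis vec_slide : E (dpush 3) ⊙ (I 1 ⊠ vec) = vec ⊠ I 1.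
Hypothesis skew : vec_skew S vec.

Local Notation st' := (src_comp, tgt_comp, src_wh, tgt_wh, src_id, tgt_id,
  src_tens, tgt_tens, src_scale, tgt_scale, vec_src, vec_tgt, vecs_src vec_src, vecs_tgt vec_src vec_tgt,
  ev_src S vec_src, ev_tgt S vec_tgt, bX_src S, bX_tgt S).

(** Exchanging two vectors creates no sign, because each leg of one slides past
    the other. *)
Lemma vec_vec : E (dcross 3 3) ⊙ (vec ⊠ vec) = vec ⊠ vec.
Proof.
have := vecs_slide vec_src vec_tgt vec_slide 3 1; rewrite muln1 [vecs 1]/= utensm1 => e.
rewrite [X in _ ⊙ X]uinter_r ?st' wh_l wh_r utensm1 ucompA e.
rewrite -[vec in (vec ⊠ I 3) ⊙ vec](utens1m vec) -uinter ?st' //.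
by rewrite utens1m ucompm1 ?ucomp1m ?st'.
Qed.

Lemma vecs_move k m : move_ok k m ->
  E (move_diag k m) ⊙ vecs k = uscale (moves_sign K [:: m]) (vecs k).
Proof.
rewrite /moves_sign big_seq1; case: m => [i b|i]; rewrite [move_ok _ _]/= => ik.
  have -> : k = (i + (1 + (k - i).-1))%N by lia.
  set r := (k - i).-1; rewrite !vecs_add [vecs 1]/= utensm1 expr1.
  have -> : E (move_diag (i + (1 + r)) (Flip i b)) =
     (I (3 * i + b) ⊠ bX S) ⊠ I (3 * (i + (1 + r) - i).-1 + ~~ b) by [].
  have -> : (i + (1 + r) - i).-1 = r by lia.
  have -> : (I (3 * i + b) ⊠ bX S) ⊠ I (3 * r + ~~ b) =
     I (3 * i) ⊠ (wh b (bX S) (~~ b) ⊠ I (3 * r)).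
    by rewrite /wh [(3 * r + _)%N]addnC -!utens_id !utensA.
  rewrite -uinter ?st' //; last by case: b.
  rewrite -[X in _ ⊠ X]uinter ?st' //; last by case: b.
  rewrite !ucomp1m ?st' //; case: skew => s1 s2.
  by case: b; rewrite ?s1 ?s2 utensZl utensZr.
rewrite expr0 uscale1.
have -> : k = (i + (2 + (k - i).-2))%N by lia.
set r := (k - i).-2; rewrite !vecs_add [vecs 2]/= utensm1.
have -> : E (move_diag (i + (2 + r)) (Swap i)) =
  (I (3 * i) ⊠ E (dcross 3 3)) ⊠ I (3 * (i + (2 + r) - i).-2) by [].
have -> : (i + (2 + r) - i).-2 = r by lia.
rewrite -utensA -uinter ?st' // -[X in _ ⊠ X]uinter ?st' //.
by rewrite !ucomp1m ?st' // vec_vec.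
Qed.

Lemma vecs_moves k ms : all (move_ok k) ms ->
  E (moves_diag k ms) ⊙ vecs k = uscale (moves_sign K ms) (vecs k).
Proof.
elim: ms => [|m ms IH] /= => [_|/andP [mk /IH {}IH]].
  by rewrite ucomp1m ?st' // /moves_sign big_nil expr0 uscale1.
rewrite -ucompA IH ucompZr vecs_move // uscaleA /moves_sign big_seq1 big_cons.
by rewrite exprD mulrC.
Qed.

(** The colourings checked by [similar] are those that coherence asks for, and
    the antisymmetry of the vectors accounts for the sign. *)
Theorem similar_interp j ms d d' : similar j ms d d' ->
  E d = uscale (delta ^+ j * moves_sign K ms) (E d').
Proof.
case/and5P => wd wd' /eqP es /eqP et /and3P [/eqP ek ok /allP H].
have [bm sm tm] := moves_diag_brauer ok.
apply: (@vec_coherence _ _ _ _ S vec vec_src vec_tgt vec_slide j d d'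
  (moves_diag (dvecs d) ms)) => //; last exact: vecs_moves.
move=> v c sv sc cv; have /H : c ++ v \in sparse 2 (dsrc d + 3 * dvecs d).
  by apply: mem_sparse; rewrite ?size_cat ?sv ?sc.
by rewrite /= -sc take_size_cat // drop_size_cat.
Qed.

End Antisymmetry.

(** * The trivalent vertex as an antisymmetric vector *)
Ltac cls_norm := repeat match goal with
  | |- context [cls ?r (TComp ?g ?f)] => rewrite (cls_comp r g f)
  | |- context [cls ?r (TTens ?g ?f)] => rewrite (cls_tens r g f)
  | |- context [cls ?r (TScale ?a ?f)] => rewrite (cls_scale r a f)
  end.

(** The vertex, as the vector with its last leg bent down. *)
Definition dY := DComp (DTens (DId 2) DCap) (DTens DVec (DId 1)).
Definition dYhat := DComp (DTens (DId 1) DCap) (DTens dY (DId 1)).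

Section TangleVector.
Context (K : fieldType).
Local Notation T := (@tangle_rel K).
Local Notation S := (tangle_brauer K).
Local Open Scope arrow_scope.
Local Notation I n := (uid T n).

Definition tvec : uarrow T := cls T (TComp (TTens (tY K) (tI K)) (tcup K)).
Lemma tvec_src : src tvec = 0%N. Proof. by []. Qed.
Lemma tvec_tgt : tgt tvec = 3%N. Proof. by []. Qed.
Local Notation E := (ev S tvec).

Local Notation st := (src_comp, tgt_comp, src_wh, tgt_wh, src_id, tgt_id,
  src_tens, tgt_tens, src_scale, tgt_scale, tvec_src, tvec_tgt,
  ev_src S tvec_src, ev_tgt S tvec_tgt).
Local Notation Y := (cls T (tY K)).


Lemma tvecE : tvec = (Y ⊠ I 1) ⊙ bcup S.
Proof. by rewrite /tvec cls_comp cls_tens. Qed.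

Lemma tY_interp : Y = E dY.
Proof.
have -> : E dY = wh 2 (bcap S) 0 ⊙ wh 0 tvec 1 by rewrite wh_l wh_r.
rewrite tvecE wh_comp ?bcup_tgt // -wh_l wh_wh ucompA.
rewrite -(@wh_xchg _ _ _ 0 0 Y 0 1 (bcap S) 0) ?bcap_src ?bcap_tgt //.
by rewrite -ucompA bzigzag_r wh00 ucompm1.
Qed.

Definition slides (u : uarrow T) :=
  E (dpush (tgt u)) ⊙ (I 1 ⊠ u) = (u ⊠ I 1) ⊙ E (dpush (src u)).

Lemma push_typed n : exists f : tterm K (1 + n) (n + 1), cls T f = E (dpush n).
Proof. by apply: cls_of; rewrite ?st ?dpush_src ?dpush_tgt ?addn1. Qed.

Definition push_term n := projT1 (cid (push_typed n)).
Lemma push_termE n : cls T (push_term n) = E (dpush n).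
Proof. by rewrite /push_term; case: cid. Qed.

Lemma slidesP m n (f : tterm K m n) : slides (cls T f) <->
  pcomp (tcl T (push_term n)) (ptens (tcl T (TId 1)) (tcl T f)) =
  pcomp (ptens (tcl T f) (tcl T (TId 1))) (tcl T (push_term m)).
Proof.
have A1 := ucompE (tcl T (push_term n)) (ptens (tcl T (TId 1)) (tcl T f)).
have A2 := ucompE (ptens (tcl T f) (tcl T (TId 1))) (tcl T (push_term m)).
rewrite /slides /= -!push_termE; split=> [e|e].
  by apply: Arrow_inj; rewrite -A1 -A2.
by etransitivity; [exact: A1 | rewrite e; symmetry; exact: A2].
Qed.

(** Sliding is a relation for the vertex and a consequence of coherence for
    the other generators; it passes to composites, tensor products and sums. *)
Lemma slides_cls m n (f : tterm K m n) : slides (cls T f).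
Proof.
elim: f => {m n} [m n g|n|m n p g IHg f IHf|m n p q f IHf g IHg|m n|m n f IHf g IHg|a m n f IHf].
- rewrite /slides; case: g.
  + exact: (@same_sem_interp _ _ _ _ S _ tvec_src tvec_tgt
      (DComp (dpush 2) (DTens (DId 1) DX)) (DComp (DTens DX (DId 1)) (dpush 2))).
  + exact: (@same_sem_interp _ _ _ _ S _ tvec_src tvec_tgt
      (DComp (dpush 2) (DTens (DId 1) DCup)) (DComp (DTens DCup (DId 1)) (dpush 0))).
  + exact: (@same_sem_interp _ _ _ _ S _ tvec_src tvec_tgt
      (DComp (dpush 0) (DTens (DId 1) DCap)) (DComp (DTens DCap (DId 1)) (dpush 2))).
  + have e : ((I 1 ⊠ bX S) ⊙ (bX S ⊠ I 1)) ⊙ (I 1 ⊠ Y) = (Y ⊠ I 1) ⊙ bX S.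
      have := tangle_cls (tangle_Y_slide_l K); rewrite /tX12; cls_norm.
      exact.
    have -> : E (dpush 2) = (I 1 ⊠ bX S) ⊙ (bX S ⊠ I 1).
      exact: (@same_sem_interp _ _ _ _ S _ tvec_src tvec_tgt (dpush 2)
        (DComp (DTens (DId 1) DX) (DTens DX (DId 1)))).
    have -> : E (dpush 1) = bX S.
      exact: (@same_sem_interp _ _ _ _ S _ tvec_src tvec_tgt (dpush 1) DX).
    exact: e.
- by rewrite /slides !utens_id ucompm1 ?ucomp1m ?st ?dpush_src ?dpush_tgt // addn1.
- rewrite /slides in IHg IHf *; rewrite cls_comp !st.
  rewrite -{1}[I 1](@ucomp1m _ _ _ (I 1) 1) // uinter // ucompA IHg.
  rewrite -ucompA IHf ucompA.
  by rewrite -{3}[I 1](@ucomp1m _ _ _ (I 1) 1) // uinter.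
- rewrite /slides in IHg IHf *; rewrite cls_tens !st.
  have addE := dpush_add S tvec_src tvec_tgt.
  rewrite (addE n q) (addE m p) -ucompA (utensA (I 1)).
  rewrite -uinter ?st ?dpush_src // IHf ucomp1m //.
  rewrite -{1}[cls T g](@ucompm1 _ _ _ _ p) //.
  rewrite uinter ?st ?dpush_tgt // ?ucompA; last by rewrite /= addn1.
  congr (_ ⊙ _); rewrite -[(cls T f ⊠ I 1) ⊠ _]utensA -uinter ?st ?dpush_src //.
  rewrite IHg ucomp1m // -[(cls T f ⊠ _) ⊠ I 1]utensA.
  by rewrite -uinter ?ucompm1 ?st ?dpush_tgt // addn1.
- by apply/slidesP; rewrite ptens0l ptens0r pcomp0l pcomp0r.
- apply/slidesP; rewrite !tcl_add ptensDl ptensDr pcompDl pcompDr.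
  by congr (_ + _); apply/slidesP.
- apply/slidesP; rewrite !tcl_scale ptensZl ptensZr pcompZl pcompZr.
  by congr (_ *: _); apply/slidesP.
Qed.

Lemma dcrossS c q : E (dcross c.+1 q) = (E (dcross c q) ⊠ I 1) ⊙ (I c ⊠ E (dpush q)).
Proof. by []. Qed.

(** A block of strands slides over [u] one strand at a time. *)
Lemma cross_natural c (u : uarrow T) : slides u ->
  E (dcross c (tgt u)) ⊙ (I c ⊠ u) = (u ⊠ I c) ⊙ E (dcross c (src u)).
Proof.
move=> su; elim: c => [|c IH].
  by rewrite utens1m utensm1 ucomp1m ?ucompm1.
rewrite !dcrossS -!ucompA -(addn1 c) -(utens_id T c 1) -(utensA (I c) (I 1)).
rewrite -uinter ?st ?dpush_src // ucomp1m // su.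
rewrite -{1}[I c](@ucomp1m _ _ _ (I c) c) // uinter ?st ?dpush_tgt ?addn1 //.
rewrite utensA !ucompA; congr (_ ⊙ _).
rewrite -uinter ?st ?dcross_src // IH ucomp1m // utensA.
by rewrite -[in RHS]uinter ?st ?dcross_tgt // ucomp1m.
Qed.

Lemma tvec_slide : E (dpush 3) ⊙ (I 1 ⊠ tvec) = tvec ⊠ I 1.
Proof.
have := slides_cls (TComp (TTens (tY K) (tI K)) (tcup K)).
by rewrite /slides -/tvec tvec_src tvec_tgt => ->; rewrite ucompm1 ?st.
Qed.

(** Antisymmetry in the first two legs is gamma_1.  The two ways of bending
    the vertex agree, which says that the vector is invariant under the cyclic
    permutation of its legs; this transports the antisymmetry to the last two
    legs. *)
Lemma tvec_skew : vec_skew S tvec.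
Proof.
have sk1 : wh 0 (bX S) 1 ⊙ tvec = uscale (-1) tvec.
  rewrite tvecE ucompA wh_l -uinter // ucompm1 //.
  have -> : bX S ⊙ Y = uscale (-1) Y.
    by rewrite -cls_comp -cls_scale; exact: tangle_cls (tangle_Y_skew K).
  by rewrite utensZl ucompZl.
split=> //.
have bend : (bcap S ⊠ I 1) ⊙ (I 1 ⊠ Y) = (I 1 ⊠ bcap S) ⊙ (Y ⊠ I 1).
  have := tangle_cls (tangle_Y_bend K); rewrite /tYhat; cls_norm; exact.
have coh := @vec_coherence _ _ _ _ S _ tvec_src tvec_tgt tvec_slide 0.
rewrite tY_interp in bend.
pose l := DComp (DTens (DComp (DTens DCap (DId 1)) (DTens (DId 1) dY)) (DId 2)) (ncup 2).
pose r := DComp (DTens (DComp (DTens (DId 1) DCap) (DTens dY (DId 1))) (DId 2)) (ncup 2).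
have lr : E l = E r by congr ((_ ⊠ _) ⊙ _).
have id3 : E (DId 3) ⊙ vecs tvec 1 = uscale 1 (vecs tvec 1).
  by rewrite uscale1 ucomp1m //= utensm1.
pose cyc := DComp (DTens (DId 1) DX) (DComp (DTens DX (DId 1)) DVec).
have el : E l = E cyc.
  rewrite (coh l cyc (DId 3) _ _ _ _ _ _ _ _ _ 1 id3) ?expr0 ?mul1r ?uscale1 //.
  by move=> [|a [|b [|c []]]] // [|//] _ _ _; case: a; case: b; case: c.
have er : E r = E DVec.
  rewrite (coh r DVec (DId 3) _ _ _ _ _ _ _ _ _ 1 id3) ?expr0 ?mul1r ?uscale1 //.
  by move=> [|a [|b [|c []]]] // [|//] _ _ _; case: a; case: b; case: c.
have h : wh 1 (bX S) 0 ⊙ wh 0 (bX S) 1 ⊙ tvec = tvec.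
  by rewrite wh_l wh_r; transitivity (E r); [rewrite -lr el | rewrite er].
by rewrite -[in RHS]h sk1 !ucompZr uscaleA mulrNN mulr1 uscale1.
Qed.

End TangleVector.

(** * Linear combinations of diagrams *)
(** [vm_compute] evaluates both arguments of [andb]; a conditional stops at the
    first failure. *)
Fixpoint lazy_all (A : Type) (p : A -> bool) (s : seq A) :=
  if s is x :: s' then (if p x then lazy_all p s' else false) else true.

Lemma lazy_allE A (p : A -> bool) s : lazy_all p s = all p s.
Proof. by elim: s => //= x s ->; case: (p x). Qed.

Definition similar_fast j ms d d' :=
  let k := dvecs d in
  if [&& dsrc d == dsrc d', dtgt d == dtgt d' & k == dvecs d'] then
    lazy_all (fun u => let v := drop (dsrc d) u in let c := take (dsrc d) u in
      perm_eq (sem d v c)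
        (flatten (nseq (2 ^ j) (flatten [seq sem d' v' c | v' <- sem (moves_diag k ms) [::] v]))))
      (sparse 2 (dsrc d + 3 * k))
  else false.

Lemma similar_fastE j ms d d' : dwf d -> dwf d' -> all (move_ok (dvecs d)) ms ->
  similar_fast j ms d d' -> similar j ms d d'.
Proof.
move=> wd wd' ok; rewrite /similar_fast; case: ifP => // /and3P [es et ek].
by rewrite lazy_allE /similar wd wd' es et ek ok.
Qed.

Definition lincomb := seq (int * diag).

(** How one term of a linear combination reduces: [Like i j ms] to the [i]-th
    term, with [j] loops and the leg permutation [ms]; [Zero ms] to nothing,
    because the diagram is invariant under the odd permutation [ms]. *)
Inductive cert := Like of nat & nat & seq move | Zero of seq move.

HB.instance Definition _ := gen_eqMixin diag.
HB.instance Definition _ := gen_eqMixin cert.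

Definition odd_moves ms := odd (sumn (map move_odd ms)).

Definition cert_ok ds d t :=
  match t with
  | Like i j ms => if all (move_ok (dvecs d)) ms then
                     similar_fast j ms d (nth (DId 0) ds i) else false
  | Zero ms => if all (move_ok (dvecs d)) ms && odd_moves ms then
                     similar_fast 0 ms d d else false
  end.

Definition cert_target t := if t is Like i _ _ then Some i else None.

Definition cert_weight (c : int) t : int :=
  if t is Like _ j ms then (if odd_moves ms then - c else c) * 7 ^+ j else 0.

Fixpoint total i (lc : lincomb) ts : int :=
  match lc, ts with
  | (c, _) :: lc', t :: ts' =>
    (if cert_target t == Some i then cert_weight c t else 0) + total i lc' ts'
  | _, _ => 0
  end.

Definition typed (m n : nat) (lc : lincomb) :=
  all (fun p => [&& dwf p.2, dsrc p.2 == m & dtgt p.2 == n]) lc.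

(** After each term has been reduced to its representative, all coefficients
    cancel when loops are evaluated to 7. *)
Definition vanishes m n (lc : lincomb) ts :=
  let ds := map snd lc in
  [&& typed m n lc, size ts == size lc,
   lazy_all (fun p => cert_ok ds p.1.2 p.2) (zip lc ts),
   all (fun t => if cert_target t is Some i then i < size lc else true)%N ts &
   all (fun i => total i lc ts == 0) (iota 0 (size lc))].

Section LinearCombinations.
Context (K : fieldType) (gen : nat -> nat -> Type) (rel : term_rel K gen)
  (S : brauer_in rel (7%:R : K)) (vec : uarrow rel).
Hypothesis (vec_src : src vec = 0%N) (vec_tgt : tgt vec = 3%N).
Hypothesis vec_slide : ucomp (ev S vec (dpush 3)) (utens (uid rel 1) vec) =
  utens vec (uid rel 1).
Hypothesis skew : vec_skew S vec.
Hypothesis two_neq0 : (2%:R : K) != 0.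
Local Notation E := (ev S vec).

(** The value of a diagram, in the space where linear combinations make
    sense. *)
Definition hm m n d : plmod rel m n := hom_of m n (E d).

Definition evl m n (lc : lincomb) : plmod rel m n :=
  \sum_(p <- lc) p.1%:~R *: hm m n p.2.

Lemma hm_arrow m n d : dsrc d = m -> dtgt d = n ->
  Arrow (plmod rel) (hm m n d) = E d.
Proof.
move=> <- <-; apply: hom_of_arrow; first by rewrite (ev_src S vec_src).
by rewrite (ev_tgt S vec_tgt).
Qed.

Lemma hm_similar m n j ms d d' : similar j ms d d' ->
  hm m n d = (7%:R ^+ j * moves_sign K ms) *: hm m n d'.
Proof.
move=> h; rewrite /hm (similar_interp vec_src vec_tgt vec_slide skew h).
by rewrite hom_ofZ.
Qed.

Lemma moves_signE ms : moves_sign K ms = if odd_moves ms then -1 else 1.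
Proof. by rewrite /odd_moves sumnE big_map /moves_sign -signr_odd; case: odd. Qed.

Lemma cert_okP m n lc (c : int) d t : dwf d -> typed m n lc ->
  (if cert_target t is Some i then i < size lc else true)%N ->
  cert_ok (map snd lc) d t ->
  c%:~R *: hm m n d =
  if cert_target t is Some i then
    (cert_weight c t)%:~R *: hm m n (nth (DId 0) (map snd lc) i)
  else 0.
Proof.
move=> wd ty; case: t => [i j ms|ms] /= il.
  case: ifP => // ok h.
  have wi : dwf (nth (DId 0) (map snd lc) i).
    rewrite (nth_map (0, DId 0)) //.
    by have /allP /(_ _ (mem_nth (0, DId 0) il)) /and3P [] := ty.
  rewrite (hm_similar m n (similar_fastE wd wi ok h)) scalerA moves_signE.
  congr (_ *: _); rewrite rmorphM rmorphXn /= mulrA.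
  by case: odd_moves; rewrite ?mulr1 // rmorphN /= mulrN1 mulNr.
case: ifP => // /andP [ok oddm] h.
have := hm_similar m n (similar_fastE wd wd ok h).
rewrite moves_signE oddm expr0 mul1r scaleN1r => e.
have : 2%:R *: hm m n d = 0.
  by rewrite scaler_nat mulr2n {1}e addNr.
by move/eqP; rewrite scaler_eq0 (negbTE two_neq0) => /eqP ->; rewrite scaler0.
Qed.

Lemma vanishesP m n lc ts : vanishes m n lc ts -> evl m n lc = 0.
Proof.
case/and5P => ty /eqP st; rewrite lazy_allE => ok tt tot.
pose f i := hm m n (nth (DId 0) (map snd lc) i).
have H lc' ts' : {subset zip lc' ts' <= zip lc ts} -> size ts' = size lc' ->
    typed m n lc' -> 
    evl m n lc' = \sum_(i < size lc) (total i lc' ts')%:~R *: f i.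
  elim: lc' ts' => [|[c d] lc' IH] [|t ts'] //= sub.
    by move=> _ _; rewrite /evl big_nil big1 // => i _; rewrite scale0r.
  move=> [s'] /andP [/and3P [wd _ _] ty'].
  rewrite /evl big_cons -/(evl m n lc') (IH ts') //; last first.
    by move=> x xs; apply: sub; rewrite inE xs orbT.
  have -> : \sum_(i < size lc)
      ((if cert_target t == Some (i : nat) then cert_weight c t else 0) +
       total i lc' ts')%:~R *: f i =
    \sum_(i < size lc)
      ((if cert_target t == Some (i : nat) then (cert_weight c t)%:~R *: f i
        else 0) + (total i lc' ts')%:~R *: f i).
    apply: eq_bigr => i _; rewrite intrD scalerDl; congr (_ + _).
    by case: eqP => //; rewrite scale0r.
  rewrite big_split /=; congr (_ + _).
  have pin := sub _ (mem_head _ _).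
  have tin : t \in ts.
    have := map_f snd pin; rewrite -/unzip2 unzip2_zip ?st //.
  have ci := allP tt _ tin; have cok := allP ok _ pin.
  rewrite (cert_okP c wd ty ci cok); case: (cert_target t) ci => [i|] il.
    rewrite (bigD1 (Ordinal il)) //= eqxx big1 ?addr0 // => k ki.
    by rewrite ifN //; apply/eqP => -[e]; case/eqP: ki; apply: val_inj.
  by rewrite big1.
rewrite (H lc ts) // big1 // => i _.
have /(allP tot)/eqP -> : (i : nat) \in iota 0 (size lc) by rewrite mem_iota add0n ltn_ord.
by rewrite scale0r.
Qed.

End LinearCombinations.

Definition lsingle d : lincomb := [:: (1, d)].
Definition lscale (z : int) (lc : lincomb) : lincomb := [seq (z * p.1, p.2) | p <- lc].
Definition lcomp (lg lf : lincomb) : lincomb :=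
  [seq (p.1 * q.1, DComp p.2 q.2) | p <- lg, q <- lf].
Definition ltens (lf lg : lincomb) : lincomb :=
  [seq (p.1 * q.1, DTens p.2 q.2) | p <- lf, q <- lg].

Definition whd a d b := DTens (DTens (DId a) d) (DId b).

(** A context [g ∘ (I ⊗ _ ⊗ I) ∘ f] with its coefficient. *)
Record context := Context { ctx_coef : int; ctx_top : diag; ctx_left : nat;
  ctx_right : nat; ctx_bot : diag }.

Definition lplug (lc : lincomb) (x : context) : lincomb :=
  lscale (ctx_coef x) (lcomp (lsingle (ctx_top x))
    (lcomp (ltens (ltens (lsingle (DId (ctx_left x))) lc) (lsingle (DId (ctx_right x))))
           (lsingle (ctx_bot x)))).

Definition ctx_typed m n p q (x : context) :=
  [&& dwf (ctx_top x), dwf (ctx_bot x), dsrc (ctx_bot x) == p, dtgt (ctx_top x) == q,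
   dtgt (ctx_bot x) == (ctx_left x + m + ctx_right x)%N &
   dsrc (ctx_top x) == (ctx_left x + n + ctx_right x)%N].

Definition reduces p q (lc : lincomb) (rel : lincomb) (xs : seq context) ts :=
  [&& all (ctx_typed 2 2 p q) xs &
   vanishes p q (lc ++ flatten [seq lplug rel x | x <- xs]) ts].

Lemma typed_comp m n p a b : typed n p a -> typed m n b -> typed m p (lcomp a b).
Proof.
move=> ta tb; apply/allP => _ /allpairsP [[u v] /= [ua vb ->]] /=.
have /and3P [-> /eqP -> ->] := allP ta _ ua.
by have /and3P [-> -> /eqP ->] := allP tb _ vb; rewrite eqxx.
Qed.

Lemma typed_tens m n p q a b : typed m n a -> typed p q b ->
  typed (m + p) (n + q) (ltens a b).
Proof.
move=> ta tb; apply/allP => _ /allpairsP [[u v] /= [ua vb ->]] /=.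
have /and3P [-> /eqP -> /eqP ->] := allP ta _ ua.
by have /and3P [-> /eqP -> /eqP ->] := allP tb _ vb; rewrite !eqxx.
Qed.

Lemma typed_cat m n a b : typed m n a -> typed m n b -> typed m n (a ++ b).
Proof. by rewrite /typed all_cat => -> ->. Qed.

Lemma typed_scale m n z a : typed m n a -> typed m n (lscale z a).
Proof. by rewrite /typed all_map. Qed.

Section LinearAlgebra.
Context (K : fieldType) (gen : nat -> nat -> Type) (rel : term_rel K gen)
  (S : brauer_in rel (7%:R : K)) (vec : uarrow rel).
Hypothesis (vec_src : src vec = 0%N) (vec_tgt : tgt vec = 3%N).
Hypothesis vec_slide : ucomp (ev S vec (dpush 3)) (utens (uid rel 1) vec) =
  utens vec (uid rel 1).
Hypothesis skew : vec_skew S vec.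
Hypothesis two_neq0 : (2%:R : K) != 0.
Local Notation evl := (evl S vec).
Local Notation hm := (hm S vec).

Lemma evl_cat m n a b : evl m n (a ++ b) = evl m n a + evl m n b.
Proof. exact: big_cat. Qed.

Lemma evl_scale m n z a : evl m n (lscale z a) = z%:~R *: evl m n a.
Proof.
rewrite /evl big_map scaler_sumr; apply: eq_bigr => p _.
by rewrite intrM scalerA.
Qed.

Lemma evl_single m n d : evl m n (lsingle d) = hm m n d.
Proof. by rewrite /evl big_seq1 scale1r. Qed.

Lemma hm_comp m n p g f : dsrc g = n -> dtgt g = p -> dsrc f = m -> dtgt f = n ->
  pcomp (hm n p g) (hm m n f) = hm m p (DComp g f).
Proof.
move=> sg tg sf tf; apply: Arrow_inj.
rewrite -[LHS](ucompE (hm n p g) (hm m n f)).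
by rewrite !(hm_arrow S vec_src vec_tgt).
Qed.

Lemma hm_tens m n p q f g : dsrc f = m -> dtgt f = n -> dsrc g = p -> dtgt g = q ->
  ptens (hm m n f) (hm p q g) = hm (m + p) (n + q) (DTens f g).
Proof.
move=> sf tf sg tg; apply: Arrow_inj.
have -> : Arrow (plmod rel) (ptens (hm m n f) (hm p q g)) =
  utens (Arrow (plmod rel) (hm m n f)) (Arrow (plmod rel) (hm p q g)) by [].
by rewrite !(hm_arrow S vec_src vec_tgt) //= ?sf ?sg ?tf ?tg.
Qed.

Lemma evl_comp m n p a b : typed n p a -> typed m n b ->
  pcomp (evl n p a) (evl m n b) = evl m p (lcomp a b).
Proof.
move=> ta tb; rewrite /lcomp.
elim: a ta => [|[z d] a IH] /=; first by rewrite /evl !big_nil pcomp0l.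
case/andP => /and3P [_ /eqP sd /eqP td] /IH {}IH.
rewrite /evl big_cons pcompDl big_cat -!/(evl _ _ _) IH; congr (_ + _).
elim: b tb {IH} => [|[z' d'] b IH] /=; first by rewrite /evl !big_nil pcomp0r.
case/andP => /and3P [_ /eqP sd' /eqP td'] /IH {}IH.
rewrite /evl !big_cons pcompDr -!/(evl _ _ _) IH; congr (_ + _).
by rewrite pcompZl pcompZr hm_comp // scalerA intrM.
Qed.

Lemma evl_tens m n p q a b : typed m n a -> typed p q b ->
  ptens (evl m n a) (evl p q b) = evl (m + p) (n + q) (ltens a b).
Proof.
move=> ta tb; rewrite /ltens.
elim: a ta => [|[z d] a IH] /=; first by rewrite /evl !big_nil ptens0l.
case/andP => /and3P [_ /eqP sd /eqP td] /IH {}IH.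
rewrite /evl big_cons ptensDl big_cat -!/(evl _ _ _) IH; congr (_ + _).
elim: b tb {IH} => [|[z' d'] b IH] /=; first by rewrite /evl !big_nil ptens0r.
case/andP => /and3P [_ /eqP sd' /eqP td'] /IH {}IH.
rewrite /evl !big_cons ptensDr -!/(evl _ _ _) IH; congr (_ + _).
by rewrite ptensZl ptensZr hm_tens // scalerA intrM.
Qed.

Lemma evl_plug m n p q lc x : typed m n lc -> evl m n lc = 0 ->
  ctx_typed m n p q x -> evl p q (lplug lc x) = 0.
Proof.
case: x => z g a b f tl l0 /and5P [/= wg wf /eqP sf /eqP tg /andP [/eqP tf /eqP sg]].
rewrite /lplug evl_scale /=.
have ti k : typed k k (lsingle (DId k)) by rewrite /typed /= !eqxx.
have tfb : typed p (a + m + b) (lsingle f) by rewrite /typed /= wf sf tf !eqxx.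
have tgb : typed (a + n + b) q (lsingle g) by rewrite /typed /= wg sg tg !eqxx.
have t1 := typed_tens (ti a) tl; have t2 := typed_tens t1 (ti b).
rewrite -(evl_comp tgb (typed_comp t2 tfb)) -(evl_comp t2 tfb).
rewrite -(evl_tens t1 (ti b)) -(evl_tens (ti a) tl).
by rewrite l0 ptens0r ptens0l pcomp0l pcomp0r scaler0.
Qed.

Theorem reducesP p q lc r xs ts : typed 2 2 r -> evl 2 2 r = 0 ->
  reduces p q lc r xs ts -> evl p q lc = 0.
Proof.
move=> tr r0 /andP [tx /(vanishesP vec_src vec_tgt vec_slide skew two_neq0)].
rewrite evl_cat => e; rewrite -[LHS]addr0 -[RHS]e; congr (_ + _).
elim: xs tx {e} => [|x xs IH] /=; first by rewrite /evl big_nil.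
case/andP => tx /IH e; rewrite evl_cat -e addr0; symmetry.
exact: evl_plug tr r0 tx.
Qed.

End LinearAlgebra.

(** * The relations to be derived from gamma_2 *)
Definition lH : lincomb :=
  [:: (1, DX); (-2%:Z, DComp DCup DCap); (1, DId 2); (1, DComp dY dYhat)].
(** Relation gamma_2, with everything on one side. *)
Definition lgamma : lincomb :=
  [:: (1, DComp dY dYhat);
      (1, DComp (DTens (DId 1) dYhat) (DTens dY (DId 1)));
      (-2%:Z, DX); (1, DComp DCup DCap); (1, DId 2)].

Definition lI := lsingle (DId 1).
Definition lX := lsingle DX.
Definition lcap := lsingle DCap.
Definition lcup := lsingle DCup.
Definition lcap2 := lcomp lcap (ltens (ltens lI lcap) lI).
Definition lcup2 := lcomp (ltens (ltens lI lcup) lI) lcup.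
Definition lY := lsingle dY.
Definition lYhat := lsingle dYhat.
Definition lH12 := ltens lH lI.
Definition lH23 := ltens lI lH.
Definition lH13 := lcomp (lcomp (ltens lI lX) lH12) (ltens lI lX).
(** The operator [H12 + H13], which acts on strands 2 and 3 as a derivation
    does on a tensor product. *)
Definition lderiv := lH12 ++ lH13.
Definition lsub (a b : lincomb) := a ++ lscale (-1) b.
Definition ltwist := lcomp (ltens lI lX) (ltens lX lI).

Definition rotate_lc := lsub
  (lcomp (lcomp (ltens (ltens lI lI) lcap2) (ltens (ltens (ltens (ltens lI lI) lH) lI) lI))
     (ltens (ltens lcup2 lI) lI)) lH.
Definition sym_lc := lsub (lcomp lX lH) (lcomp lH lX).
Definition skew_l_lc := lsub
  (lcomp (lcomp (ltens (ltens lI lcap) lI) (ltens lX lH)) (ltens (ltens lI lcup) lI))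
  (lscale (-1) lH).
Definition skew_r_lc := lsub
  (lcomp (lcomp (ltens (ltens lI lcap) lI) (ltens lH lX)) (ltens (ltens lI lcup) lI))
  (lscale (-1) lH).
Definition bubble_lc := lcomp lYhat lY ++ lscale 6 lI.
Definition derivX_lc := lsub (lcomp lderiv (ltens lI lX)) (lcomp (ltens lI lX) lderiv).
Definition derivCup_lc := lcomp lderiv (ltens lI lcup).
Definition derivCap_lc := lcomp (ltens lI lcap) lderiv.
(** Twice the relation, because gamma_2 has to be used with coefficients in
    [1/2]. *)
Definition derivY_lc := lscale 2 (lsub (lcomp lderiv (ltens lI lY)) (lcomp (ltens lI lY) lH)).
Definition derivYhat_lc :=
  lscale 2 (lsub (lcomp (ltens lI lYhat) lderiv) (lcomp lH (ltens lI lYhat))).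
Definition twist_lc := lsub (lcomp ltwist lderiv) (lcomp (lH13 ++ lH23) ltwist).
Definition twist23_lc := lsub (lcomp ltwist lH23) (lcomp lH12 ltwist).

Definition same i := Like i 0 [::].

(** For each relation, the multiples of gamma_2 from which it follows.  The
    coefficients solve a linear system whose unknowns are the ways of placing
    gamma_2 inside a diagram of the required shape; the certificates name, for
    every term of the resulting sum, an earlier term to which it is equal up to
    loops and sign. *)
Definition rotate_ctx : seq context := [:: ].
Definition rotate_cert :=
  [:: same 0; same 1; same 2; same 3; same 0; same 1; same 2; Like 3 0 [::
  Swap 0; Flip 0 true; Flip 0 false; Flip 1 false; Flip 1 true]].
Definition sym_ctx : seq context := [:: ].
Definition sym_cert :=
  [:: same 0; same 1; same 2; same 3; same 0; same 1; same 2; Like 3 0 [::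
  Flip 0 true; Flip 1 false]].
Definition skew_l_ctx : seq context := [:: Context (1) DX 0 0 (DId 2)].
Definition skew_l_cert :=
  [:: same 0; same 1; same 2; same 3; same 1; same 0; same 2; same 7; Like 7 0
  [:: Flip 1 false]; Like 3 0 [:: Swap 0; Flip 0 false; Flip 0 true; Flip 1
  false; Flip 1 true; Flip 1 false]; same 2; same 0; same 1].
Definition skew_r_ctx : seq context := [:: Context (1) DX 0 0 (DId 2)].
Definition skew_r_cert :=
  [:: same 0; same 1; same 2; same 3; same 1; same 0; same 2; same 7; Like 7 0
  [:: Flip 1 false]; Like 3 0 [:: Flip 0 false]; same 2; same 0; same 1].
Definition bubble_ctx : seq context := [:: Context (-1) (DTens (DId 1) DCap) 0 1 (DTens (DId 1) DCup)].
Definition bubble_cert :=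
  [:: same 0; same 1; same 0; Zero [:: Flip 1 false]; same 1; same 1; Like 1 1
  [::]].
Definition derivX_ctx : seq context := [:: ].
Definition derivX_cert :=
  [:: same 0; same 1; same 2; same 3; same 4; same 5; same 2; same 7; same 4;
  same 5; same 2; same 7; same 0; same 1; same 2; same 3].
Definition derivCup_ctx : seq context := [:: Context (1) (whd 0 DX 1) 0 1 (DTens (DId 1) DCup)].
Definition derivCup_cert :=
  [:: same 0; same 1; same 2; same 3; same 1; same 0; same 2; same 7; Like 3 0
  [:: Flip 1 false]; Like 7 0 [:: Flip 0 false]; same 2; same 1; same 0].
Definition derivCap_ctx : seq context := [:: Context (1) (DTens (DId 1) DCap) 0 1 (DComp (whd 0 DX 1) (whd 1 DX 0))].
Definition derivCap_cert :=
  [:: same 0; same 1; same 2; same 3; same 1; same 0; same 2; same 7; Like 7 0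
  [:: Flip 0 true]; Like 3 0 [:: Swap 0; Flip 0 true; Flip 1 false; Flip 1
  true]; same 2; same 0; same 1].
Definition derivY_ctx : seq context := [:: Context (-2) (DComp (DComp (whd 1 DX 0) (whd 0 DX 1)) (DTens (DId 1) dY)) 0 0 (whd 0 DX 0); Context (2) (DId 3) 0 1 (DComp (DTens (DId 1) DCup) dYhat); Context (-1) (DComp (DComp (whd 0 DX 1) (whd 1 DX 0)) (DTens (DId 1) dY)) 0 0 (whd 0 DX 0); Context (1) (whd 1 DX 0) 0 1 (DComp (DComp (DTens (DId 1) DCup) dYhat) (whd 0 DX 0)); Context (1) (whd 1 DX 0) 0 1 (DTens (DId 1) dY); Context (1) (DComp (whd 0 DX 1) (whd 1 DX 0)) 0 1 (DComp (DTens (DId 1) dY) (whd 0 DX 0)); Context (1) (DComp (whd 1 DX 0) (DTens (DId 1) dY)) 0 0 (DId 2)].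
Definition derivY_cert :=
  [:: same 0; same 1; same 2; same 3; same 4; same 5; same 2; same 7; same 8;
  same 9; same 2; same 11; same 12; Like 3 0 [:: Flip 0 false; Flip 1 true];
  Like 4 0 [:: Flip 0 false]; Like 9 0 [:: Flip 0 true; Flip 0 false]; same
  16; Like 12 0 [:: Flip 0 true; Flip 1 false]; same 11; Like 5 0 [:: Flip 0
  true]; Like 1 0 [:: Flip 0 false; Flip 0 true]; same 21; same 22; Like 7 0
  [:: Flip 1 true; Flip 2 false]; Like 0 0 [:: Flip 0 false]; Like 9 0 [::
  Flip 0 false; Flip 0 true]; same 26; Like 22 0 [:: Flip 1 false; Flip 2
  false]; Like 11 0 [:: Flip 0 true; Flip 2 false]; Like 1 0 [:: Flip 0
  false]; same 5; Like 21 0 [:: Flip 0 true]; Like 7 0 [:: Flip 0 false]; same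
  33; Like 4 0 [:: Flip 0 false]; Like 5 0 [:: Flip 0 false]; Like 2 0 [::
  Flip 0 false]; same 37; Like 33 0 [:: Swap 0; Flip 0 false; Flip 1 false;
  Flip 2 true]; Like 16 0 [:: Flip 0 false]; Like 21 0 [:: Flip 0 false]; same
  26; Like 11 0 [:: Flip 2 false]; Like 37 0 [:: Flip 0 false; Flip 1 true;
  Flip 2 false]; Like 8 0 [:: Flip 0 false]; Like 9 0 [:: Flip 0 false]; Like
  2 0 [:: Flip 0 false]].
Definition derivYhat_ctx : seq context := [:: Context (1) (DTens (DId 1) dYhat) 0 1 (whd 0 DX 1); Context (2) (whd 0 DX 0) 0 0 (DComp (DTens (DId 1) dYhat) (whd 0 DX 1)); Context (1) (DComp dY (DTens (DId 1) DCap)) 0 1 (DComp (whd 0 DX 1) (whd 1 DX 0)); Context (-2) (DComp (whd 0 DX 0) (DComp dY (DTens (DId 1) DCap))) 0 1 (DId 3); Context (1) (DId 2) 0 0 (DComp (DTens (DId 1) dYhat) (whd 0 DX 1)); Context (1) (DComp (whd 0 DX 0) (DTens (DId 1) dYhat)) 0 1 (DComp (whd 0 DX 1) (whd 1 DX 0)); Context (-1) (whd 0 DX 0) 0 0 (DComp (DTens (DId 1) dYhat) (DComp (whd 0 DX 1) (whd 1 DX 0)))].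
Definition derivYhat_cert :=
  [:: same 0; same 1; same 2; same 3; same 4; same 5; same 2; same 7; same 8;
  same 9; same 2; same 11; Like 3 0 [:: Flip 0 true]; same 13; same 2; same 1;
  same 0; same 17; Like 7 0 [:: Swap 1; Flip 2 true]; same 0; Like 9 0 [::
  Flip 0 false; Flip 0 true; Flip 0 false]; same 21; Like 17 0 [:: Flip 0
  true; Flip 1 true; Flip 2 false]; same 23; same 24; Like 5 0 [:: Flip 0
  false]; Like 1 0 [:: Flip 0 true; Flip 0 false]; Like 23 0 [:: Swap 0; Flip
  0 true; Flip 0 false; Flip 1 true; Flip 2 false]; Like 11 0 [:: Swap 0; Flip
  1 false; Flip 1 true; Flip 2 false]; same 5; Like 1 0 [:: Flip 0 true]; Like
  24 0 [:: Flip 0 false]; Like 17 0 [:: Flip 2 false]; same 33; same 21; Like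
  9 0 [:: Flip 0 false; Flip 0 true; Flip 0 false]; same 0; Like 33 0 [:: Swap
  1; Flip 0 true; Flip 1 true; Flip 2 true]; Like 13 0 [:: Swap 0; Swap 1;
  Swap 0; Flip 0 true; Flip 1 false; Flip 1 true; Flip 1 false; Flip 2 true];
  Like 8 0 [:: Flip 0 true]; Like 5 0 [:: Flip 0 false; Flip 0 true]; same 41;
  Like 23 0 [:: Swap 0; Flip 0 true; Flip 0 false; Flip 2 false]; Like 3 0 [::
  Swap 1; Flip 1 true; Flip 2 true]; Like 4 0 [:: Flip 0 true]; Like 9 0 [::
  Flip 0 false; Flip 0 true]; same 41].
Definition twist_ctx : seq context := [:: ].
Definition twist_cert :=
  [:: same 0; same 1; same 2; same 3; same 4; same 5; same 2; same 7; same 0;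
  same 1; same 2; Like 3 0 [:: Flip 0 true; Flip 1 false]; same 4; same 5;
  same 2; Like 7 0 [:: Flip 0 true; Flip 1 false]].
Definition twist23_ctx : seq context := [:: ].
Definition twist23_cert :=
  [:: same 0; same 1; same 2; same 3; same 0; same 1; same 2; same 3].

Lemma rotate_ok : reduces 2 2 rotate_lc lgamma rotate_ctx rotate_cert.
Proof. by vm_compute. Qed.

Lemma sym_ok : reduces 2 2 sym_lc lgamma sym_ctx sym_cert.
Proof. by vm_compute. Qed.

Lemma skew_l_ok : reduces 2 2 skew_l_lc lgamma skew_l_ctx skew_l_cert.
Proof. by vm_compute. Qed.

Lemma skew_r_ok : reduces 2 2 skew_r_lc lgamma skew_r_ctx skew_r_cert.
Proof. by vm_compute. Qed.

Lemma bubble_ok : reduces 1 1 bubble_lc lgamma bubble_ctx bubble_cert.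
Proof. by vm_compute. Qed.

Lemma derivX_ok : reduces 3 3 derivX_lc lgamma derivX_ctx derivX_cert.
Proof. by vm_compute. Qed.

Lemma derivCup_ok : reduces 1 3 derivCup_lc lgamma derivCup_ctx derivCup_cert.
Proof. by vm_compute. Qed.

Lemma derivCap_ok : reduces 3 1 derivCap_lc lgamma derivCap_ctx derivCap_cert.
Proof. by vm_compute. Qed.

Lemma derivY_ok : reduces 2 3 derivY_lc lgamma derivY_ctx derivY_cert.
Proof. by vm_compute. Qed.

Lemma derivYhat_ok : reduces 3 2 derivYhat_lc lgamma derivYhat_ctx derivYhat_cert.
Proof. by vm_compute. Qed.

Lemma twist_ok : reduces 3 3 twist_lc lgamma twist_ctx twist_cert.
Proof. by vm_compute. Qed.

Lemma twist23_ok : reduces 3 3 twist23_lc lgamma twist23_ctx twist23_cert.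
Proof. by vm_compute. Qed.

(** * Consequences of gamma_2 *)
Section Consequences.
Context (K : fieldType) (gen : nat -> nat -> Type) (rel : term_rel K gen)
  (S : brauer_in rel (7%:R : K)) (vec : uarrow rel).
Hypothesis (vec_src : src vec = 0%N) (vec_tgt : tgt vec = 3%N).
Hypothesis vec_slide : ucomp (ev S vec (dpush 3)) (utens (uid rel 1) vec) =
  utens vec (uid rel 1).
Hypothesis skew : vec_skew S vec.
Hypothesis two_neq0 : (2%:R : K) != 0.
Local Notation E := (ev S vec).
Local Notation evl := (evl S vec).
Local Notation hm := (hm S vec).

Lemma evl_sub m n a b : evl m n (lsub a b) = evl m n a - evl m n b.
Proof. by rewrite /lsub evl_cat evl_scale rmorphN1 scaleN1r. Qed.

Lemma evl_sub0 m n a b : evl m n (lsub a b) = 0 -> evl m n a = evl m n b.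
Proof. by rewrite evl_sub => /eqP; rewrite subr_eq0 => /eqP. Qed.

Lemma evl_id n : evl n n (lsingle (DId n)) = tcl rel (TId n).
Proof.
by rewrite evl_single; apply: Arrow_inj; rewrite (hm_arrow S vec_src vec_tgt).
Qed.

(** Replacing terms by combinations of diagrams makes equations between them
    decidable by computation.  The scalar is kept apart because combinations
    have integer coefficients, whereas vertices get rescaled by a square root
    of -1. *)
Definition stands (s : K) m n (f : term K gen m n) lc :=
  typed m n lc /\ tcl rel f = s *: evl m n lc.

Lemma stands_cls m n (f : term K gen m n) d : dwf d -> dsrc d = m -> dtgt d = n ->
  cls rel f = E d -> stands 1 f (lsingle d).
Proof.
move=> wd sd td fd; split; first by rewrite /typed /= wd sd td !eqxx.
rewrite scale1r evl_single; apply: Arrow_inj.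
by rewrite (hm_arrow S vec_src vec_tgt) // -fd.
Qed.

Lemma stands_id n : stands 1 (TId n : term K gen n n) (lsingle (DId n)).
Proof. exact: stands_cls. Qed.

Lemma stands_comp s s' m n p (g : term K gen n p) (f : term K gen m n) a b :
  stands s g a -> stands s' f b -> stands (s * s') (TComp g f) (lcomp a b).
Proof.
move=> [ta ea] [tb eb]; split; first exact: typed_comp ta tb.
rewrite -tcl_comp ea eb pcompZl pcompZr scalerA.
by rewrite (evl_comp S vec_src vec_tgt ta tb).
Qed.

Lemma stands_tens s s' m n p q (f : term K gen m n) (g : term K gen p q) a b :
  stands s f a -> stands s' g b -> stands (s * s') (TTens f g) (ltens a b).
Proof.
move=> [ta ea] [tb eb]; split; first exact: typed_tens.
rewrite -tcl_tens ea eb ptensZl ptensZr scalerA.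
by rewrite (evl_tens S vec_src vec_tgt ta tb).
Qed.

Lemma stands1_comp m n p (g : term K gen n p) (f : term K gen m n) a b :
  stands 1 g a -> stands 1 f b -> stands 1 (TComp g f) (lcomp a b).
Proof. by move=> ha /(stands_comp ha); rewrite mulr1. Qed.

Lemma stands1_tens m n p q (f : term K gen m n) (g : term K gen p q) a b :
  stands 1 f a -> stands 1 g b -> stands 1 (TTens f g) (ltens a b).
Proof. by move=> ha /(stands_tens ha); rewrite mulr1. Qed.

Lemma stands_add s m n (f g : term K gen m n) a b :
  stands s f a -> stands s g b -> stands s (TAdd f g) (a ++ b).
Proof.
move=> [ta ea] [tb eb]; split; first exact: typed_cat.
by rewrite tcl_add ea eb evl_cat scalerDr.
Qed.

Lemma stands_scale s c m n (f : term K gen m n) a :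
  stands s f a -> stands (c * s) (TScale c f) a.
Proof. by move=> [ta ea]; split => //; rewrite tcl_scale ea scalerA. Qed.

Lemma stands_int s z m n (f : term K gen m n) a :
  stands s f a -> stands s (TScale z%:~R f) (lscale z a).
Proof.
move=> [ta ea]; split; first exact: typed_scale.
by rewrite tcl_scale ea evl_scale !scalerA mulrC.
Qed.

Lemma stands_opp s m n (f : term K gen m n) a :
  stands s f a -> stands s (TScale (-1) f) (lscale (-1) a).
Proof. by move=> /(stands_int (-1)); rewrite rmorphN1. Qed.

Lemma stands_sub s m n (f g : term K gen m n) a b :
  stands s f a -> stands s g b -> stands s (TAdd f (TScale (-1) g)) (lsub a b).
Proof. by move=> sf sg; apply: stands_add => //; apply: stands_opp. Qed.

Lemma stands_eq s m n (f g : term K gen m n) a b :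
  stands s f a -> stands s g b -> evl m n a = evl m n b -> tcl rel f = tcl rel g.
Proof. by move=> [_ ->] [_ ->] ->. Qed.

Lemma stands_similar s s' j ms m n (f g : term K gen m n) d d' :
  stands s f (lsingle d) -> stands s' g (lsingle d') -> similar j ms d d' ->
  s * (7%:R ^+ j * moves_sign K ms) = s' -> tcl rel f = tcl rel g.
Proof.
move=> [_ ->] [_ ->] /(hm_similar vec_src vec_tgt vec_slide skew m n) e <-.
by rewrite !evl_single e scalerA.
Qed.

Section Square.
Hypothesis square : evl 2 2 lgamma = 0.

Lemma square_reduces p q lc xs ts : reduces p q lc lgamma xs ts -> evl p q lc = 0.
Proof.
exact: (reducesP vec_src vec_tgt vec_slide skew two_neq0 _ square).
Qed.
Let tl := evl_comp S vec_src vec_tgt.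
Let tt := evl_tens S vec_src vec_tgt.

Lemma double_eq m n a b : evl m n (lscale 2 (lsub a b)) = 0 -> evl m n a = evl m n b.
Proof.
rewrite evl_scale => /eqP.
by rewrite scaler_eq0 (negbTE two_neq0) /= => /eqP/evl_sub0.
Qed.

Lemma bubble_eq : evl 1 1 (lcomp lYhat lY) = - (6%:R *: evl 1 1 lI).
Proof.
by have /eqP := square_reduces bubble_ok; rewrite evl_cat evl_scale addr_eq0 => /eqP.
Qed.

(** [H23] is a combination of [I ⊗ X], [(I ⊗ cup) (I ⊗ cap)], the identity
    and [(I ⊗ Y) (I ⊗ Yhat)].  The derivation property of [H12 + H13] turns its
    product with each of these, from either side, into the same expression. *)
Lemma deriv_comm : pcomp (evl 3 3 lderiv) (evl 3 3 lH23) = pcomp (evl 3 3 lH23) (evl 3 3 lderiv).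
Proof.
set D := evl 3 3 lderiv.
pose x := evl 3 3 (ltens lI lX).
pose u := evl 1 3 (ltens lI lcup); pose v := evl 3 1 (ltens lI lcap).
pose y := evl 2 3 (ltens lI lY); pose z := evl 3 2 (ltens lI lYhat).
pose h := evl 2 2 lH.
have hx : pcomp D x = pcomp x D.
  by have := evl_sub0 (square_reduces derivX_ok); rewrite -!(@tl 3 3 3).
have hu : pcomp D u = 0.
  by have := square_reduces derivCup_ok; rewrite /derivCup_lc -(@tl 1 3 3).
have hv : pcomp v D = 0.
  by have := square_reduces derivCap_ok; rewrite /derivCap_lc -(@tl 3 3 1).
have hy : pcomp D y = pcomp y h.
  by have := double_eq (square_reduces derivY_ok); rewrite -(@tl 2 3 3) // -(@tl 2 2 3).
have hz : pcomp z D = pcomp h z.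
  by have := double_eq (square_reduces derivYhat_ok); rewrite -(@tl 3 3 2) // -(@tl 3 2 2).
have -> : evl 3 3 lH23 = x - 2%:R *: pcomp u v + tcl rel (TId 3) + pcomp y z.
  have hE : evl 2 2 lH = evl 2 2 lX - 2%:R *: pcomp (evl 0 2 lcup) (evl 2 0 lcap) +
      tcl rel (TId 2) + pcomp (evl 1 2 lY) (evl 2 1 lYhat).
    have -> : lH = lX ++ lscale (-2) (lcomp lcup lcap) ++ lsingle (DId 2) ++ lcomp lY lYhat by [].
    rewrite (@tl 2 0 2) // (@tl 2 1 2) // -evl_id.
    by rewrite 3!evl_cat evl_scale rmorphN scaleNr !addrA.
  have i1 : tcl rel (TId 1) = pcomp (evl 1 1 lI) (evl 1 1 lI).
    by rewrite evl_id pcomp1m.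
  have wI k l a : typed k l a ->
      ptens (evl 1 1 lI) (evl k l a) = evl k.+1 l.+1 (ltens lI a) by exact: tt.
  rewrite -wI // hE !ptensDr -scaleNr ptensZr scaleNr.
  have dist p g f : ptens (evl 1 1 lI) (pcomp g f : plmod rel 2 2) =
     pcomp (ptens (evl 1 1 lI) g) (ptens (evl 1 1 lI) (f : plmod rel 2 p)).
    by rewrite -ptens_comp evl_id pcomp1m.
  by rewrite !dist !wI // evl_id ptens_id.
rewrite !pcompDl !pcompDr -!scaleNr !pcompZl !pcompZr.
rewrite !pcompA hx hu hy -!pcompA hv hz !pcomp0l !pcomp0r.
by rewrite pcomp1m pcompm1 !pcompA.
Qed.


(** Conjugating by the cyclic permutation of the strands. *)
Lemma deriv_comm_l : pcomp (evl 3 3 lH12) (evl 3 3 (lH13 ++ lH23)) =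
  pcomp (evl 3 3 (lH13 ++ lH23)) (evl 3 3 lH12).
Proof.
pose r := evl 3 3 ltwist.
have h1 : pcomp r (evl 3 3 lderiv) = pcomp (evl 3 3 (lH13 ++ lH23)) r.
  by rewrite !(@tl 3 3 3) //; exact: evl_sub0 (square_reduces twist_ok).
have h2 : pcomp r (evl 3 3 lH23) = pcomp (evl 3 3 lH12) r.
  by rewrite !(@tl 3 3 3) //; exact: evl_sub0 (square_reduces twist23_ok).
pose d := DComp (DTens DX (DId 1)) (DTens (DId 1) DX).
have ri : pcomp r (hm 3 3 d) = tcl rel (TId 3).
  have -> : r = hm 3 3 (DComp (DTens (DId 1) DX) (DTens DX (DId 1))).
    by rewrite -evl_single.
  rewrite (hm_comp S vec_src vec_tgt) // -evl_id evl_single.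
  rewrite (@hm_similar _ _ _ _ _ vec_src vec_tgt vec_slide skew 3 3 0 [::] _ (DId 3)) //.
  by rewrite moves_signE expr0 mul1r scale1r.
have key : pcomp (pcomp (evl 3 3 lH12) (evl 3 3 (lH13 ++ lH23))) r =
    pcomp (pcomp (evl 3 3 (lH13 ++ lH23)) (evl 3 3 lH12)) r.
  by rewrite -!pcompA -h1 -h2 !pcompA -h1 -h2 -!pcompA deriv_comm.
have := congr1 (fun f => pcomp f (hm 3 3 d)) key.
by rewrite -!(pcompA _ r) ri !pcompm1.
Qed.

End Square.
End Consequences.

(** * Functors given on generators *)
Section Substitution.
Context (K : fieldType) (gen gen' : nat -> nat -> Type)
  (rel : term_rel K gen)
  (rel' : term_rel K gen')
  (phi : forall m n, gen m n -> term K gen' m n).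

Fixpoint tmap m n (f : term K gen m n) : term K gen' m n :=
  match f in term _ _ m n return term K gen' m n with
  | TGen _ _ g => phi g
  | TId n => TId n
  | TComp _ _ _ g f => TComp (tmap g) (tmap f)
  | TTens _ _ _ _ f g => TTens (tmap f) (tmap g)
  | TZero _ _ => TZero
  | TAdd _ _ f g => TAdd (tmap f) (tmap g)
  | TScale _ _ a f => TScale a (tmap f)
  end.

Hypothesis tmap_rel : forall m n (f g : term K gen m n), rel f g ->
  tcl rel' (tmap f) = tcl rel' (tmap g).

Lemma tmap_eqt m n (f : term K gen m n) m' n' (g : term K gen m' n') :
  eqt rel f g -> eqt rel' (tmap f) (tmap g).
Proof.
elim=> /=; try by move=> *; econstructor; eassumption.
by move=> ? ? ? ? /tmap_rel /tcl_eq.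
Qed.

Definition fmap m n (u : plmod rel m n) : plmod rel' m n :=
  tcl rel' (tmap (trep u)).

Lemma fmap_tcl m n (f : term K gen m n) : fmap (tcl rel f) = tcl rel' (tmap f).
Proof. exact/tcl_eq/tmap_eqt/trep_tcl. Qed.

Lemma fmap_lin m n : linear (@fmap m n).
Proof.
move=> a u v; rewrite -(trepK u) -(trepK v) tcl_lin !fmap_tcl /=.
by rewrite -tcl_lin.
Qed.

Lemma fmap_sum m n (I : finType) (a : I -> K) (u : I -> plmod rel m n) :
  fmap (\sum_i a i *: u i) = \sum_i a i *: fmap (u i).
Proof.
elim: (index_enum I) => [|i s IH]; last by rewrite !big_cons fmap_lin IH.
by rewrite !big_nil; exact: lin0 (@fmap_lin m n).
Qed.

Lemma fmap_comp m n p (v : plmod rel n p) (u : plmod rel m n) :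
  fmap (pcomp v u) = pcomp (fmap v) (fmap u).
Proof. by rewrite -(trepK u) -(trepK v) tcl_comp !fmap_tcl tcl_comp. Qed.

Lemma fmap_tens m n p q (u : plmod rel m n) (v : plmod rel p q) :
  fmap (ptens u v) = ptens (fmap u) (fmap v).
Proof. by rewrite -(trepK u) -(trepK v) tcl_tens !fmap_tcl tcl_tens. Qed.

Lemma fmap_id n : fmap (tcl rel (TId n)) = tcl rel' (TId n).
Proof. exact: fmap_tcl. Qed.

Definition functor : linMonFunctor (presented rel) (presented rel') :=
  @LinMonFunctor K (presented rel) (presented rel') id fmap fmap_lin fmap_id
    fmap_comp erefl (fun _ _ => erefl)
    (fun a b c d f g => congr1 (Arrow (plmod rel')) (fmap_tens f g)).

End Substitution.

Section Inverse.
Context (K : fieldType) (gen gen' : nat -> nat -> Type)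
  (rel : term_rel K gen)
  (phi : forall m n, gen m n -> term K gen' m n)
  (psi : forall m n, gen' m n -> term K gen m n).

Lemma tmapK : (forall m n (g : gen m n), tcl rel (tmap psi (phi g)) = tcl rel (TGen g)) ->
  forall m n (f : term K gen m n), tcl rel (tmap psi (tmap phi f)) = tcl rel f.
Proof.
move=> H m n; elim=> //=.
- by move=> *; rewrite -!tcl_comp; congr pcomp.
- by move=> *; rewrite -!tcl_tens; congr ptens.
- by move=> *; rewrite !tcl_add; congr (_ + _).
- by move=> *; rewrite !tcl_scale; congr (_ *: _).
Qed.
End Inverse.

Section Isomorphism.
Context (K : fieldType) (gen gen' : nat -> nat -> Type)
  (rel : term_rel K gen)
  (rel' : term_rel K gen')
  (phi : forall m n, gen m n -> term K gen' m n)
  (psi : forall m n, gen' m n -> term K gen m n).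
Hypothesis phi_rel : forall m n (f g : term K gen m n), rel f g ->
  tcl rel' (tmap phi f) = tcl rel' (tmap phi g).
Hypothesis psi_rel : forall m n (f g : term K gen' m n), rel' f g ->
  tcl rel (tmap psi f) = tcl rel (tmap psi g).
Hypothesis phiK : forall m n (g : gen m n), tcl rel (tmap psi (phi g)) = tcl rel (TGen g).
Hypothesis psiK : forall m n (g : gen' m n), tcl rel' (tmap phi (psi g)) = tcl rel' (TGen g).

Lemma presented_iso : linMonIso (presented rel) (presented rel').
Proof.
exists (functor phi_rel), (functor psi_rel); split; split => // m n u;
  congr (Arrow _); rewrite -(trepK u) /=.
  by rewrite (fmap_tcl phi_rel) (fmap_tcl psi_rel) tmapK.
by rewrite (fmap_tcl psi_rel) (fmap_tcl phi_rel) tmapK.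
Qed.
End Isomorphism.

(** * The functor from Brauer diagrams to tangles *)
Section BrauerImage.
Context (K : fieldType).
Local Notation T := (@tangle_rel K).
Local Notation S := (tangle_brauer K).
Local Notation E := (ev S (tvec K)).

Definition drawn r s (D : brauer r s) : plmod T r s := tcl T (drawing_term K D).

Definition brauer_map r s (f : bhom K r s) : plmod T r s :=
  \sum_(D : brauer r s) f D *: drawn D.

Lemma brauer_map_lin r s : linear (@brauer_map r s).
Proof.
move=> a f g; rewrite /brauer_map scaler_sumr -big_split; apply: eq_bigr => D _ /=.
by rewrite !ffunE scalerDl scalerA.
Qed.

HB.instance Definition _ r s :=
  GRing.isLinear.Build K (bhom K r s) (plmod T r s) *:%R (@brauer_map r s) (@brauer_map_lin r s).

Lemma brauer_map_bdiag r s (D : brauer r s) : brauer_map (bdiag K D) = drawn D.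
Proof.
rewrite /brauer_map (bigD1 D) //= ffunE eqxx scale1r big1 ?addr0 // => D' /negbTE n.
by rewrite ffunE n scale0r.
Qed.

Lemma drawn_interp r s (D : brauer r s) d : draws D d ->
  Arrow (plmod T) (drawn D) = E d.
Proof. exact: drawing_term_interp. Qed.

(** A drawing of [B] on top of a drawing of [A] has the state sum of their
    stack, and [2] to the number of loops becomes [7] to the number of loops
    by coherence. *)
Lemma drawn_comp r s t (B : brauer s t) (A : brauer r s) :
  pcomp (drawn B) (drawn A) =
  7%:R ^+ stack_loops B A *: brauer_map (\sum_(D | is_stack B A D) bdiag K D).
Proof.
have [D [_ uD HD]] := stack_exists S B A.
rewrite (eq_bigl _ _ uD) big_pred1_eq brauer_map_bdiag; apply: Arrow_inj.
have [a da] := drawing_exists A; have [b db] := drawing_exists B.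
have [d dd] := drawing_exists D.
rewrite -(ucompE (drawn B) (drawn A)) (drawn_interp da) (drawn_interp db).
rewrite -[RHS]/(uscale _ (Arrow (plmod T) (drawn D))) (drawn_interp dd).
have [bba H] := draws_comp da db.
case: da db dd H => [_ sa _ _] [_ _ tb _] [bd sd td Hd] H.
rewrite -[LHS]/(E (DComp b a)).
apply: (brauer_coherence S (tvec_src K) (tvec_tgt K)) => //=; rewrite ?sa ?tb //.
by move=> c e sc se _; rewrite H // HD // Hd.
Qed.

Lemma drawn_tens r s r' s' (A : brauer r s) (B : brauer r' s') :
  ptens (drawn A) (drawn B) =
  brauer_map (\sum_(D | is_juxtaposition A B D) bdiag K D).
Proof.
have [D [uD HD]] := juxtaposition_exists S A B.
rewrite (eq_bigl _ _ uD) big_pred1_eq brauer_map_bdiag; apply: Arrow_inj.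
have [a da] := drawing_exists A; have [b db] := drawing_exists B.
have [d dd] := drawing_exists D.
rewrite -[LHS]/(utens (Arrow (plmod T) (drawn A)) (Arrow (plmod T) (drawn B))).
rewrite (drawn_interp da) (drawn_interp db) (drawn_interp dd) -[LHS]/(E (DTens a b)).
case: da db dd => [ba sa ta Ha] [bb sb tb Hb] [bd sd td Hd].
rewrite (brauer_coherence S (tvec_src K) (tvec_tgt K) (j := 0) (d' := d)) ?expr0 ?uscale1 //.
- by rewrite dbrauer_tensE ba bb.
- by rewrite /= sa sb sd.
- by rewrite /= ta tb td.
move=> c e; rewrite [dsrc _]/= [dtgt _]/= sa sb ta tb mul1n.
move=> /split_at [c1 [c2 [-> s1 s2]]] /split_at [e1 [e2 [-> t1 t2]]] _.
rewrite count_sem_tens ?sa ?ta //.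
by rewrite Ha ?Hb ?Hd ?HD ?size_cat ?s1 ?s2 ?t1 ?t2 // mulnb.
Qed.

Lemma brauer_map_id r : brauer_map (bdiag K (br_id r)) = tcl T (TId r).
Proof. by rewrite brauer_map_bdiag; apply: Arrow_inj; rewrite (drawn_interp (draws_id r)). Qed.

Lemma pcomp_sum r s t (I J : finType) (a : I -> K) (b : J -> K)
    (g : I -> plmod T s t) (f : J -> plmod T r s) :
  pcomp (\sum_i a i *: g i) (\sum_j b j *: f j) =
  \sum_i \sum_j (a i * b j) *: pcomp (g i) (f j).
Proof.
rewrite (big_morph (fun v => pcomp v _) (fun v v' => pcompDl v v' _) (pcomp0l _ _)).
apply: eq_bigr => i _.
rewrite (big_morph (pcomp _) (pcompDr _) (pcomp0r _ _)); apply: eq_bigr => j _.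
by rewrite pcompZl pcompZr scalerA.
Qed.

Lemma ptens_sum r s r' s' (I J : finType) (a : I -> K) (b : J -> K)
    (f : I -> plmod T r s) (g : J -> plmod T r' s') :
  ptens (\sum_i a i *: f i) (\sum_j b j *: g j) =
  \sum_i \sum_j (a i * b j) *: ptens (f i) (g j).
Proof.
rewrite (big_morph (fun v => ptens v _) (fun v v' => ptensDl v v' _) (ptens0l _ _ _)).
apply: eq_bigr => i _.
rewrite (big_morph (ptens _) (ptensDr _) (ptens0r _ _ _)); apply: eq_bigr => j _.
by rewrite ptensZl ptensZr scalerA.
Qed.

Lemma brauer_map_comp r s t (g : bhom K s t) (f : bhom K r s) :
  brauer_map (bcomp 7%:R g f) = pcomp (brauer_map g) (brauer_map f).
Proof.
rewrite [RHS]pcomp_sum /bcomp linear_sum; apply: eq_bigr => B _.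
rewrite linear_sum; apply: eq_bigr => A _.
by rewrite linearZ /= drawn_comp scalerA.
Qed.

Lemma brauer_map_tens r s r' s' (f : bhom K r s) (g : bhom K r' s') :
  brauer_map (btens f g) = ptens (brauer_map f) (brauer_map g).
Proof.
rewrite [RHS]ptens_sum /btens linear_sum; apply: eq_bigr => A _.
rewrite linear_sum; apply: eq_bigr => B _.
by rewrite linearZ /= drawn_tens.
Qed.

End BrauerImage.

(** * From the coupon category to tangles *)
Section ToTangles.
Context (K : fieldType) (c : K) (c_sqr : c * c = -1) (two_neq0 : (2%:R : K) != 0).
Local Notation T := (@tangle_rel K).
Local Notation S := (tangle_brauer K).
Local Notation tvec := (tvec K).
Local Notation E := (ev S tvec).
Local Notation I n := (uid T n).
Local Notation vs := (tvec_src K).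
Local Notation vt := (tvec_tgt K).
Local Notation vsl := (@tvec_slide K).
Local Notation vsk := (@tvec_skew K).

Definition tHimage : tterm K 2 2 :=
  (tX K - 2%R *: tE K + tI K ⊗ tI K + tY K ∘ tYhat K)%T.

Definition to_tangles m n (g : omega3_gen K m n) : tterm K m n :=
  match g in omega3_gen _ m n return tterm K m n with
  | BMor _ _ f => trep (brauer_map f)
  | Omega3 => TScale (- c) (TComp (TTens (tY K) (tI K)) (tcup K))
  | HCoupon => tHimage
  end.

Local Notation F := (tmap to_tangles).
Local Notation stands := (stands S tvec).
Local Notation evl := (evl S tvec).

Lemma tangle_tcl m n (f g : tterm K m n) : tangle_rel f g -> tcl T f = tcl T g.
Proof. by move=> h; apply/tcl_eq/eqt_rel. Qed.

Lemma stands_tI : stands 1 (tI K) lI.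
Proof. exact: stands_id vs vt 1. Qed.
Lemma stands_tX : stands 1 (tX K) lX.
Proof. exact: (stands_cls vs vt). Qed.
Lemma stands_tcup : stands 1 (tcup K) lcup.
Proof. exact: (stands_cls vs vt). Qed.
Lemma stands_tcap : stands 1 (tcap K) lcap.
Proof. exact: (stands_cls vs vt). Qed.
Lemma stands_tY : stands 1 (tY K) lY.
Proof. by apply: (stands_cls vs vt) => //; exact: tY_interp. Qed.
Lemma stands_tII : stands 1 (TTens (tI K) (tI K)) (lsingle (DId 2)).
Proof. by apply: (stands_cls vs vt) => //; rewrite cls_tens utens_id. Qed.

Local Notation ct := (stands1_comp vs vt).
Local Notation tt := (stands1_tens vs vt).

Lemma stands_tYhat : stands 1 (tYhat K) lYhat.
Proof. exact: (ct (tt stands_tI stands_tcap) (tt stands_tY stands_tI)). Qed.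

Lemma tangle_square : evl 2 2 lgamma = 0.
Proof.
have e := tangle_tcl (tangle_Y_square K).
have [_ l] := stands_add (ct stands_tY stands_tYhat)
  (ct (tt stands_tI stands_tYhat) (tt stands_tY stands_tI)).
have [_ r] := stands_sub (stands_sub (stands_int 2 stands_tX)
  (ct stands_tcup stands_tcap)) stands_tII.
move: e; rewrite l r !scale1r => e.
have -> : lgamma = lsub (lcomp lY lYhat ++ lcomp (ltens lI lYhat) (ltens lY lI))
  (lsub (lsub (lscale 2 lX) (lcomp lcup lcap)) (lsingle (DId 2))) by [].
by rewrite evl_sub e subrr.
Qed.

Local Notation tangle_reduces := (square_reduces vs vt vsl vsk two_neq0 tangle_square).

Lemma to_tangles_draws r s (D : brauer r s) d : draws D d ->
  cls T (F (obr (bdiag K D))) = E d.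
Proof. by move=> h; rewrite -(drawn_interp K h) /cls /= trepK brauer_map_bdiag. Qed.

Lemma stands_draws r s (D : brauer r s) d : draws D d ->
  stands 1 (F (obr (bdiag K D))) (lsingle d).
Proof.
move=> h; have [/andP [wd _] sd td _] := h.
by apply: (stands_cls vs vt) => //; exact: to_tangles_draws.
Qed.

Lemma stands_FX : stands 1 (F (oX K)) lX. Proof. exact: stands_draws draws_X. Qed.
Lemma stands_Fcap : stands 1 (F (ocap K)) lcap. Proof. exact: stands_draws draws_cap. Qed.
Lemma stands_Fcup : stands 1 (F (ocup K)) lcup. Proof. exact: stands_draws draws_cup. Qed.
Lemma stands_FH : stands 1 (F (oH K)) lH.
Proof.
exact: (stands_add (stands_add (stands_sub stands_tX
  (stands_int 2 (ct stands_tcup stands_tcap))) stands_tII)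
  (ct stands_tY stands_tYhat)).
Qed.
Lemma stands_Fomega : stands (- c) (F (oomega K)) (lsingle DVec).
Proof.
rewrite -[- c]mulr1; apply: stands_scale; exact: (stands_cls vs vt).
Qed.

Lemma stands_FY : stands (- c) (F (oY K)) lY.
Proof.
have := stands_comp vs vt (tt stands_tII stands_Fcap)
  (stands_tens vs vt stands_Fomega stands_tI).
by rewrite mul1r mulr1.
Qed.
Lemma stands_FYhat : stands (- c) (F (oYhat K)) lYhat.
Proof.
have := stands_comp vs vt (tt stands_tI stands_Fcap)
  (stands_tens vs vt stands_FY stands_tI).
by rewrite mul1r mulr1.
Qed.

Lemma to_tangles_slide_l d p q (g : oterm K p q) :
  tcl T (F (oXX K d q ∘ (TId d ⊗ g))%T) = tcl T (F ((g ⊗ TId d) ∘ oXX K d p)%T).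
Proof.
apply: Arrow_inj; have := cross_natural d (slides_cls (F g)).
rewrite -[tgt _]/q -[src _]/p -!(to_tangles_draws (draws_cross d _)) uid_cls.
by rewrite -!cls_tens -!cls_comp.
Qed.

(** Undoing a crossing, which turns one sliding relation into the other. *)
Lemma cross_inverse d q : (E (dcross q d) ⊙ E (dcross d q))%A = I (d + q).
Proof.
have := @sem_eq_interp _ _ T _ S _ vs vt (DComp (dcross q d) (dcross d q)) (DId (d + q)).
apply; rewrite ?dcross_src ?dcross_tgt //=.
- by apply/dbrauer_compP; rewrite !dcross_brauer dcross_src dcross_tgt.
- by rewrite dcross_src.
- by rewrite dcross_tgt.
rewrite dcross_src => _ /split_at [u [v [-> su sv]]].
by rewrite sem_dcross //= sem_dcross.
Qed.

Lemma to_tangles_slide_r d p q (g : oterm K p q) :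
  tcl T (F (oXX K q d ∘ (g ⊗ TId d))%T) = tcl T (F ((TId d ⊗ g) ∘ oXX K p d)%T).
Proof.
apply: Arrow_inj; have e := cross_natural d (slides_cls (F g)).
rewrite -[tgt _]/q -[src _]/p in e.
transitivity (E (dcross q d) ⊙ (cls T (F g) ⊠ I d))%A.
  by rewrite -(to_tangles_draws (draws_cross q d)) uid_cls -cls_tens -cls_comp.
transitivity ((I d ⊠ cls T (F g)) ⊙ E (dcross p d))%A; last first.
  by rewrite -(to_tangles_draws (draws_cross p d)) uid_cls -cls_tens -cls_comp.
rewrite -[LHS](@ucompm1 _ _ _ _ (p + d)) //; last first.
  by rewrite src_comp src_tens.
rewrite -(cross_inverse p d) -ucompA (ucompA (cls T (F g) ⊠ _)%A) -e.
rewrite !ucompA cross_inverse ucomp1m // tgt_tens //.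
Qed.

Lemma to_tangles_rel m n (f g : oterm K m n) : omega3_rel f g -> tcl T (F f) = tcl T (F g).
Proof.
have H := stands_FH; have X := stands_FX; have i := stands_tI.
have cap := stands_Fcap; have cup := stands_Fcup.
have cup2 := ct (tt (tt i cup) i) cup.
have cap2 := ct cap (tt (tt i cap) i).
have H12 := tt H i; have H23 := tt i H; have H13 := ct (ct (tt i X) H12) (tt i X).
case=> {m n f g}.
- by move=> a r s f g; rewrite /= tcl_add tcl_scale !trepK linearP.
- by move=> r; rewrite /= trepK brauer_map_id.
- by move=> r s t g f; rewrite /= -tcl_comp !trepK brauer_map_comp.
- by move=> r s r' s' f g; rewrite /= -tcl_tens !trepK brauer_map_tens.
- by move=> d p q g _; exact: to_tangles_slide_l.
- by move=> d p q g _; exact: to_tangles_slide_r.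
- apply: (stands_eq H (ct (ct (tt (tt i i) cap2) (tt (tt (tt (tt i i) H) i) i)) (tt (tt cup2 i) i))).
  exact: esym (evl_sub0 (tangle_reduces rotate_ok)).
- apply: (stands_eq (ct X H) (ct H X)).
  exact: evl_sub0 (tangle_reduces sym_ok).
- apply: (stands_eq (ct (ct (tt (tt i cap) i) (tt X H)) (tt (tt i cup) i)) (stands_opp H)).
  exact: evl_sub0 (tangle_reduces skew_l_ok).
- apply: (stands_eq (ct (ct (tt (tt i cap) i) (tt H X)) (tt (tt i cup) i)) (stands_opp H)).
  exact: evl_sub0 (tangle_reduces skew_r_ok).
- have a := stands_add H13 H23.
  have [_ e] := stands_sub (ct H12 a) (ct a H12).
  rewrite [LHS]e scale1r evl_sub -!(evl_comp S vs vt (n := 3)) //.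
  by rewrite (deriv_comm_l vs vt vsl vsk two_neq0 tangle_square) subrr.
- have a := stands_add H12 H13.
  have [_ e] := stands_sub (ct a H23) (ct H23 a).
  rewrite [LHS]e scale1r evl_sub -!(evl_comp S vs vt (n := 3)) //.
  by rewrite (deriv_comm vs vt vsl vsk two_neq0 tangle_square) subrr.
- have l := stands_comp vs vt (tt X i) stands_Fomega.
  have r := stands_scale (-1) stands_Fomega.
  apply: (stands_similar vs vt vsl vsk (j := 0) (ms := [:: Flip 0 false]) l r) => //.
  by rewrite moves_signE expr0 !mul1r mulrN1 mulN1r.
- have l := stands_comp vs vt (tt i X) stands_Fomega.
  have r := stands_scale (-1) stands_Fomega.
  apply: (stands_similar vs vt vsl vsk (j := 0) (ms := [:: Flip 0 true]) l r) => //.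
  by rewrite moves_signE expr0 !mul1r mulrN1 mulN1r.
- have [_ l] := stands_comp vs vt stands_FYhat stands_FY.
  have [_ r] := stands_int 6 i.
  rewrite [LHS]l [RHS]r (bubble_eq vs vt vsl vsk two_neq0 tangle_square).
  by rewrite evl_scale mulrNN c_sqr scaleN1r opprK scale1r.
- have [_ y] := stands_comp vs vt stands_FY stands_FYhat.
  have [_ z] := ct stands_tY stands_tYhat.
  have b := stands_add (stands_sub X (stands_int 2 (ct cup cap))) stands_tII.
  have b' := stands_add (stands_sub stands_tX (stands_int 2 (ct stands_tcup stands_tcap))) stands_tII.
  rewrite [LHS]tcl_add [RHS]tcl_add (stands_eq b' b (erefl _)); congr (_ + _).
  by rewrite z [RHS]tcl_scale [X in _ = _ *: X]y mulrNN c_sqr !scaleN1r opprK scale1r.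
Qed.

End ToTangles.

(** * From tangles to the coupon category *)
(** The coupon [oH]: here [Y Yhat] has the sign opposite to that in [lH]. *)
Definition lHomega : lincomb :=
  lsub (lX ++ lscale (-2) (lcomp lcup lcap) ++ lsingle (DId 2)) (lcomp lY lYhat).
Definition omega_skew_lc := lsub
  (lcomp (lcomp (ltens (ltens lI lcap) lI) (ltens lX lHomega)) (ltens (ltens lI lcup) lI))
  (lscale (-1) lHomega).
(** Relation gamma_2 for [c *: oY], whose quadratic terms have changed sign. *)
Definition square_lc : lincomb :=
  lcomp lY lYhat ++ lcomp (ltens lI lYhat) (ltens lY lI) ++
  [:: (2, DX); (-1, DComp DCup DCap); (-1, DId 2)].
(** Composing with the crossing turns [Y Yhat], bent as in the skew symmetry of
    [oH], into the other quadratic term of gamma_2. *)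
Definition square_ctx := [:: Context (-1) DX 0 0 (DId 2)].
Definition square_cert :=
  [:: same 0; same 1; same 2; same 3; same 4; same 3; same 4; same 2; Like 1 0
  [:: Swap 0; Flip 0 false; Flip 0 true; Flip 0%N false; Flip 1 true; Flip 1
  false]; same 4; same 3; same 2; Like 0 0 [:: Flip 1 false]].

Lemma square_ok : reduces 2 2 square_lc omega_skew_lc square_ctx square_cert.
Proof. by vm_compute. Qed.

Section FromTangles.
Context (K : fieldType) (c : K) (c_sqr : c * c = -1) (two_neq0 : (2%:R : K) != 0).
Local Notation O := (@omega3_rel K).
Local Notation S := (omega_brauer K).
Local Notation ovec := (cls O (oomega K)).
Local Notation E := (ev S ovec).
Local Notation I n := (uid O n).
Local Open Scope arrow_scope.

Lemma ovec_src : src ovec = 0%N. Proof. by []. Qed.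
Lemma ovec_tgt : tgt ovec = 3%N. Proof. by []. Qed.
Local Notation vs := ovec_src.
Local Notation vt := ovec_tgt.

Lemma brauer_arrow_interp r s (D : brauer r s) d : draws D d -> brauer_arrow K D = E d.
Proof.
move=> [bd sd td Hd]; have [r' [s' [k [D' [sd' td' e Hd']]]]] := omega_normal K bd.
have er : r' = r by congruence.
have es : s' = s by congruence.
move: D' e Hd' {sd' td'}; rewrite {}er {}es => D' e Hd'.
have [k0 eD] : k = 0%N /\ D' = D.
  by apply: fits_determines => a b sa sb; rewrite -Hd' // Hd // mul1n.
by move: e; rewrite k0 eD expr0 uscale1 => <-.
Qed.

Lemma ovec_slide : E (dpush 3) ⊙ (I 1 ⊠ ovec) = ovec ⊠ I 1.
Proof.
have := omega_cls (omega3_slide_l 1 (coupon_omega K)).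
have oc r s : cls O (oXX K r s) = E (dcross r s) by exact: brauer_arrow_interp (draws_cross r s).
rewrite !cls_comp !cls_tens -!uid_cls !oc.
have -> : E (dcross 1 3) = E (dpush 3).
  by apply: (same_sem_interp S vs vt); vm_compute.
have -> : E (dcross 1 0) = I 1.
  by apply: (same_sem_interp S vs vt (d' := DId 1)); vm_compute.
by move=> ->; rewrite ucompm1.
Qed.

Lemma ovec_skew : vec_skew S ovec.
Proof.
split; rewrite ?wh_l ?wh_r -cls_scale uid_cls -cls_tens -cls_comp; apply: omega_cls.
  exact: omega3_skew_l.
exact: omega3_skew_r.
Qed.
Local Notation vsl := ovec_slide.
Local Notation vsk := ovec_skew.
Local Notation stands := (stands S ovec).
Local Notation evl := (evl S ovec).
Local Notation ct := (stands1_comp vs vt).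
Local Notation tt := (stands1_tens vs vt).

Lemma omega_tcl m n (f g : oterm K m n) : omega3_rel f g -> tcl O f = tcl O g.
Proof. by move=> h; apply/tcl_eq/eqt_rel. Qed.

Lemma stands_oI : stands 1 (oI K) lI.
Proof. exact: stands_id vs vt 1. Qed.
Lemma stands_oX : stands 1 (oX K) lX.
Proof. exact: (stands_cls vs vt). Qed.
Lemma stands_ocup : stands 1 (ocup K) lcup.
Proof. exact: (stands_cls vs vt). Qed.
Lemma stands_ocap : stands 1 (ocap K) lcap.
Proof. exact: (stands_cls vs vt). Qed.
Lemma stands_oII : stands 1 (TTens (oI K) (oI K)) (lsingle (DId 2)).
Proof. by apply: (stands_cls vs vt) => //; rewrite cls_tens utens_id. Qed.
Lemma stands_oomega : stands 1 (oomega K) (lsingle DVec).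
Proof. exact: (stands_cls vs vt). Qed.
Lemma stands_oY : stands 1 (oY K) lY.
Proof. exact: (ct (tt stands_oII stands_ocap) (tt stands_oomega stands_oI)). Qed.
Lemma stands_oYhat : stands 1 (oYhat K) lYhat.
Proof. exact: (ct (tt stands_oI stands_ocap) (tt stands_oY stands_oI)). Qed.

Lemma stands_oH : stands 1 (oH K) lHomega.
Proof.
have [t e] := stands_sub (stands_add (stands_sub stands_oX
  (stands_int 2 (ct stands_ocup stands_ocap))) stands_oII)
  (ct stands_oY stands_oYhat).
split=> //; rewrite (omega_tcl (omega3_H_def K)); exact: e.
Qed.

Lemma omega_skew0 : evl 2 2 omega_skew_lc = 0.
Proof.
have h := stands_oH; have i := stands_oI.
have [_ l] := ct (ct (tt (tt i stands_ocap) i) (tt stands_oX h)) (tt (tt i stands_ocup) i).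
have [_ r] := stands_opp h.
have e := omega_tcl (omega3_H_skew_l K).
rewrite /oH /oX in l r e.
by move: e; rewrite [LHS]l [RHS]r !scale1r /omega_skew_lc evl_sub => ->; rewrite subrr.
Qed.

Lemma omega_square : evl 2 2 square_lc = 0.
Proof. exact: (reducesP vs vt vsl vsk two_neq0 _ omega_skew0 square_ok). Qed.

Definition to_omega m n (g : tangle_gen m n) : oterm K m n :=
  match g in tangle_gen m n return oterm K m n with
  | TX => oX K | TCup => ocup K | TCap => ocap K | TY => TScale c (oY K)
  end.
Local Notation G := (tmap to_omega).

Lemma stands_GY : stands c (G (tY K)) lY.
Proof. by rewrite -[c in stands c]mulr1; apply: stands_scale stands_oY. Qed.

Lemma stands_GYhat : stands c (G (tYhat K)) lYhat.
Proof.
have := stands_comp vs vt (tt stands_oI stands_ocap)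
  (stands_tens vs vt stands_GY stands_oI).
by rewrite mul1r mulr1.
Qed.

Local Ltac like j' ms' l r :=
  apply: (stands_similar vs vt vsl vsk (j := j') (ms := ms') l r) => //;
  by rewrite moves_signE ?expr0 ?expr1 ?(mulr1, mul1r) // mulrC.

Lemma to_omega_rel m n (f g : tterm K m n) : tangle_rel f g -> tcl O (G f) = tcl O (G g).
Proof.
have i := stands_oI; have X := stands_oX; have cap := stands_ocap.
have cup := stands_ocup; have Y := stands_GY; have Yhat := stands_GYhat.
have X1 := tt X i; have X2 := tt i X.
have cap1 := tt cap i; have cap2 := tt i cap.
have cup1 := tt cup i; have cup2 := tt i cup.
have Y1 := stands_tens vs vt Y i; have Y2 := stands_tens vs vt i Y.
case=> {m n f g}.
- like 0%N (@nil move) (ct X X) (tt i i).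
- like 0%N (@nil move) (ct (ct X1 X2) X1) (ct (ct X2 X1) X2).
- like 0%N (@nil move) (ct cap1 cup2) i.
- like 0%N (@nil move) (ct cap2 cup1) i.
- like 0%N (@nil move) (ct cap X) cap.
- like 0%N (@nil move) (ct X cup) cup.
- like 0%N (@nil move) (ct cap1 X2) (ct cap2 X1).
- like 0%N (@nil move) (ct X2 cup1) (ct X1 cup2).
- have r := stands_scale 7%:R (stands_id S vs vt 0).
  like 1%N (@nil move) (ct cap cup) r.
- like 0%N [:: Flip 0%N true; Flip 0%N false] (stands_comp vs vt cap1 Y2) Yhat.
- like 0%N (@nil move) (stands_comp vs vt (ct X2 X1) Y2) (stands_comp vs vt Y1 X).
- like 0%N (@nil move) (stands_comp vs vt (ct X1 X2) Y1) (stands_comp vs vt Y2 X).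
- like 0%N [:: Flip 0%N false] (stands_comp vs vt X Y) (stands_scale (-1) Y).
- have [_ y] := stands_comp vs vt Y Yhat.
  have [_ z] := stands_comp vs vt (stands_tens vs vt i Yhat) Y1.
  have [_ r] := stands_sub (stands_sub (stands_int 2 X) (ct cup cap)) stands_oII.
  rewrite [LHS]tcl_add [X in X + _]y [X in _ + X]z [RHS]r mul1r mulr1 c_sqr -scalerDr.
  have := omega_square; set R := lsub _ _.
  have -> : square_lc = lcomp lY lYhat ++ lcomp (ltens lI lYhat) (ltens lY lI) ++ R.
    by [].
  rewrite 2!evl_cat addrA => /eqP; rewrite addr_eq0 => /eqP ->.
  by rewrite scaleN1r opprK scale1r.
Qed.

End FromTangles.

(** * The isomorphism *)
Section Inverses.
Context (K : fieldType) (c : K) (c_sqr : c * c = -1) (two_neq0 : (2%:R : K) != 0).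
Local Notation T := (@tangle_rel K).
Local Notation O := (@omega3_rel K).
Local Notation F := (tmap (to_tangles c)).
Local Notation G := (tmap (@to_omega K c)).
Local Notation ovec := (cls O (oomega K)).

(** A tangle without vertices is sent to the same diagram in the other
    category. *)
Lemma to_omega_interp d m n : dbrauer d -> dsrc d = m -> dtgt d = n ->
  exists f : tterm K m n, cls T f = ev (tangle_brauer K) (tvec K) d /\
    cls O (G f) = ev (omega_brauer K) ovec d.
Proof.
elim: d m n => [||||k|g IHg f IHf|f IHf g IHg] m n.
- by move=> _ <- <-; exists (tX K).
- by move=> _ <- <-; exists (tcup K).
- by move=> _ <- <-; exists (tcap K).
- by [].
- by move=> _ <- <-; exists (TId k).
- move=> /dbrauer_compP [bg bf gf] sf tg.
  have [a [a1 a2]] := IHf m (dtgt f) bf sf erefl.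
  have [b [b1 b2]] := IHg (dtgt f) n bg gf tg.
  by exists (TComp b a); rewrite /= !cls_comp a1 a2 b1 b2.
rewrite dbrauer_tensE => /andP [bf bg] <- <-.
have [a [a1 a2]] := IHf _ _ bf erefl erefl.
have [b [b1 b2]] := IHg _ _ bg erefl erefl.
by exists (TTens a b); rewrite /= !cls_tens a1 a2 b1 b2.
Qed.

Lemma bdiag_sum r s (f : bhom K r s) : f = \sum_D f D *: bdiag K D.
Proof.
apply/ffunP => D; rewrite sum_ffunE.
have e D' : (f D' *: bdiag K D') D = f D' * (D == D')%:R by rewrite !ffunE.
rewrite (bigD1 D) //= e eqxx mulr1 big1 ?addr0 // => D' /negbTE n.
by rewrite e eq_sym n mulr0.
Qed.

Lemma to_omegaK m n (g : omega3_gen K m n) :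
  tcl O (G (to_tangles c g)) = tcl O (TGen g).
Proof.
have Grel := to_omega_rel c_sqr two_neq0.
case: g => [r s f||].
- rewrite /= -/(fmap (rel := T) O (to_omega c) (brauer_map f)) (fmap_sum Grel).
  rewrite [in RHS](bdiag_sum f) -/(brauer_class _) linear_sum; apply: eq_bigr => D _.
  rewrite linearZ; congr (_ *: _); rewrite /drawn (fmap_tcl Grel).
  have [d dd] := drawing_exists D; have [bd sd td _] := dd.
  have [a [a1 a2]] := to_omega_interp bd sd td.
  apply: Arrow_inj; rewrite -[RHS]/(brauer_arrow K D) (brauer_arrow_interp K dd) -a2.
  apply: tcl_arrow; apply: (tmap_eqt Grel).
  by apply/clsP; rewrite a1 (drawing_term_interp (tvec K) dd).
- have i := stands_oI K; have cup := stands_ocup K.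
  have Y1 := stands_tens (ovec_src K) (ovec_tgt K) (stands_GY c) i.
  have l := stands_scale (- c) (stands_comp (ovec_src K) (ovec_tgt K) Y1 cup).
  apply: (stands_similar (ovec_src K) (ovec_tgt K) (ovec_slide K) (ovec_skew K)
    (j := 0) (ms := [::]) l (stands_oomega K)) => //.
  by rewrite moves_signE expr0 !mulr1 mulNr c_sqr opprK.
- have b := stands_add (stands_sub (stands_oX K) (stands_int 2
    (stands1_comp (ovec_src K) (ovec_tgt K) (stands_ocup K) (stands_ocap K)))) (stands_oII K).
  have [_ y] := stands_comp (ovec_src K) (ovec_tgt K) (stands_GY c) (stands_GYhat c).
  have [_ h] := stands_oH K; have [_ b'] := b.
  rewrite [LHS]tcl_add [X in X + _]b' [X in _ + X]y [RHS]h c_sqr !scale1r scaleN1r.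
  by rewrite /lHomega evl_sub.
Qed.

Lemma to_tanglesK m n (g : tangle_gen m n) :
  tcl T (F (to_omega c g)) = tcl T (TGen g).
Proof.
case: g.
- exact: (stands_eq (stands_FX c) (stands_tX K)).
- exact: (stands_eq (stands_Fcup c) (stands_tcup K)).
- exact: (stands_eq (stands_Fcap c) (stands_tcap K)).
have := stands_scale c (stands_FY c); rewrite mulrN c_sqr opprK => y.
exact: (stands_eq y (stands_tY K)).
Qed.

Lemma omega_tangle_iso : linMonIso (Bomega3_7 K) (TGamma K).
Proof.
exact: (presented_iso (to_tangles_rel c_sqr two_neq0) (to_omega_rel c_sqr two_neq0) to_omegaK to_tanglesK).
Qed.
End Inverses.

Theorem theorem4p6 (R : realType) : linMonIso (Bomega3_7 R[i]) (TGamma R[i]).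
Proof.
apply: (@omega_tangle_iso _ 'i); last by rewrite Num.Theory.pnatr_eq0.
by rewrite -expr2 Num.Theory.sqrCi.
Qed.
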